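(* Let $X$ be a compact set in $\mathbb{C}^n$ and let $1\le m\le n$. Then the following conditions are equivalent: (1) $X$ is an $m$-Poisson set, i.e. for every $f\in\mathcal{C}(B_X^m)$ there exists a function $u\in\mathcal{H}_m(X)$ such that $u=f$ on $B_X^m$; (2) for every $z\in X$, the set $\mathcal{J}_z^{b,m}$ contains exactly one measure $P_z^m$; (3) for every $f\in\mathcal{C}(B_X^m)$ we have $PB_{-f}=-PB_f$ on $X$.
   Context: $m$-subharmonic functions on open sets: a $C^2$ function on an open set $U\subseteq\mathbb{C}^n$ is $m$-subharmonic if at each point the elementary symmetric polynomials $\sigma_1,\dots,\sigma_m$ of the eigenvalues of its complex Hessian are nonnegative; in general a subharmonic function $u$ on $U$ is $m$-subharmonic if $dd^cu\wedge dd^cv_1\wedge\dots\wedge dd^cv_{m-1}\wedge(dd^c\|z\|^2)^{n-m}\ge 0$ in the sense of currents for all $C^2$ $m$-subharmonic functions $v_1,\dots,v_{m-1}$ on open subsets of $U$. Thus $m=1$ gives subharmonic functions and $m=n$ gives plurisubharmonic functions. Let $X\subseteq\mathbb{C}^n$ be compact. $\mathcal{SH}_m^o(X)$ is the set of restrictions to $X$ of functions that are $m$-subharmonic and continuous on some neighborhood of $X$. For $z\in X$, $\mathcal{J}_z^m=\mathcal{J}_z^m(X)$ is the set of non-negative regular Borel measures $\mu$ on $X$ with $\mu(X)=1$ and $u(z)\le\int_X u\,d\mu$ for all $u\in\mathcal{SH}_m^o(X)$. $\mathcal{SH}_m(X)$ is the set of upper semicontinuous functions $u$ on $X$ with $u(z)\le\int_X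 u\,d\mu$ for all $z\in X$ and all $\mu\in\mathcal{J}_z^m(X)$. $\mathcal{H}_m(X)$ is the set of functions $h:X\to\mathbb{R}$ such that both $h$ and $-h$ belong to $\mathcal{SH}_m(X)$. $\mathcal{C}(E)$ denotes the continuous real-valued functions on $E$. The Choquet boundary is $O_X^m=\{z\in X:\mathcal{J}_z^m=\{\delta_z\}\}$, and the Šilov boundary $B_X^m$ is the topological closure of $O_X^m$. For $z\in X$, $\mathcal{J}_z^{b,m}=\{\mu\in\mathcal{J}_z^m:\operatorname{supp}\mu\subseteq B_X^m\}$. For $f\in\mathcal{C}(B_X^m)$ the Perron-Bremermann envelope is $PB_f(z)=\sup\{v(z):v\in\mathcal{SH}_m(X)\cap\mathcal{C}(X),\ v\le f\text{ on }B_X^m\}$, $z\in X$. *)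

(* Defs.v *)
From HB Require Import structures.
From mathcomp Require Import all_boot all_order all_algebra all_fingroup.
From mathcomp Require Import spectral complex.
From mathcomp Require Import all_classical all_reals all_analysis.

Set Implicit Arguments.
Unset Strict Implicit.
Unset Printing Implicit Defensive.
Import Order.TTheory GRing.Theory Num.Theory.
Import numFieldNormedType.Exports.

Local Open Scope classical_set_scope.
Local Open Scope ring_scope.

(* C^n as a real normed space: the pair (x, y) stands for z = x + iy.  Its norm
   is the sup norm, which has the same open sets as the Euclidean norm.       *)
Notation Cn R n := ('rV[R]_n * 'rV[R]_n)%type.

Notation borelCn R n := (g_sigma_algebraType (@open (Cn R n))).

Section lebesgue_Cn.
Context {R : realType}.
Local Notation Rm := (measurableTypeR R).

Definition tcons n (p : Rm * n.-tuple Rm) : n.+1.-tuple Rm :=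
  [tuple of p.1 :: p.2].

Lemma measurable_tcons n : measurable_fun setT (@tcons n).
Proof. exact: measurable_cons. Qed.

Fixpoint lebesgue_tuple n : {measure set (n.-tuple Rm) -> \bar R} :=
  match n with
  | 0 => \d_([tuple] : 0.-tuple Rm)
  | n'.+1 => measure_function_pushforward__canonical__measure_function_Measure
       (lebesgue_measure \x^ lebesgue_tuple n')%E (@measurable_tcons n')
  end.

Definition tuple_Cn n (t : (n + n).-tuple Rm) : borelCn R n :=
  (\row_i tnth t (lshift n i), \row_i tnth t (rshift n i)).

Lemma measurable_tuple_Cn n : measurable_fun setT (@tuple_Cn n).
Proof.
apply: (@measurability _ _ _ _ setT (@tuple_Cn n) (@open (Cn R n))) => //.
move=> _ [A oA <-]; rewrite setTI.
pose box (q : (n + n).-tuple rat) (k : nat) : set ((n + n).-tuple Rm) :=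
  \bigcap_(i in [set: 'I_(n + n)])
    ((fun t => tnth t i) @^-1` ball (ratr (tnth q i) : R) k.+1%:R^-1).
have mbox q k : measurable (box q k).
  apply: fin_bigcap_measurable => // i _.
  rewrite -[X in measurable X]setTI; apply: measurable_tnth => //.
  by rewrite ball_itv; exact: measurable_itv.
rewrite (_ : _ @^-1` A = \bigcup_(p in
    [set p : (n + n).-tuple rat * nat | box p.1 p.2 `<=` @tuple_Cn n @^-1` A])
    box p.1 p.2); last first.
  apply/seteqP; split => [t At|t [p /= pA /pA]//].
  have /nbhs_ballP[e /= e0 eA] : nbhs (tuple_Cn t : Cn R n) A.
    by apply: open_nbhs_nbhs.
  have [k ke] : exists k : nat, k.+1%:R^-1 < e / 2.
    have [k] := ltr_add_invr (divr_gt0 e0 (ltr0Sn R 1)).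
    by rewrite add0r; exists k.
  have k0 : 0 < k.+1%:R^-1 :> R by rewrite invr_gt0.
  have /choice[q qP] (i : 'I_(n + n)) : exists q : rat,
      `|ratr q - tnth t i| < k.+1%:R^-1 :> R.
    have /rat_in_itvoo[q] : tnth t i - k.+1%:R^-1 < tnth t i + k.+1%:R^-1 :> R.
      by rewrite ltrD2l gtrN.
    by rewrite in_itv/= => qt; exists q; rewrite ltr_distl.
  exists ([tuple q i | i < n + n], k) => [/= s sbox|i _ /=]; last first.
    by rewrite tnth_mktuple /ball/= qP.
  have ts i : `|tnth t i - tnth s i| < e.
    have := sbox i I; rewrite /= tnth_mktuple /ball/= => si.
    rewrite (le_lt_trans (ler_distD (ratr (q i)) _ _))// [ltRHS](splitr e).
    by rewrite distrC ltrD// (lt_trans _ ke).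
  by apply: eA; split; split => //= a b; rewrite !mxE; exact: ts.
rewrite bigcup_mkcond; apply: countable_bigcupT_measurable => // p.
by case: ifP.
Qed.

Definition lebesgue_Cn n : {measure set (borelCn R n) -> \bar R} :=
  measure_function_pushforward__canonical__measure_function_Measure
    (lebesgue_tuple (n + n)) (@measurable_tuple_Cn n).

End lebesgue_Cn.

Section subharmonic.
Context {R : realType} {n : nat}.
Implicit Types (U V X : set (Cn R n)) (z : Cn R n).

Definition normsq z : R := \sum_(j < n) (z.1 0 j ^+ 2 + z.2 0 j ^+ 2).

(* Upper semicontinuity on a set, for functions with values in [-oo, +oo[.
   A function on E is represented by a total function whose values outside E
   are irrelevant.                                                            *)
Definition usc_on (E : set (Cn R n)) (u : Cn R n -> \bar R) : Prop :=
  forall z, E z -> (u z < +oo)%E /\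
    forall a : R, (u z < a%:E)%E ->
      \forall y \near within E (nbhs z), (u y < a%:E)%E.

Definition subharmonic U (u : Cn R n -> \bar R) : Prop :=
  [/\ open U, usc_on U u,
      forall z, U z -> exists2 y, connected_component U z y & u y <> -oo%E
    & forall (a : Cn R n) (r : R), 0 < r ->
        let B := [set z | normsq (z - a) <= r ^+ 2] in
        B `<=` U ->
        (u a * lebesgue_Cn n B <= \int[lebesgue_Cn n]_(z in B) u z)%E].

Fixpoint Ck (k : nat) U (f : Cn R n -> R) : Prop :=
  (forall z, U z -> {for z, continuous f}) /\
  if k is k'.+1 then
    forall e : Cn R n,
      (forall z, U z -> derivable f z e) /\ Ck k' U ('D_e f)
  else True.

Definition dirx (j : 'I_n) : Cn R n := (delta_mx 0 j, 0).
Definition diry (j : 'I_n) : Cn R n := (0, delta_mx 0 j).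

(* The complex Hessian (d^2 f / dz_j dzbar_k)_{j,k}, where
   d/dz_j = (d/dx_j - i d/dy_j) / 2 and d/dzbar_k = (d/dx_k + i d/dy_k) / 2.  *)
Definition hessC (f : Cn R n -> R) z : 'M[R[i]]_n :=
  let D2 e e' := 'D_e ('D_e' f) z in
  \matrix_(j, k)
    Complex ((D2 (dirx j) (dirx k) + D2 (diry j) (diry k)) / 4)
            ((D2 (dirx j) (diry k) - D2 (diry j) (dirx k)) / 4).

Definition elem_sym (k : nat) (l : 'rV[R[i]]_n) : R[i] :=
  \sum_(A : {set 'I_n} | #|A| == k) \prod_(i in A) l 0 i.

(* [spectral_diag] lists the eigenvalues, with multiplicity, of a normal
   matrix; the complex Hessian of a C^2 function is Hermitian.  In R[i],
   0 <= w means that w is real and nonnegative.                               *)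
Definition C2_msh (m : nat) V (v : Cn R n -> R) : Prop :=
  [/\ open V, Ck 2 V v
    & forall z, V z -> forall k, (1 <= k <= m)%N ->
        0 <= elem_sym k (spectral_diag (hessC v z))].

(* For (1,1)-forms alpha_k = \sum_(p, q) A k p q (i dz_p /\ dzbar_q), k < n,
   the product alpha_0 /\ ... /\ alpha_(n-1) equals
     wedge_coef A * \prod_p (i dz_p /\ dzbar_p),
   and \prod_p (i dz_p /\ dzbar_p) is 2^n times the volume form: only the terms
   where p and q both run through a permutation of the indices survive, and
   reordering the dz's and the dzbar's costs the product of the two signs.    *)
Definition wedge_coef (A : 'I_n -> 'M[R[i]]_n) : R[i] :=
  \sum_(s : 'S_n) \sum_(t : 'S_n)
    (-1) ^+ s * (-1) ^+ t * \prod_(k < n) A k (s k) (t k).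

(* The density with respect to Lebesgue measure of
     dd^c phi /\ dd^c v_1 /\ ... /\ dd^c v_(m-1) /\ (dd^c |z|^2)^(n-m),
   up to a positive constant depending on n and on the normalization of dd^c:
   dd^c f is a positive multiple of
   \sum_(p, q) (hessC f) p q (i dz_p /\ dzbar_q).                             *)
Definition ddc_density (m : nat) (phi : Cn R n -> R)
    (v : nat -> Cn R n -> R) z : R :=
  complex.Re (wedge_coef (fun k : 'I_n =>
    if k == 0%N :> nat then hessC phi z
    else if (k < m)%N then hessC (v k) z
    else hessC normsq z)).

Definition test_fun V (phi : Cn R n -> R) : Prop :=
  [/\ forall k, Ck k setT phi,
      forall z, 0 <= phi z
    & exists K, [/\ compact K, K `<=` V & forall z, ~ K z -> phi z = 0]].

(* The coefficients of dd^c u are distributions of order 2 and those of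
   T := dd^c v_1 /\ ... /\ dd^c v_(m-1) /\ (dd^c |z|^2)^(n-m) are merely
   continuous; as T is closed, the current dd^c u /\ T is dd^c (u T), that is,
     <dd^c u /\ T, phi> = \int u dd^c phi /\ T.                               *)
Definition msh (m : nat) U (u : Cn R n -> \bar R) : Prop :=
  subharmonic U u /\
  forall V (v : nat -> Cn R n -> R), open V -> V `<=` U ->
    (forall k, (1 <= k < m)%N -> C2_msh m V (v k)) ->
    forall phi, test_fun V phi ->
      (0 <= \int[lebesgue_Cn n]_(z in V)
              (u z * (ddc_density m phi v z)%:E))%E.

Definition SHo (m : nat) X : set (Cn R n -> R) :=
  [set u | exists U (w : Cn R n -> R),
     [/\ open U, X `<=` U, msh m U (EFin \o w),
         forall z, U z -> {for z, continuous w}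
       & forall z, X z -> u z = w z]].

End subharmonic.

Section jensen.
Context {R : realType} {n : nat}.
Implicit Types (X : set (Cn R n)) (z : Cn R n).

Definition regular_borel (mu : set (borelCn R n) -> \bar R) : Prop :=
  forall A : set (borelCn R n), measurable A ->
    mu A = ereal_inf
      [set mu V | V in [set V | open (V : set (Cn R n)) /\ A `<=` V]] /\
    mu A = ereal_sup
      [set mu K | K in [set K | compact (K : set (Cn R n)) /\ K `<=` A]].

(* Measures are functions on all sets; only their values on Borel sets count. *)
Definition eq_on_borel (mu nu : set (borelCn R n) -> \bar R) : Prop :=
  forall A : set (borelCn R n), measurable A -> mu A = nu A.

Definition measure_supp (mu : set (borelCn R n) -> \bar R) : set (Cn R n) :=
  [set z | forall V : set (Cn R n), open V -> V z -> (0 < mu V)%E].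

(* A Borel probability measure on the compact set X is represented by a Borel
   probability measure on C^n that gives X measure 1.                         *)
Definition jensen_measures (m : nat) X z : set (probability (borelCn R n) R) :=
  [set mu : probability (borelCn R n) R | [/\ mu X = 1%E, regular_borel mu
    & forall u, SHo m X u -> ((u z)%:E <= \int[mu]_(x in X) (u x)%:E)%E]].

Definition SH (m : nat) X : set (Cn R n -> \bar R) :=
  [set u | usc_on X u /\
     forall z, X z -> forall mu, jensen_measures m X z mu ->
       (u z <= \int[mu]_(x in X) u x)%E].

Definition Hm (m : nat) X : set (Cn R n -> R) :=
  [set h : Cn R n -> R | SH m X (EFin \o h) /\ SH m X (EFin \o (\- h))].

Definition choquet_boundary (m : nat) X : set (Cn R n) :=
  [set z | X z /\ forall mu,
     jensen_measures m X z mu <-> eq_on_borel mu \d_(z : borelCn R n)].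

Definition silov_boundary (m : nat) X : set (Cn R n) :=
  closure (choquet_boundary m X).

Definition jensen_boundary (m : nat) X z : set (probability (borelCn R n) R) :=
  [set mu : probability (borelCn R n) R |
     jensen_measures m X z mu /\ measure_supp mu `<=` silov_boundary m X].

Definition PB (m : nat) X (f : Cn R n -> R) z : \bar R :=
  ereal_sup [set (v z)%:E | v in
    [set v : Cn R n -> R | [/\ SH m X (EFin \o v), {within X, continuous v}
               & forall x, silov_boundary m X x -> v x <= f x]]].

End jensen.

(* Main.v *)
Require Import Defs.
From HB Require Import structures.
From mathcomp Require Import all_boot all_order all_algebra all_fingroup.
From mathcomp Require Import complex.
From mathcomp Require Import all_classical all_reals all_analysis.
From mathcomp Require Import measurable_realfun.
From mathcomp Require Import ring lra.

(* Since [PB] is a supremum of continuous members of SH_m(X), Hahn-Banach and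
   Riesz on the Shilov boundary give the Edwards duality
     PB_f(z) = \int f dmu   for some mu in J_z^{b,m},
   while PB_f(z) <= \int f dnu for all nu in J_z^{b,m}.  Hence J_z^{b,m} is a
   singleton iff PB_{-f}(z) = - PB_f(z) for every f, and then PB_f, being both
   upper and lower semicontinuous, is the m-Poisson extension of f; conversely
   an extension u in H_m(X) forces \int f dmu = u(z) for every mu in J_z^{b,m}.

   The duality needs the maximum principle on the Choquet boundary: a nonempty
   compact A that carries the Jensen measures of its points keeps this property
   when shrunk to the maximum set of a function in SH_m(X), and the real and
   imaginary parts of the coordinates shrink it to one point.  That these are
   m-subharmonic in the sense of currents amounts to
   \int w dd^c phi /\ dd^c v_1 /\ ... = 0 for real-linear w.  As v_j is only C^2,
   this is derived from finite differences: the discrete wedge product of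
   differentials is a null Lagrangian, because the cochain d f_1 \cup ... \cup d f_k
   is closed, and dividing by powers of the mesh gives the vanishing in the limit. *)

Set Implicit Arguments.
Unset Strict Implicit.
Unset Printing Implicit Defensive.
Import Order.TTheory GRing.Theory Num.Theory.
Import numFieldNormedType.Exports.
Local Open Scope classical_set_scope.
Local Open Scope ring_scope.

(** * Lebesgue measure on C^n *)

(** Two obstacles shape the development. The vanishing for real-linear [w] calls for two
    integrations by parts on data that are only [C^2]. Expanding every complex Hessian in real
    directions leaves signed double sums over permutations; freezing one of the two permutations
    leaves a determinant of first derivatives of [C^1] functions, so both integrations by parts are
    instances of one first-order statement. The first lets a derivative fall on [w]; as the
    differential of [w] is constant, what remains is again such a determinant, with the roles of the
    permutations exchanged. The other obstacle is to extract a measure from a functional.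
    Hahn-Banach is applied to all functions bounded on the Shilov boundary, not only to the
    continuous ones, so that the functional can be evaluated on indicators of arbitrary sets.
    Transported to the Cantor space, which maps onto the boundary and on whose clopen sets countable
    additivity is automatic, it gives a premeasure; the measure sought is the image of its
    extension. *)

Section lebesgue_affine.
Context {R : realType}.
Local Notation Rm := (measurableTypeR R).
Implicit Types (b : bool).

(** The sign bit covers with one family the translations, needed for summation by parts, and the
    reflections, needed for the mean value property of real-linear functions. *)
Definition signed_shift b (a x : R) : R := a + (-1) ^+ b * x.

Lemma measurable_signed_shift b a :
  measurable_fun [set: Rm] (signed_shift b a : Rm -> Rm).
Proof.
by apply: measurable_funD => //; exact: measurable_funM.
Qed.

Lemma lebesgue_measure_signed_shift b a (A : set Rm) : measurable A ->
  lebesgue_measure ((signed_shift b a : Rm -> Rm) @^-1` A) = lebesgue_measure A.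
Proof.
move=> mA; apply/esym.
pose mu := measure_function_pushforward__canonical__measure_function_Measure
    (@lebesgue_measure R) (measurable_signed_shift b a).
apply: (@lebesgue_measure_unique R mu) => // X [[u v] _ <-] /=.
rewrite /pushforward /signed_shift.
(* A reflection exchanges the closed and the open end of a half-open interval, so the two signs are
   treated apart; the length is the same. *)
case: b @mu => mu; rewrite ?expr1 ?expr0.
  rewrite (_ : _ @^-1` _ = `[a - v, a - u[%classic); last first.
    apply/seteqP; split => x /=; rewrite !in_itv /=; lra.
  rewrite !lebesgue_measure_itv /= !lte_fin.
  rewrite ltrD2l ltrN2; case: ifP => // _; rewrite -!EFinB; congr EFin; ring.
rewrite (_ : _ @^-1` _ = `]u - a, v - a]%classic); last first.
  apply/seteqP; split => x /=; rewrite !in_itv /=; lra.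
rewrite !lebesgue_measure_itv /= !lte_fin.
rewrite ltrD2r; case: ifP => // _; rewrite -!EFinB; congr EFin; ring.
Qed.

Definition tuple_shift b n (a : 'I_n -> R) (t : n.-tuple Rm) : n.-tuple Rm :=
  [tuple signed_shift b (a i) (tnth t i) | i < n].

Lemma measurable_tuple_shift b n (a : 'I_n -> R) :
  measurable_fun setT (tuple_shift b a).
Proof.
apply/measurable_fun_tnthP => i.
rewrite (_ : _ \o _ = signed_shift b (a i) \o (fun t : n.-tuple Rm => tnth t i));
  last by apply/funext => t /=; rewrite tnth_mktuple.
apply: measurableT_comp; first exact: measurable_signed_shift.
exact: measurable_tnth.
Qed.

Lemma tuple_shift_tcons b n (a : 'I_n.+1 -> R) (x : Rm) (t : n.-tuple Rm) :
  tuple_shift b a (tcons (x, t)) =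
  tcons (signed_shift b (a ord0) x, tuple_shift b (a \o lift ord0) t).
Proof.
apply: eq_from_tnth => i; rewrite tnth_mktuple.
case: (unliftP ord0 i) => [j ->|->]; last by rewrite !tnth0.
by rewrite !tnthS tnth_mktuple.
Qed.

(** Fubini along the recursive definition of [lebesgue_tuple]: invariance on the line settles the
    length of the section in the head, and the induction hypothesis, read as equality of a
    pushforward with the measure itself, settles the integral over the tail. *)
Lemma lebesgue_tuple_shift b n (a : 'I_n -> R) (A : set (n.-tuple Rm)) :
  measurable A ->
  lebesgue_tuple n (tuple_shift b a @^-1` A) = lebesgue_tuple n A.
Proof.
elim: n a A => [|n IH] a A mA /=.
  rewrite (_ : _ @^-1` A = A)//.
  by apply/seteqP; split => t /=; rewrite !(tuple0 t) (tuple0 (tuple_shift _ _ _)).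
rewrite /pushforward /product_measure2 /=.
pose G (t : n.-tuple Rm) := lebesgue_measure (ysection (@tcons R n @^-1` A) t).
have mtA : measurable (@tcons R n @^-1` A).
  by rewrite -[X in measurable X]setTI; exact: measurable_tcons.
have mG : measurable_fun setT G by exact: measurable_fun_ysection.
transitivity (\int[lebesgue_tuple n]_t G (tuple_shift b (a \o lift ord0) t))%E.
  apply: eq_integral => t _ /=.
  rewrite /G -[RHS](lebesgue_measure_signed_shift b (a ord0)); last first.
    exact: measurable_ysection.
  congr lebesgue_measure; apply/seteqP; split => x; rewrite /ysection /= !inE /=;
    by rewrite tuple_shift_tcons.
pose phi := tuple_shift b (a \o lift ord0).
pose mu := measure_function_pushforward__canonical__measure_function_Measure
    (lebesgue_tuple n) (measurable_tuple_shift b (a \o lift ord0)).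
rewrite -(@ge0_integral_pushforward _ _ _ _ R phi _ (lebesgue_tuple n) setT G)//;
  last exact: measurable_tuple_shift.
by apply: (@eq_measure_integral _ _ _ _ _ mu) => B mB _; exact: IH.
Qed.

Lemma measurable_tuple_box n (r : R) :
  measurable [set t : n.-tuple Rm | forall i, (`|tnth t i| <= r)%R].
Proof.
rewrite (_ : [set _ | _] = \bigcap_(i in [set: 'I_n])
    ((fun t : n.-tuple Rm => tnth t i) @^-1` `[- r, r]%classic)).
  apply: fin_bigcap_measurable => // i _.
  by rewrite -[X in measurable X]setTI; exact: measurable_tnth.
apply/seteqP; split => t /= h i; first by move=> _ /=; rewrite in_itv /= -ler_norml.
by have := h i I; rewrite /= in_itv /= -ler_norml.
Qed.

Lemma lebesgue_tuple_box n (r : R) : 0 <= r ->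
  (lebesgue_tuple n [set t : n.-tuple Rm | forall i, (`|tnth t i| <= r)%R]
    < +oo)%E.
Proof.
move=> r0; elim: n => [|n IH] /=.
  by rewrite diracE ltry.
rewrite /pushforward /product_measure2 /=.
set D := [set t : n.-tuple Rm | forall i, (`|tnth t i| <= r)%R] in IH *.
have mD : measurable D by exact: measurable_tuple_box.
set D' := _ @^-1` _.
have mD' : measurable D'.
  rewrite -[X in measurable X]setTI; apply: measurable_tcons => //.
  exact: measurable_tuple_box.
apply: (@le_lt_trans _ _ (\int[lebesgue_tuple n]_(t in D) (cst (r - - r)%:E) t)%E);
  last first.
  by rewrite integral_cst// lte_mul_pinfty// lee_fin subr_ge0 (le_trans _ r0)// oppr_le0.
rewrite [leRHS]integral_mkcond; apply: ge0_le_integral => //=.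
- exact: measurable_fun_ysection.
- by apply/(measurable_restrictT _ mD); exact: measurable_cst.
- move=> t _; rewrite /patch; case: ifPn => [/set_mem Dt|Dt].
    have -> : (r - - r)%:E = lebesgue_measure (`[- r, r]%classic : set Rm).
      rewrite lebesgue_measure_itv /= lte_fin; case: ltgtP => //.
        by move=> h; exfalso; lra.
      by move=> ->; rewrite subrr.
    apply: le_measure; rewrite ?inE; first exact: measurable_ysection.
      exact: measurable_itv.
    move=> x; rewrite /ysection /= inE /= => /(_ ord0).
    by rewrite tnth0 in_itv /= -ler_norml.
  rewrite (_ : ysection _ _ = set0) ?measure0//.
  apply/seteqP; split => // x; rewrite /ysection /= inE /= => h.
  move/negP: Dt; apply; apply/mem_set => i.
  by have := h (lift ord0 i); rewrite tnthS.
Qed.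

End lebesgue_affine.

(** * Borel sets of C^n, and invariance of Lebesgue measure under translations and reflections *)

Section borel_Cn.
Context {R : realType} {n : nat}.
Local Notation Rm := (measurableTypeR R).
Local Notation Cn := (Cn R n).
Local Notation borelCn := (borelCn R n).
Local Notation lambda := (@lebesgue_Cn R n).
Implicit Types (b : bool) (a z : Cn).

Lemma open_borel (A : set Cn) : open A -> measurable (A : set borelCn).
Proof. by move=> oA; exact: sub_sigma_algebra. Qed.

Lemma closed_borel (A : set Cn) : closed A -> measurable (A : set borelCn).
Proof.
by move=> cA; rewrite -(setCK A); apply: measurableC; apply: open_borel;
  exact: closed_openC.
Qed.

Lemma Cn_hausdorff : hausdorff_space Cn.
Proof. exact: norm_hausdorff. Qed.

Lemma compact_borel (A : set Cn) : compact A -> measurable (A : set borelCn).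
Proof. by move=> /(compact_closed Cn_hausdorff); exact: closed_borel. Qed.

Lemma open_measurable_fun d (T : measurableType d) (f : T -> borelCn) :
  (forall A : set Cn, open A -> measurable (f @^-1` A)) ->
  measurable_fun [set: T] f.
Proof.
move=> mf; apply: (@measurability _ _ _ _ setT f (@open Cn)) => //.
by move=> _ [A oA <-]; rewrite setTI; exact: mf.
Qed.

Lemma continuous_measurable_real (f : Cn -> R) : continuous f ->
  measurable_fun [set: borelCn] (f : borelCn -> Rm).
Proof.
move=> cf; apply: (measurability _ (RGenOpens.measurableE R)) => //.
move=> _ [_ [a [b ->] <-]]; rewrite setTI; apply: open_borel.
by apply: open_comp => //; exact: interval_open.
Qed.

Definition Cn_shift b a z : Cn := a + (-1) ^+ b *: z.

Lemma measurable_Cn_shift b a :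
  measurable_fun [set: borelCn] (Cn_shift b a : borelCn -> borelCn).
Proof.
apply: open_measurable_fun => A oA; apply: open_borel.
apply: open_comp => // z _; apply: continuousD; first exact: cst_continuous.
exact: scaler_continuous.
Qed.

Lemma lebesgue_Cn_shift b a (A : set borelCn) : measurable A ->
  lambda ((Cn_shift b a : borelCn -> borelCn) @^-1` A) = lambda A.
Proof.
move=> mA; rewrite /lebesgue_Cn /= /pushforward.
pose a' (i : 'I_(n + n)) : R :=
  match fintype.split i with inl j => a.1 0 j | inr j => a.2 0 j end.
rewrite -[RHS](lebesgue_tuple_shift b a'); last first.
  by rewrite -[X in measurable X]setTI; exact: measurable_tuple_Cn.
congr (lebesgue_tuple _ _); apply/seteqP; split => t /=;
  suff -> : Cn_shift b a (tuple_Cn t) = tuple_Cn (tuple_shift b a' t) by [].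
- rewrite /Cn_shift /tuple_Cn; congr pair; apply/rowP => i;
    rewrite !mxE tnth_mktuple /signed_shift /a'.
    by rewrite -[lshift _ _]/(unsplit (inl i)) unsplitK.
  by rewrite -[rshift _ _]/(unsplit (inr i)) unsplitK.
- rewrite /Cn_shift /tuple_Cn; congr pair; apply/rowP => i;
    rewrite !mxE tnth_mktuple /signed_shift /a'.
    by rewrite -[lshift _ _]/(unsplit (inl i)) unsplitK.
  by rewrite -[rshift _ _]/(unsplit (inr i)) unsplitK.
Qed.

Lemma lebesgue_Cn_bounded (r : R) (A : set borelCn) : measurable A ->
  (forall z : Cn, A z -> `|z| <= r) -> (lambda A < +oo)%E.
Proof.
move=> mA Ar; have [r0|r0] := leP 0 r; last first.
  rewrite (_ : A = set0) ?measure0//; apply/seteqP; split => // z /Ar.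
  by move=> /(le_trans (normr_ge0 _)); rewrite leNgt r0.
apply: le_lt_trans (lebesgue_tuple_box (n + n) r0); rewrite /lebesgue_Cn /=.
rewrite /pushforward; apply: le_measure; rewrite ?inE.
- by rewrite -[X in measurable X]setTI; exact: measurable_tuple_Cn.
- exact: measurable_tuple_box.
- move=> t /= /Ar; rewrite /tuple_Cn prod_normE /= ge_max => /andP[h1 h2] i.
  case: (fintype.splitP i) => j ij.
    rewrite (_ : i = lshift n j); last exact/val_inj.
    apply: le_trans h1; rewrite /Num.norm /= mx_normrE.
    by apply: le_trans (le_bigmax _ _ (0, j)); rewrite /= mxE.
  rewrite (_ : i = rshift n j); last exact/val_inj.
  apply: le_trans h2; rewrite /Num.norm /= mx_normrE.
  by apply: le_trans (le_bigmax _ _ (0, j)); rewrite /= mxE.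
Qed.

Lemma integral_Cn_shift b a (f : borelCn -> \bar R) :
  measurable_fun setT f ->
  lambda.-integrable setT (f \o Cn_shift b a) ->
  (\int[lambda]_z f (Cn_shift b a z) = \int[lambda]_z f z)%E.
Proof.
move=> mf If.
rewrite -(@integral_pushforward _ _ borelCn borelCn R (Cn_shift b a) _ lambda setT f)//;
  last exact: measurable_Cn_shift.
pose mu := measure_function_pushforward__canonical__measure_function_Measure
    lambda (measurable_Cn_shift b a).
by apply: (@eq_measure_integral _ _ _ _ _ mu) => B mB _; exact: lebesgue_Cn_shift.
Qed.

End borel_Cn.

(** * Integration of bounded functions with bounded support *)

Section bounded_support.
Context {R : realType} {n : nat}.
Local Notation Cn := (Cn R n).
Local Notation borelCn := (borelCn R n).
Local Notation lambda := (@lebesgue_Cn R n).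
Implicit Types (f g : Cn -> R) (a : Cn) (b : bool).

(** One constant bounds both the values and the radius of the support. Measurability takes the place
    of continuity because functions cut off sharply, to a tube or to a ball, have to be included. *)
Definition bounded_support f := measurable_fun [set: borelCn] (f : borelCn -> R) /\
  exists M : R, (forall z, `|f z| <= M) /\ (forall z, M < `|z| -> f z = 0).

Lemma bounded_supportM f g : bounded_support f -> bounded_support g ->
  bounded_support (f \* g).
Proof.
move=> [mf [M [fM f0]]] [mg [N [gN g0]]]; split; first exact: measurable_funM.
exists (Num.max M (M * N)); split => z.
  rewrite normrM (le_trans (ler_pM _ _ (fM z) (gN z)))//.
  by rewrite le_max lexx orbT.
by rewrite gt_max => /andP[/f0 /= -> _]; rewrite mul0r.
Qed.

Lemma bounded_supportD f g : bounded_support f -> bounded_support g ->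
  bounded_support (f \+ g).
Proof.
move=> [mf [M [fM f0]]] [mg [N [gN g0]]]; split; first exact: measurable_funD.
have M0 : 0 <= M by exact: le_trans (fM 0).
have N0 : 0 <= N by exact: le_trans (gN 0).
exists (M + N); split => z.
  by rewrite (le_trans (ler_normD _ _))// lerD.
move=> h; rewrite /= f0 ?g0 ?addr0//.
  by apply: le_lt_trans h; rewrite lerDr.
by apply: le_lt_trans h; rewrite lerDl.
Qed.

Lemma bounded_support0 : bounded_support (cst 0).
Proof.
split; first exact: measurable_cst.
by exists 0; split => // z; rewrite normr0.
Qed.

Lemma bounded_supportZ c f : bounded_support f ->
  bounded_support (fun z => c * f z).
Proof.
move=> [mf [M [fM f0]]]; split; first exact: measurable_funM.
exists (Num.max M (`|c| * M)); split => z.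
  by rewrite normrM le_max ler_wpM2l ?orbT.
by rewrite gt_max => /andP[/f0 -> _]; rewrite mulr0.
Qed.

Lemma bounded_supportB f g : bounded_support f -> bounded_support g ->
  bounded_support (f \- g).
Proof.
move=> hf /(bounded_supportZ (-1)) hg; have := bounded_supportD hf hg.
by congr bounded_support; apply/funext => z /=; rewrite mulN1r.
Qed.

Lemma bounded_support_sum I (r : seq I) (P : pred I) (F : I -> Cn -> R) :
  (forall i, P i -> bounded_support (F i)) ->
  bounded_support (fun z => \sum_(i <- r | P i) F i z).
Proof.
move=> hF; elim: r => [|i r IH].
  by under [X in bounded_support X]eq_fun do rewrite big_nil;
    exact: bounded_support0.
have [Pi|nPi] := boolP (P i); last first.
  by under [X in bounded_support X]eq_fun do rewrite big_cons (negbTE nPi).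
under [X in bounded_support X]eq_fun do rewrite big_cons Pi.
exact: (bounded_supportD (hF i Pi) IH).
Qed.

Lemma bounded_supportM_prod k g (F : 'I_k -> Cn -> R) :
  bounded_support g -> (forall i, bounded_support (F i)) ->
  bounded_support (fun z => g z * \prod_(i < k) F i z).
Proof.
move=> hg; elim: k F => [|k IH] F hF.
  by under eq_fun do rewrite big_ord0 mulr1.
under eq_fun do rewrite big_ord_recr /= mulrA.
by apply: bounded_supportM => //; exact: IH.
Qed.

Lemma bounded_support_shift b a f : bounded_support f ->
  bounded_support (f \o Cn_shift b a).
Proof.
move=> [mf [M [fM f0]]]; split.
  apply: (@measurableT_comp _ _ _ borelCn borelCn) => //.
  exact: measurable_Cn_shift.
have M0 : 0 <= M by exact: le_trans (fM 0).
exists (M + `|a|); split => z.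
  by apply: (le_trans (fM _)); rewrite lerDl.
move=> h; apply: f0; rewrite /Cn_shift.
rewrite -(ltrD2r `|a|) (lt_le_trans h)//.
have -> : `|z| = `|(a + (-1) ^+ b *: z) - a|.
  by rewrite addrAC subrr add0r normrZ normr_sign mul1r.
exact: ler_normB.
Qed.

Lemma bounded_support_translate a f : bounded_support f ->
  bounded_support (fun z => f (z + a)).
Proof.
move=> /(bounded_support_shift false a); congr bounded_support.
by apply/funext => z /=; rewrite /Cn_shift expr0 scale1r addrC.
Qed.

Lemma bounded_support_integrable f : bounded_support f ->
  lambda.-integrable setT (EFin \o f).
Proof.
move=> [mf [M [fM f0]]].
pose A : set borelCn := [set z : Cn | `|z| <= M].
have mA : measurable A.
  apply: closed_borel.
  have -> : A = (fun z : Cn => `|z|) @^-1` [set x | x <= M] by [].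
  apply: closed_comp; last exact: closed_le.
  by move=> z _; exact: norm_continuous.
have lA : (lambda A < +oo)%E by exact: (lebesgue_Cn_bounded (r := M)).
apply: (@le_integrable _ borelCn _ _ _ measurableT _
  (EFin \o (M \o* \1_A)%R)).
- exact/measurable_EFinP.
- move=> z _ /=; rewrite lee_fin; have [zM|zM] := leP `|z| M.
    by rewrite indicE mem_set// mulr1n mul1r (le_trans (fM _))// ler_norm.
  by rewrite f0// normr0.
- apply/integrableP; split.
    by apply/measurable_EFinP/measurable_funM.
  have M0 : 0 <= M by exact: le_trans (fM 0).
  under eq_integral.
    move=> z _; rewrite /= ger0_norm ?mulr_ge0// mulrC EFinM; over.
  rewrite ge0_integralZl//; last by apply/measurable_EFinP.
  rewrite integral_indic// setIT lte_mul_pinfty//.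
Qed.

Lemma Rintegral_bounded_support_sum I (r : seq I) (P : pred I) (F : I -> Cn -> R) :
  (forall i, P i -> bounded_support (F i)) ->
  (\int[lambda]_z (\sum_(i <- r | P i) F i z) =
   \sum_(i <- r | P i) \int[lambda]_z F i z)%R.
Proof.
move=> hF; elim: r => [|i r IH].
  under eq_Rintegral do rewrite big_nil.
  by rewrite big_nil Rintegral_cst// mul0r.
have [Pi|nPi] := boolP (P i); last first.
  under eq_Rintegral do rewrite big_cons (negbTE nPi).
  by rewrite IH big_cons (negbTE nPi).
under eq_Rintegral do rewrite big_cons Pi.
rewrite RintegralD//; first by rewrite IH big_cons Pi.
  by apply: bounded_support_integrable; exact: hF.
by apply: bounded_support_integrable; exact: bounded_support_sum.
Qed.

Lemma Rintegral_Cn_shift b a f : bounded_support f ->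
  (\int[lambda]_z f (Cn_shift b a z) = \int[lambda]_z f z)%R.
Proof.
move=> hf; rewrite /Rintegral; congr fine.
rewrite -[RHS](@integral_Cn_shift _ _ b a)//.
  by apply/measurable_EFinP; case: hf.
exact: (bounded_support_integrable (bounded_support_shift b a hf)).
Qed.

Lemma Rintegral_translate a f : bounded_support f ->
  (\int[lambda]_z f (z + a) = \int[lambda]_z f z)%R.
Proof.
move=> /(Rintegral_Cn_shift false a) <-; apply: eq_Rintegral => z _.
by rewrite /Cn_shift expr0 scale1r addrC.
Qed.

(** Dominated convergence, with [M] times the indicator of the closed ball of radius [M] as
    majorant. The limit inherits its measurability from the approximants. *)
Lemma Rintegral_cvg0 (F : nat -> Cn -> R) f (M : R) :
  (forall N, bounded_support (F N)) ->
  (forall N z, `|F N z| <= M) -> (forall N z, M < `|z| -> F N z = 0) ->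
  (forall z, F N z @[N --> \oo] --> f z) ->
  (forall N, \int[lambda]_z F N z = 0)%R ->
  lambda.-integrable setT (EFin \o f) /\ (\int[lambda]_z f z = 0)%R.
Proof.
move=> hF FM F0 Ff IF.
pose A : set borelCn := [set z : Cn | `|z| <= M].
have mA : measurable A.
  apply: closed_borel.
  have -> : A = (fun z : Cn => `|z|) @^-1` [set x | x <= M] by [].
  apply: closed_comp; last exact: closed_le.
  by move=> z _; exact: norm_continuous.
have M0 : 0 <= M by exact: le_trans (FM 0%N 0).
pose g : Cn -> R := (M \o* \1_A)%R.
have hg : bounded_support g.
  split; first exact: measurable_funM.
  exists M; split => z; rewrite /g /= indicE.
    by case: (_ \in _); rewrite ?mul1r ?mul0r ?normr0 ?ger0_norm.
  by move=> zM; rewrite memNset ?mul0r// /A /= leNgt zM.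
have cF z : ((EFin \o F N) z @[N --> \oo] --> (f z)%:E)%E.
  by apply: cvg_EFin; [exact: nearW|exact: Ff].
have mf : measurable_fun [set: borelCn] (EFin \o f).
  apply: (@emeasurable_fun_cvg _ borelCn R setT (fun N => EFin \o F N)) => [N|z _].
    by apply/measurable_EFinP; case: (hF N).
  exact: cF.
have [] := @dominated_convergence _ borelCn R lambda setT measurableT
  (fun N => EFin \o F N) (EFin \o f) (EFin \o g).
- by move=> N; apply/measurable_EFinP; case: (hF N).
- exact: mf.
- by apply: aeW => z _; exact: cF.
- exact: bounded_support_integrable.
- apply: aeW => z N _ /=; rewrite lee_fin /g /= indicE.
  have [zM|zM] := leP `|z| M; first by rewrite mem_set// mul1r.
  by rewrite F0// normr0 mulr_ge0.
move=> If _ /cvg_lim lf; split => //; rewrite /Rintegral -lf//.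
rewrite (_ : [sequence _]_N = cst 0%E) ?lim_cst//.
apply/funext => N /=; have := IF N; rewrite /Rintegral => h.
rewrite -[LHS]fineK; first by rewrite h.
exact: (integrable_fin_num measurableT (bounded_support_integrable (hF N))).
Qed.

End bounded_support.

(** * Finite differences and null Lagrangians *)

Section null_lagrangian_discrete.
Context {R : realType} {n : nat}.
Local Notation Cn := (Cn R n).
Local Notation lambda := (@lebesgue_Cn R n).

Lemma prodrB_telescope k (a b : nat -> R) :
  \prod_(i < k) a i - \prod_(i < k) b i =
  \sum_(j < k) \prod_(i < k)
    (if (i < j)%N then a i else if i == j :> nat then a i - b i else b i).
Proof.
elim: k => [|k IH]; first by rewrite !big_ord0 subrr.
rewrite !big_ord_recr /= ltnn eqxx.
have -> : \prod_(i < k) a i * a k - \prod_(i < k) b i * b k =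
  (\prod_(i < k) a i - \prod_(i < k) b i) * b k +
  \prod_(i < k) a i * (a k - b k) by ring.
rewrite IH mulr_suml; congr (_ + _).
  apply: eq_bigr => j _; rewrite big_ord_recr /=.
  by rewrite ltnNge ltnW//= gtn_eqF.
by congr (_ * _); apply: eq_bigr => i _; rewrite ltn_ord.
Qed.

Variable k : nat.
Implicit Types (e : 'I_k.+1 -> Cn) (s : 'S_k.+1) (f : 'I_k.+1 -> Cn -> R).

(** The vertex reached after [l] edges when the cube spanned by [e] is walked from the origin in the
    order [s]. *)
Definition partial_sum e s (l : nat) : Cn := \sum_(i < k.+1 | (i < l)%N) e (s i).

(** The same walk with its first edge [e (s ord0)] left out: it stays on a facet through the
    origin. *)
Definition partial_sum1 e s (l : nat) : Cn :=
  \sum_(i < k.+1 | (0 < i < l)%N) e (s i).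

Lemma partial_sum0 e s : partial_sum e s 0 = 0.
Proof. by rewrite /partial_sum big_pred0. Qed.

Lemma partial_sumS e s (l : 'I_k.+1) :
  partial_sum e s l.+1 = partial_sum e s l + e (s l).
Proof.
rewrite /partial_sum (bigD1 l) //= addrC; congr (_ + _).
by apply: eq_bigl => i; rewrite ltnS [RHS]ltn_neqAle andbC.
Qed.

Lemma partial_sum1E e s (l : nat) : (0 < l)%N ->
  partial_sum e s l = e (s ord0) + partial_sum1 e s l.
Proof.
move=> l0; rewrite /partial_sum (bigD1 ord0) //=; congr (_ + _).
by apply: eq_bigl => i; rewrite andbC lt0n.
Qed.

Lemma partial_sum1S e s (l : 'I_k.+1) : (0 < l)%N ->
  partial_sum1 e s l.+1 = partial_sum1 e s l + e (s l).
Proof.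
move=> l0; apply: (@addrI _ (e (s ord0))).
by rewrite addrA -!partial_sum1E// partial_sumS.
Qed.

Lemma partial_sum1_tperm e s (j l : 'I_k.+1) : (l <= j)%N ->
  partial_sum1 e (tperm ord0 j * s)%g l = partial_sum1 e s l.
Proof.
move=> lj; apply: eq_bigr => i /andP[i0 il]; rewrite permM tpermD//.
  by rewrite -val_eqE /= ltn_eqF.
by rewrite -val_eqE /= gtn_eqF// (leq_trans il).
Qed.

Lemma partial_sum_tperm e s (j : 'I_k.+1) (l : nat) : (j < l)%N ->
  partial_sum e (tperm ord0 j * s)%g l = partial_sum e s l.
Proof.
move=> jl; rewrite /partial_sum.
rewrite [RHS](reindex_inj (@perm_inj _ (tperm ord0 j))) /=.
apply: eq_big => [i|i _]; last by rewrite permM.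
by case: tpermP => // ->; rewrite ?jl ?(leq_ltn_trans _ jl).
Qed.

(** The cup product of the cochains [d (f l)], evaluated on the path [s] of the cube at [z]. Its
    signed sum over [s] replaces the wedge product of the differentials. *)
Definition path_prod e f s (z : Cn) : R :=
  \prod_(l < k.+1) (f l (z + partial_sum e s l.+1) - f l (z + partial_sum e s l)).

(* the coboundary of [df_1 \cup ... \cup df_k] vanishes on the cube at [z] *)
Lemma discrete_coboundary e f (z : Cn) :
  \sum_(s : 'S_k.+1) (-1) ^+ s *
    (\prod_(l < k) (f (lift ord0 l) (z + partial_sum1 e s l.+2) -
                    f (lift ord0 l) (z + partial_sum1 e s l.+1)) -
     \prod_(l < k) (f (lift ord0 l) (z + partial_sum e s l.+2) -
                    f (lift ord0 l) (z + partial_sum e s l.+1))) = 0.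
Proof.
pose g (l : nat) := f (inord l.+1).
pose a s (l : nat) := g l (z + partial_sum1 e s l.+2) - g l (z + partial_sum1 e s l.+1).
pose b s (l : nat) := g l (z + partial_sum e s l.+2) - g l (z + partial_sum e s l.+1).
have gE (l : 'I_k) : f (lift ord0 l) = g l.
  rewrite /g; congr f; apply/val_inj => /=; rewrite inordK//.
  by rewrite ltnS ltn_ord.
under eq_bigr => s _.
  under eq_bigr => l _ do rewrite gE.
  under [X in _ - X]eq_bigr => l _ do rewrite gE.
  rewrite (prodrB_telescope k (a s) (b s)) mulr_sumr; over.
(* In the [j]-th term of the telescoped difference, the factors before [j] skip the first edge,
   those after [j] have passed it, and factor [j] is, up to sign, a mixed second difference in the
   edges at positions [0] and [j.+1]. *)
rewrite exchange_big big1 //= => j _.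
pose T s := \prod_(i < k) (if (i < j)%N then a s i
  else if i == j :> nat then a s i - b s i else b s i).
have jk : (j.+1 < k.+1)%N by rewrite ltnS.
pose j1 : 'I_k.+1 := Ordinal jk.
(* Exchange of the edges at positions [0] and [j.+1]: earlier factors see neither of them, later
   ones have passed both, and the second difference is symmetric in them. As the transposition is
   odd, the signed sum equals its own opposite. *)
have TE s : T (tperm ord0 j1 * s)%g = T s.
  apply: eq_bigr => i _; case: ltngtP => [ij|ij|ij].
  - rewrite /a.
    have i1 : (i.+1 < k.+1)%N by rewrite ltnS.
    have i2 : (i.+2 < k.+1)%N by rewrite ltnS (leq_ltn_trans ij).
    rewrite (@partial_sum1_tperm e s j1 (Ordinal i1)) /=; last exact: ltnW.
    by rewrite (@partial_sum1_tperm e s j1 (Ordinal i2)).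
  - by rewrite /b !partial_sum_tperm// ltnS// ltnW.
  - rewrite /a /b ij.
    rewrite !(@partial_sum1E _ _ j.+2)// !(@partial_sum1E _ _ j.+1)//.
    rewrite !(@partial_sum1S _ _ j1)//.
    rewrite (@partial_sum1_tperm e s j1 j1)//= !permM tpermL tpermR.
    rewrite -/(partial_sum1 _ _ _).
    set S := partial_sum1 e s j.+1.
    rewrite [e (s j1) + (S + _)]addrCA [e (s ord0) + (S + _)]addrCA.
    rewrite [e (s j1) + e (s ord0)]addrC [e (s j1) + S]addrC.
    rewrite [e (s ord0) + S]addrC; ring.
set X := \sum_(i | _) _.
suff : X = - X by move/eqP; rewrite -addr_eq0 -mulr2n mulrn_eq0 => /eqP.
rewrite {1}/X (reindex_inj (mulgI (tperm ord0 j1))) /= -sumrN.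
apply: eq_bigr => s _; rewrite -/(T _) TE odd_permM odd_tperm.
have -> : ord0 != j1 by [].
by rewrite addTb signrN mulNr.
Qed.

(** Summation by parts. The factor of index [ord0] is a difference of two values of [f ord0];
    translating the integral of the advanced one by [e (s ord0)] leaves [f ord0 z] as a common
    weight, and the sum that it multiplies vanishes at every point by [discrete_coboundary]. *)
Lemma null_lagrangian_discrete e f : (forall l, bounded_support (f l)) ->
  (\int[lambda]_z (\sum_(s : 'S_k.+1) (-1) ^+ s * path_prod e f s z) = 0)%R.
Proof.
move=> hf.
pose P s z := \prod_(l < k) (f (lift ord0 l) (z + partial_sum e s l.+2) -
                    f (lift ord0 l) (z + partial_sum e s l.+1)).
pose P1 s z := \prod_(l < k) (f (lift ord0 l) (z + partial_sum1 e s l.+2) -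
                    f (lift ord0 l) (z + partial_sum1 e s l.+1)).
have hd l a b : bounded_support (fun z => f l (z + a) - f l (z + b)).
  by apply: bounded_supportB; exact: bounded_support_translate.
have hP c s : bounded_support (fun z => f ord0 (z + c) * P s z).
  by apply: bounded_supportM_prod => [|l]; [exact: bounded_support_translate|exact: hd].
have hP1 s : bounded_support (fun z => f ord0 z * P1 s z).
  by apply: bounded_supportM_prod => [|l]; [exact: hf|exact: hd].
have hP0 s : bounded_support (fun z => f ord0 z * P s z).
  by have := hP 0 s; under eq_fun do rewrite addr0.
have PE s z : path_prod e f s z =
    f ord0 (z + e (s ord0)) * P s z - f ord0 z * P s z.
  rewrite /path_prod big_ord_recl /= partial_sum0 addr0.
  by rewrite (partial_sumS e s ord0) partial_sum0 add0r mulrBl.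
have hQ s : bounded_support (path_prod e f s).
  rewrite (_ : path_prod e f s = (fun z => f ord0 (z + e (s ord0)) * P s z) \-
    (fun z => f ord0 z * P s z)); first exact: bounded_supportB.
  by apply/funext => z; rewrite PE.
rewrite Rintegral_bounded_support_sum => [|s _]; last exact: bounded_supportZ.
have bi := @bounded_support_integrable R n.
transitivity (\sum_(s : 'S_k.+1)
    \int[lambda]_z ((-1) ^+ s * (f ord0 z * P1 s z - f ord0 z * P s z)))%R.
  apply: eq_bigr => s _; rewrite !RintegralZl//; last 2 first.
  - by apply: bi; apply: bounded_supportB.
  - exact: bi.
  congr (_ * _).
  transitivity (\int[lambda]_z (f ord0 (z + e (s ord0)) * P s z) -
                \int[lambda]_z (f ord0 z * P s z))%R.
    rewrite -(RintegralB measurableT (bi _ (hP (e (s ord0)) s)) (bi _ (hP0 s))).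
    by apply: eq_Rintegral => z _; exact: PE.
  rewrite (RintegralB measurableT (bi _ (hP1 s)) (bi _ (hP0 s))).
  congr (_ - _); rewrite -(Rintegral_translate (e (s ord0)) (hP1 s)).
  apply: eq_Rintegral => z _; congr (_ * _); apply: eq_bigr => l _.
  by rewrite !partial_sum1E// !addrA.
rewrite -Rintegral_bounded_support_sum => [|s _]; last first.
  by apply: bounded_supportZ; exact: bounded_supportB.
under eq_Rintegral => z _.
  under eq_bigr => s _ do rewrite -mulrBr mulrCA.
  rewrite -mulr_sumr (discrete_coboundary e f z) mulr0; over.
by rewrite Rintegral_cst// mul0r.
Qed.

End null_lagrangian_discrete.

(** * Directional derivatives, and uniform neighborhoods of compact sets *)

Section directional_calculus.
Context {R : realType} {n : nat}.
Local Notation Cn := (Cn R n).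
Local Notation borelCn := (borelCn R n).
Implicit Types (f g : Cn -> R) (K V W : set Cn) (e x y z : Cn).

Lemma is_derive_line f y e (t : R) : derivable f (y + t *: e) e ->
  is_derive t 1 (fun u : R => f (y + u *: e)) ('D_e f (y + t *: e)).
Proof.
move=> df.
have E : (fun h : R => h^-1 *: (((fun u : R => f (y + u *: e)) \o shift t) (h *: 1)
    - f (y + t *: e))) =
  (fun h : R => h^-1 *: ((f \o shift (y + t *: e)) (h *: e) - f (y + t *: e))).
  apply/funext => h /=; congr (_ *: (f _ - _)).
  by rewrite [h *: 1]mulr1 scalerDl addrCA.
split; first by rewrite /derivable E.
by rewrite /derive E.
Qed.

Lemma directional_mvt f y e (t : R) : 0 <= t ->
  (forall u, 0 <= u <= t -> derivable f (y + u *: e) e) ->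
  exists2 u, 0 <= u <= t & f (y + t *: e) - f y = t * 'D_e f (y + u *: e).
Proof.
move=> t0 df; pose phi u : R := f (y + u *: e).
have dphi u : 0 <= u <= t -> is_derive u 1 phi ('D_e f (y + u *: e)).
  by move=> /df /is_derive_line.
have [||u] := @MVT_segment R phi (fun u => 'D_e f (y + u *: e)) 0 t t0.
- by move=> u; rewrite in_itv/= => /andP[u0 ut]; apply: dphi; rewrite !ltW.
- apply: derivable_within_continuous => u; rewrite in_itv /= => /dphi.
  by case.
rewrite in_itv /= => ut; rewrite /phi scale0r addr0 subr0 mulrC => E.
by exists u.
Qed.

Lemma derive_quadratic f z e (a b : R) :
  (forall t : R, f (z + t *: e) = f z + t * a + t ^+ 2 * b) ->
  is_derive z e f a.
Proof.
move=> E.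
have H : (h^-1 *: ((f \o shift z) (h *: e) - f z) : R) @[h --> 0^'] --> a.
  apply: (@cvg_trans _ ((a + h * b : R) @[h --> (0 : R)^'])).
    apply: near_eq_cvg; near=> h.
    have h0 : h != 0 by near: h; exact: nbhs_dnbhs_neq.
    rewrite /= [h *: e + z]addrC E [_ *: _]/GRing.scale /=.
    by field.
  have : (a + h * b : R) @[h --> (0 : R)^'] --> a + 0 * b.
    apply: cvgD; first exact: cvg_cst.
    by apply: cvgMl; apply: cvg_within_filter; exact: cvg_id.
  by rewrite mul0r addr0.
by split; [apply/cvg_ex; exists a|exact/cvg_lim].
Unshelve. all: by end_near.
Qed.

(** A single large parameter [M] serves as the bound and, inverted, as the radius. Near-covering
    compactness of [K], with [M] tending to infinity, then makes both uniform at once. *)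
Lemma compact_tube (I : finType) (G : I -> Cn -> R) K V :
  compact K -> open V -> K `<=` V ->
  (forall i z, V z -> {for z, continuous (G i)}) ->
  exists r M : R, 0 < r /\ forall x y, K x -> `|y - x| < r ->
    V y /\ forall i, `|G i y| <= M.
Proof.
move=> cK oV KV cG.
pose P (M : R) x := 0 < M /\
  forall y, `|y - x| < M^-1 -> V y /\ forall i, `|G i y| <= M.
have : \forall M \near +oo, K `<=` P M.
  apply: (proj1 (compact_near_coveringP K) cK) => x Kx.
  have : \forall y \near x, V y /\ forall i, `|G i y| <= 1 + \sum_j `|G j x|.
    apply: filterI; first by apply: open_nbhs_nbhs; split => //; exact: KV.
    apply: (@filter_forall _ I (fun i y => `|G i y| <= 1 + \sum_j `|G j x|) _
      (nbhs_filter x)) => i.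
    have /cvgr_distC_le/(_ _ ltr01) := cG i x (KV _ Kx).
    apply: filterS => y; rewrite /= => h.
    rewrite -(subrK (G i x) (G i y)) (le_trans (ler_normD _ _))// lerD//.
    rewrite (bigD1 i)//= lerDl; exact: sumr_ge0.
  move=> /nbhs_ballP[r /= r0 rP].
  pose A := 1 + \sum_j `|G j x|.
  exists (ball x (r / 2), [set M | Num.max A (2 / r) < M]) => /=.
    split; first by apply: nbhsx_ballx; rewrite divr_gt0.
    exists (Num.max A (2 / r)); split => //; exact: num_real.
  move=> [x' M] /= [xx' ]; rewrite gt_max => /andP[AM rM].
  have M0 : 0 < M by apply: lt_trans rM; rewrite divr_gt0.
  split => // y yx'.
  have [|Vy Gy] := rP y.
    rewrite -ball_normE /= -(subrK x' x) -addrA (le_lt_trans (ler_normD _ _))//.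
    rewrite (splitr r) ltrD//; first by move: xx'; rewrite -ball_normE.
    rewrite distrC (lt_trans yx')// -[ltRHS]invrK ltf_pV2 ?posrE ?invr_gt0 ?divr_gt0//.
    by rewrite invf_div.
  by split => // i; rewrite (le_trans (Gy i))// ltW.
move=> [M0 [_ /(_ (Num.max M0 0 + 1))]].
set M := Num.max M0 0 + 1.
have MM : M0 < M by apply: (@le_lt_trans _ _ (Num.max M0 0)); rewrite ?ltrDl// le_max lexx.
move=> /(_ MM) KP.
have M1 : 0 < M by rewrite /M ltr_wpDl// le_max lexx orbT.
exists M^-1, M; split; first by rewrite invr_gt0.
by move=> x y Kx yx; have [_] := KP x Kx; exact.
Qed.

Lemma open_tube K (r : R) : open [set y | exists2 x, K x & `|y - x| < r].
Proof.
rewrite (_ : [set _ | _] = \bigcup_(x in K) ball x r).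
  by apply: bigcup_open => x _; exact: ball_open.
by apply/seteqP; split => y [x Kx yx]; exists x => //;
  move: yx; rewrite -ball_normE /= distrC.
Qed.

(** The points at distance at least [1 / (k + 1)] from the complement of [V]. These closed sets
    exhaust an open [V]; they serve inner regularity and the measurability of maps out of the Cantor
    space. *)
Definition inner_closed V (k : nat) : set Cn :=
  [set x | forall y, `|y - x| < k.+1%:R^-1 -> V y].

Lemma closed_inner_closed V k : closed (inner_closed V k).
Proof.
rewrite -(setCK (inner_closed V k)); apply: open_closedC.
rewrite (_ : ~` inner_closed V k = [set x | exists2 y, (~` V) y & `|x - y| < k.+1%:R^-1]).
  exact: open_tube.
apply/seteqP; split => x /=.
  move=> /existsNP[y /not_implyP[xy Vy]]; exists y => //; by rewrite distrC.
by move=> [y Vy xy] /(_ y); rewrite distrC => /(_ xy).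
Qed.

Lemma inner_closed_sub V k : inner_closed V k `<=` V.
Proof. by move=> x; apply; rewrite subrr normr0 invr_gt0. Qed.

Lemma inner_closed_nondecreasing V (k l : nat) : (k <= l)%N ->
  inner_closed V k `<=` inner_closed V l.
Proof.
move=> kl x Vx y xy; apply: Vx; apply: lt_le_trans xy _.
by rewrite lef_pV2 ?posrE// ler_nat ltnS.
Qed.

Lemma bigcup_inner_closed V : open V -> \bigcup_k inner_closed V k = V.
Proof.
move=> oV; apply/seteqP; split => x; first by move=> [k _]; exact: inner_closed_sub.
move=> Vx; have /nbhs_ballP[e /= e0 eV] : nbhs x V by apply: open_nbhs_nbhs.
have [k] := ltr_add_invr e0; rewrite add0r => ke.
exists k => // y yx; apply: eV.
by rewrite -ball_normE /= distrC (lt_trans yx).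
Qed.

Lemma open_continuous_measurable W f : open W ->
  (forall z, W z -> {for z, continuous f}) ->
  measurable_fun (W : set borelCn) (f : borelCn -> R).
Proof.
move=> oW cf; apply: (measurability _ (RGenOpens.measurableE R)) => //.
move=> _ [_ [a [b ->] <-]]; apply: open_borel.
rewrite openE => z /= [Wz fz]; apply: filterI.
  exact: open_nbhs_nbhs.
by apply: cf => //; apply: open_nbhs_nbhs; split => //; exact: interval_open.
Qed.

Lemma cvg_seq_continuous f (y : nat -> Cn) z : {for z, continuous f} ->
  y N @[N --> \oo] --> z -> f (y N) @[N --> \oo] --> f z.
Proof. by move=> cf yz; apply: continuous_cvg. Qed.

End directional_calculus.

(** * Determinants of first derivatives integrate to zero *)

Section null_lagrangian.
Context {R : realType} {n k : nat}.
Local Notation Cn := (Cn R n).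
Local Notation borelCn := (borelCn R n).
Local Notation lambda := (@lebesgue_Cn R n).
Variables (e : 'I_k.+1 -> Cn) (h : 'I_k.+1 -> Cn -> R) (K V : set Cn).
Hypotheses (oV : open V) (cK : compact K) (KV : K `<=` V).
Hypothesis h0 : forall z, ~ K z -> h ord0 z = 0.
Hypothesis ch : forall l z, V z -> {for z, continuous (h l)}.
Hypothesis dh : forall l j z, V z -> derivable (h l) z (e j).
Hypothesis cdh : forall l j z, V z -> {for z, continuous ('D_(e j) (h l))}.

Lemma partial_sumZ (t : R) (s : 'S_k.+1) l :
  partial_sum (fun j => t *: e j) s l = t *: partial_sum e s l.
Proof. by rewrite /partial_sum scaler_sumr. Qed.

Lemma partial_sum_norm (s : 'S_k.+1) (l : 'I_k.+1) :
  `|partial_sum e s l| + `|e (s l)| <= \sum_j `|e j|.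
Proof.
rewrite [leRHS](reindex_inj (@perm_inj _ s)) /=.
rewrite [leRHS](bigID (fun i : 'I_k.+1 => (i < l)%N)) /= lerD//.
  exact: ler_norm_sum.
by rewrite (bigD1 l) ?ltnn//= lerDl sumr_ge0.
Qed.

(** The discrete identity with edges [t N *: e j], divided by the [k.+1]-st power of the mesh,
    passes to the limit: by the mean value theorem each difference quotient is a first derivative at
    a nearby point. Only first derivatives enter, so the result applies to the first derivatives of
    [C^2] functions. *)
Lemma null_lagrangian :
  let F z := \sum_(s : 'S_k.+1) (-1) ^+ s * \prod_l 'D_(e (s l)) (h l) z in
  lambda.-integrable setT (EFin \o F) /\ (\int[lambda]_z F z = 0)%R.
Proof.
move=> F.
(* [None] selects the function itself and [Some j] its derivative along [e j], so that one tube
   bounds them all. *)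
pose G (i : option 'I_k.+1 * 'I_k.+1) :=
  if i.1 is Some j then 'D_(e j) (h i.2) else h i.2.
have [|r [M0 [r0 tube0]]] := @compact_tube R n _ G K V cK oV KV.
  by case=> -[j|] l z Vz; [exact: cdh|exact: ch].
have rr : r / 2 <= r by move: r0; lra.
pose M := Num.max M0 0.
have M_ge0 : 0 <= M by rewrite le_max lexx orbT.
have tubeV x y : K x -> `|y - x| < r -> V y.
  by move=> Kx yx; have [] := tube0 x y Kx yx.
have tubeh x y l : K x -> `|y - x| < r -> `|h l y| <= M.
  move=> Kx yx; have [_ /(_ (None, l))/= hM] := tube0 x y Kx yx.
  by rewrite le_max hM.
have tubed x y l j : K x -> `|y - x| < r -> `|'D_(e j) (h l) y| <= M.
  move=> Kx yx; have [_ /(_ (Some j, l))/= hM] := tube0 x y Kx yx.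
  by rewrite le_max hM.
have [B KB] : exists B, forall x, K x -> `|x| <= B.
  have [B [_ /(_ (B + 1))]] := compact_bounded cK.
  by rewrite ltrDl ltr01 => /(_ isT) KB; exists (B + 1) => x Kx; exact: KB.
pose W := [set y | exists2 x, K x & `|y - x| < r].
have oW : open W by exact: open_tube.
have KW : K `<=` W by move=> x Kx; exists x => //; rewrite subrr normr0.
have WV : W `<=` V by move=> y [x Kx yx]; exact: tubeV yx.
(* The sharp cut-off makes every function bounded with bounded support. It is harmless: near [K] all
   difference quotients are taken along segments inside [W], and [h ord0] is already zero off
   [K]. *)
pose g l : Cn -> R := (h l \_ W).
have gE l y : W y -> g l y = h l y by move=> Wy; rewrite /g patchE mem_set.
have g0E y : g ord0 y = h ord0 y.
  rewrite /g patchE; case: ifPn => // /negP yW; rewrite h0// => /KW Wy.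
  by apply: yW; exact: mem_set.
have hg l : bounded_support (g l).
  split.
    apply/(measurable_restrictT (T1 := borelCn) (h l) (open_borel oW)).
    by apply: open_continuous_measurable => // z /WV; exact: ch.
  exists (Num.max M (B + r)); split => z.
    rewrite /g patchE; case: ifPn => [/set_mem[x Kx zx]|_]; last first.
      by rewrite normr0 le_max M_ge0.
    by rewrite le_max (tubeh _ _ _ Kx zx).
  rewrite gt_max => /andP[_ zB]; rewrite /g patchE memNset// => -[x Kx zx].
  move: zB; rewrite ltNge -(subrK x z) (le_trans (ler_normD _ _))//.
  by rewrite addrC lerD// ?KB// ltW.
(* The [+ 1] keeps [S] positive and strictly larger than the length of any edge. The mesh [t N]
   below is chosen so that a whole path stays within [t N * S <= r / 2] of its starting point. *)
pose S := \sum_j `|e j| + 1.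
have S0 : 0 < S by rewrite /S ltr_wpDl// sumr_ge0.
pose t N : R := r / 2 / S / N.+1%:R.
have t0 N : 0 < t N by rewrite /t !divr_gt0.
have tS N : t N * S = r / 2 / N.+1%:R by rewrite /t mulrAC divfK// gt_eqF.
have tSr N : t N * S <= r / 2.
  rewrite tS ler_pdivrMr// ler_peMr ?ler1n//.
  by rewrite divr_ge0// ltW.
have t_cvg : (t N * S : R) @[N --> \oo] --> (0 : R).
  under eq_fun do rewrite tS.
  rewrite -(mulr0 (r / 2)); apply: cvgMr; exact: cvg_harmonic.
clearbody t.
pose near_K z := exists2 x, K x & `|z - x| < r / 2.
have factor N z (s : 'S_k.+1) l : near_K z -> exists y, [/\ `|y - z| <= t N * S,
    (g l (z + t N *: partial_sum e s l.+1) - g l (z + t N *: partial_sum e s l))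
      = t N * 'D_(e (s l)) (h l) y & `|'D_(e (s l)) (h l) y| <= M].
  move=> [x Kx zx].
  pose y0 := z + t N *: partial_sum e s l.
  have y0z u : 0 <= u <= t N -> `|y0 + u *: e (s l) - z| <= t N * S.
    move=> /andP[u0 ut].
    rewrite /y0 -(addrA z) [z + _]addrC addrK (le_trans (ler_normD _ _))// !normrZ.
    rewrite (ger0_norm (ltW (t0 N))) (ger0_norm u0).
    apply: (@le_trans _ _ (t N * (`|partial_sum e s l| + `|e (s l)|))).
      by rewrite mulrDr lerD2l ler_wpM2r.
    rewrite (ler_wpM2l (ltW (t0 N)))// (le_trans (partial_sum_norm s l))//.
    by rewrite /S lerDl.
  have y0x u : 0 <= u <= t N -> `|y0 + u *: e (s l) - x| < r.
    move=> ut; rewrite -(subrK z (y0 + u *: e (s l))) -addrA.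
    rewrite (le_lt_trans (ler_normD _ _))// (splitr r) ler_ltD//.
    exact: le_trans (y0z _ ut) (tSr N).
  have y0W u : 0 <= u <= t N -> W (y0 + u *: e (s l)).
    by move=> ut; exists x => //; exact: y0x.
  have htt : 0 <= t N <= t N by apply/andP; split => //; exact: ltW.
  have t00 : (0 : R) <= 0 <= t N by apply/andP; split => //; exact: ltW.
  have [u|u ut E] := @directional_mvt R n (h l) y0 (e (s l)) _ (ltW (t0 N)).
    by move=> ut; apply: dh; apply: WV; exact: y0W.
  exists (y0 + u *: e (s l)); split; first exact: y0z.
  - rewrite partial_sumS scalerDr addrA -/y0 gE; last exact: y0W.
    by rewrite gE ?E//; have := y0W 0 t00; rewrite scale0r addr0.
  - by apply: (tubed x) => //; exact: y0x.
pose FN N z : R := (t N)^-1 ^+ k.+1 *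
  \sum_(s : 'S_k.+1) (-1) ^+ s * path_prod (fun j => t N *: e j) g s z.
have FNE N z : FN N z = \sum_(s : 'S_k.+1) (-1) ^+ s * \prod_l ((t N)^-1 *
    (g l (z + t N *: partial_sum e s l.+1) - g l (z + t N *: partial_sum e s l))).
  rewrite /FN mulr_sumr; apply: eq_bigr => s _; rewrite mulrCA; congr (_ * _).
  rewrite big_split /= prodr_const card_ord; congr (_ * _).
  by apply: eq_bigr => l _; rewrite !partial_sumZ.
(* The factor of index [ord0] reads [h ord0] only at [z] and at the end of the first edge. If either
   point lay in [K], then [z] would be within [r / 2] of [K]. *)
have far N z : ~ near_K z -> FN N z = 0.
  move=> zK; rewrite FNE big1// => s _.
  rewrite big_ord_recl /= !g0E !h0 ?subr0 ?mulr0 ?mul0r ?mulr0//.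
    rewrite partial_sum0 scaler0 addr0 => Kz; apply: zK; exists z => //.
    by rewrite subrr normr0 divr_gt0.
  rewrite (partial_sumS e s ord0) partial_sum0 add0r => Kz; apply: zK.
  exists (z + t N *: e (s ord0)) => //.
  rewrite opprD addrA subrr add0r normrN normrZ (ger0_norm (ltW (t0 N))).
  apply: (@lt_le_trans _ _ (t N * S)) => //; rewrite ltr_pM2l// /S.
  rewrite ltr_pwDr// [leRHS](reindex_inj (@perm_inj _ s)) /= (bigD1 ord0)//=.
  by rewrite lerDl sumr_ge0.
apply: (Rintegral_cvg0 (F := FN)
    (M := Num.max (#|{: 'S_k.+1}|%:R * M ^+ k.+1) (B + r))).
- move=> N; apply: bounded_supportZ; apply: bounded_support_sum => s _.
  apply: bounded_supportZ; rewrite /path_prod.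
  have hd l a b : bounded_support (fun z => g l (z + a) - g l (z + b)).
    by apply: bounded_supportB; exact: bounded_support_translate.
  under eq_fun do rewrite big_ord_recl.
  by apply: bounded_supportM_prod => *; exact: hd.
- move=> N z; rewrite le_max; have [zK|/far ->] := pselect (near_K z); last first.
    by rewrite normr0 mulr_ge0// exprn_ge0.
  apply/orP; left; rewrite FNE (le_trans (ler_norm_sum _ _ _))//.
  rewrite mulr_natl -sumr_const ler_sum// => s _.
  rewrite normrM normr_sign mul1r normr_prod.
  rewrite -[X in M ^+ X](card_ord k.+1) -prodr_const.
  apply: ler_prod => l _; rewrite normr_ge0/=.
  have [y [_ -> yM]] := factor N z s l zK.
  by rewrite mulKf ?gt_eqF.
- move=> N z; rewrite gt_max => /andP[_ zB]; apply: far => -[x Kx zx].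
  move: zB; rewrite ltNge -(subrK x z) (le_trans (ler_normD _ _))//.
  by rewrite addrC lerD// ?KB// ltW// (lt_le_trans zx).
- move=> z; have [zK|zK] := pselect (near_K z); last first.
    have -> : F z = 0.
      rewrite /F big1// => s _; rewrite big_ord_recl.
      have -> : 'D_(e (s ord0)) (h ord0) z = 0.
        rewrite -(derive_cst (0 : R) z (e (s ord0))).
        apply: near_eq_derive.
        have : nbhs z (~` K).
          apply: open_nbhs_nbhs; split.
            by apply: closed_openC; apply: compact_closed => //; exact: Cn_hausdorff.
          by move=> Kz; apply: zK; exists z => //; rewrite subrr normr0 divr_gt0.
        by apply: filterS => y /h0 ->.
      by rewrite mul0r mulr0.
    rewrite (_ : FN ^~ z = cst 0); first exact: cvg_cst.
    by apply/funext => N /=; exact: far.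
  under eq_fun do rewrite FNE.
  apply: cvg_big; first exact: add_continuous.
  move=> s _; apply: cvgMr; apply: cvg_big; first exact: mul_continuous.
  move=> l _.
  have /choice[y yP] N := factor N z s l zK.
  have E N : (t N)^-1 * (g l (z + t N *: partial_sum e s l.+1) -
      g l (z + t N *: partial_sum e s l)) = 'D_(e (s l)) (h l) (y N).
    by have [_ -> _] := yP N; rewrite mulKf ?gt_eqF.
  under eq_fun do rewrite E.
  have yz : y N @[N --> \oo] --> z.
    apply/cvgrPdistC_lt => eps eps0.
    have /cvgr_lt/(_ _ eps0) := t_cvg; apply: filterS => N /=.
    by apply: le_lt_trans; case: (yP N).
  suff Vz : V z.
    exact: (cvg_seq_continuous (@cdh l (s l) z Vz) yz).
  by case: zK => x Kx zx; apply: (tubeV x) => //; exact: lt_le_trans rr.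
- move=> N; rewrite /FN RintegralZl//; last first.
    apply: bounded_support_integrable; apply: bounded_support_sum => s _.
    apply: bounded_supportZ; rewrite /path_prod.
    have hd l a b : bounded_support (fun z => g l (z + a) - g l (z + b)).
      by apply: bounded_supportB; exact: bounded_support_translate.
    under eq_fun do rewrite big_ord_recl.
    by apply: bounded_supportM_prod => *; exact: hd.
  by rewrite null_lagrangian_discrete// mulr0.
Qed.

End null_lagrangian.

Section null_integral.
Context {R : realType} {n : nat}.
Local Notation Cn := (Cn R n).
Local Notation lambda := (@lebesgue_Cn R n).

(** Integrability is kept together with the value so that finite sums can be integrated term by
    term. *)
Definition null_integral (F : Cn -> R) :=
  lambda.-integrable setT (EFin \o F) /\ (\int[lambda]_z F z = 0)%R.

Lemma null_integralD F G : null_integral F -> null_integral G ->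
  null_integral (fun z => F z + G z).
Proof.
move=> [iF F0] [iG G0]; split; last by rewrite RintegralD// F0 G0 addr0.
by rewrite (_ : EFin \o _ = (EFin \o F) \+ (EFin \o G))%E//; exact: integrableD.
Qed.

Lemma null_integralZ c F : null_integral F -> null_integral (fun z => c * F z).
Proof.
move=> [iF F0]; split; last by rewrite RintegralZl// F0 mulr0.
by rewrite (_ : EFin \o _ = (fun z => c%:E * (F z)%:E)%E)//; exact: integrableZl.
Qed.

Lemma null_integral_sum I (r : seq I) (P : pred I) (F : I -> Cn -> R) :
  (forall i, P i -> null_integral (F i)) ->
  null_integral (fun z => \sum_(i <- r | P i) F i z).
Proof.
move=> hF; elim: r => [|i r IH].
  under eq_fun do rewrite big_nil.
  split; last by rewrite Rintegral_cst// mul0r.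
  exact: (bounded_support_integrable bounded_support0).
have [Pi|nPi] := boolP (P i); last by under eq_fun do rewrite big_cons (negbTE nPi).
by under eq_fun do rewrite big_cons Pi; exact: null_integralD (hF i Pi) IH.
Qed.

End null_integral.

(** * Second differences and symmetry of second derivatives *)

Section second_derivatives.
Context {R : realType} {n : nat}.
Local Notation Cn := (Cn R n).
Variables (V : set Cn) (f : Cn -> R).
Hypotheses (oV : open V) (f2 : Ck 2 V f).

Lemma Ck2_continuous z : V z -> {for z, continuous f}.
Proof. by case: f2 => + _; apply. Qed.

Lemma Ck2_derivable e z : V z -> derivable f z e.
Proof. by case: f2 => _ /(_ e)[+ _]; apply. Qed.

Lemma Ck2_derive_continuous e z : V z -> {for z, continuous ('D_e f)}.
Proof. by case: f2 => _ /(_ e)[_ [+ _]]; apply. Qed.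

Lemma Ck2_derive_derivable e e' z : V z -> derivable ('D_e f) z e'.
Proof. by case: f2 => _ /(_ e)[_ [_ /(_ e')[+ _]]]; apply. Qed.

Lemma Ck2_derive2_continuous e e' z : V z -> {for z, continuous ('D_e' ('D_e f))}.
Proof. by case: f2 => _ /(_ e)[_ [_ /(_ e')[_ [+ _]]]]; apply. Qed.

(** The mean value theorem is applied first along [e'] and then along [e], which fixes the order of
    the two derivatives. The second difference itself is symmetric in [e] and [e']. *)
Lemma second_difference (z e e' : Cn) (t : R) : 0 <= t ->
  (forall u v, 0 <= u <= t -> 0 <= v <= t -> V (z + u *: e' + v *: e)) ->
  exists2 u, 0 <= u <= t & exists2 v, 0 <= v <= t &
    f (z + t *: e + t *: e') - f (z + t *: e) - (f (z + t *: e') - f z) =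
    t * (t * 'D_e ('D_e' f) (z + u *: e' + v *: e)).
Proof.
move=> t0 zV.
have tt' : 0 <= t <= t by rewrite t0 /=.
have t00 : (0 : R) <= 0 <= t by rewrite lexx.
pose phi (u : R) : R := f (z + t *: e + u *: e') - f (z + u *: e').
pose dphi (u : R) : R := 'D_e' f (z + t *: e + u *: e') - 'D_e' f (z + u *: e').
have dP u : 0 <= u <= t -> is_derive u 1 phi (dphi u).
  move=> ut; apply: is_deriveB; apply: is_derive_line; apply: Ck2_derivable.
    by rewrite addrAC; exact: zV.
  by have := zV u 0 ut t00; rewrite scale0r addr0.
have [||u] := @MVT_segment R phi dphi 0 t t0.
- by move=> u; rewrite in_itv/= => /andP[u0 ut]; apply: dP; rewrite !ltW.
- by apply: derivable_within_continuous => u; rewrite in_itv /= => /dP[].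
rewrite in_itv /= => ut; rewrite /phi /dphi !scale0r !addr0 subr0 => E.
have [v vt|v vt E'] := @directional_mvt R n ('D_e' f) (z + u *: e') e t t0.
  by apply: Ck2_derive_derivable; exact: zV.
exists u => //; exists v => //.
rewrite -E' -[z + u *: e' + t *: e]addrAC mulrC -E; ring.
Qed.

End second_derivatives.

Lemma dist_common {R : realFieldType} (a b c d eps : R) : c = d ->
  `|a - c| < eps / 2 -> `|b - d| < eps / 2 -> `|a - b| <= eps.
Proof.
move=> -> ac bd; rewrite (le_trans (ler_distD d _ _))// (splitr eps).
by rewrite lerD ?(ltW ac)// distrC ltW.
Qed.

(** The same second difference is [t * t] times either mixed derivative, each at some point near
    [z]; continuity of both closes the gap. The symmetry reconciles two integrations by parts that
    differentiate in opposite orders. *)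
Lemma derive2_sym {R : realType} {n : nat} (V : set (Cn R n)) (f : Cn R n -> R)
    (z e e' : Cn R n) : open V -> Ck 2 V f -> V z ->
  'D_e ('D_e' f) z = 'D_e' ('D_e f) z.
Proof.
move=> oV f2 Vz; apply/eqP; rewrite -subr_eq0 -normr_le0.
apply/ler_addgt0Pr => eps eps0; rewrite add0r.
have eps2 : 0 < eps / 2 by rewrite divr_gt0.
have zV : nbhs z V by exact: open_nbhs_nbhs.
have /cvgr_dist_lt/(_ _ eps2) z1 := @Ck2_derive2_continuous _ _ _ _ f2 e' e z Vz.
have /cvgr_dist_lt/(_ _ eps2) z2 := @Ck2_derive2_continuous _ _ _ _ f2 e e' z Vz.
have zP : \forall y \near z, V y /\
    (`|'D_e ('D_e' f) z - 'D_e ('D_e' f) y| < eps / 2 /\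
     `|'D_e' ('D_e f) z - 'D_e' ('D_e f) y| < eps / 2).
  exact: (@filterI _ (nbhs z) (nbhs_filter z) _ _ zV
    (@filterI _ (nbhs z) (nbhs_filter z) _ _ z1 z2)).
have [r /= r0 rP] := proj1 (nbhs_ballP _ _) zP.
pose S := `|e| + `|e'| + 1.
have S0 : 0 < S by rewrite /S ltr_wpDl// addr_ge0.
pose t := r / 2 / S.
have t0 : 0 < t by rewrite /t !divr_gt0.
have near_z a b u v : `|a| + `|b| <= `|e| + `|e'| -> 0 <= u <= t -> 0 <= v <= t ->
    ball z r (z + u *: a + v *: b).
  move=> ab /andP[u0 ut] /andP[v0 vt]; rewrite -ball_normE /= -addrA opprD addNKr normrN.
  rewrite (le_lt_trans (ler_normD _ _))// !normrZ !ger0_norm//.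
  apply: (@le_lt_trans _ _ (t * (`|a| + `|b|))).
    by rewrite mulrDr lerD// ler_wpM2r.
  apply: (@le_lt_trans _ _ (t * S)).
    by apply: ler_wpM2l; rewrite ?(ltW t0)// (le_trans ab)// lerDl.
  by rewrite /t divfK ?gt_eqF//; move: r0; lra.
have [u ut [v vt E1]] : exists2 u, 0 <= u <= t & exists2 v, 0 <= v <= t &
    f (z + t *: e + t *: e') - f (z + t *: e) - (f (z + t *: e') - f z) =
    t * (t * 'D_e ('D_e' f) (z + u *: e' + v *: e)).
  apply: (second_difference f2 (ltW t0)) => u v ut vt.
  by have [] := rP _ (near_z e' e u v _ ut vt); rewrite // addrC.
have [u' ut' [v' vt' E2]] : exists2 u, 0 <= u <= t & exists2 v, 0 <= v <= t &
    f (z + t *: e' + t *: e) - f (z + t *: e') - (f (z + t *: e) - f z) =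
    t * (t * 'D_e' ('D_e f) (z + u *: e + v *: e')).
  apply: (second_difference f2 (ltW t0)) => u' v' ut' vt'.
  by have [] := rP _ (near_z e e' u' v' (lexx _) ut' vt').
have E : 'D_e ('D_e' f) (z + u *: e' + v *: e) =
         'D_e' ('D_e f) (z + u' *: e + v' *: e').
  apply: (mulfI (lt0r_neq0 t0)); apply: (mulfI (lt0r_neq0 t0)).
  apply: etrans (esym E1) _; apply: etrans E2.
  rewrite [z + t *: e' + t *: e]addrAC !opprB addrACA [RHS]addrACA.
  by congr (_ + _); rewrite addrC.
have ee : `|e'| + `|e| <= `|e| + `|e'| by rewrite addrC.
have [_ [h1 _]] := rP _ (near_z e' e u v ee ut vt).
have [_ [_ h2]] := rP _ (near_z e e' u' v' (lexx _) ut' vt').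
exact: dist_common E h1 h2.
Qed.

(** * Signed double sums of second derivatives against an affine weight *)

Section mixed_hessian.
Context {R : realType} {n k : nat}.
Local Notation Cn := (Cn R n).
Local Notation lambda := (@lebesgue_Cn R n).

Lemma derive_off_support (K : set Cn) (g : Cn -> R) (u z : Cn) : closed K ->
  (forall z, ~ K z -> g z = 0) -> ~ K z -> 'D_u g z = 0.
Proof.
move=> cK g0 zK; rewrite -(derive_cst (0 : R) z u); apply: near_eq_derive.
have : nbhs z (~` K) by apply: open_nbhs_nbhs; split => //; exact: closed_openC.
by apply: filterS => y /g0 ->.
Qed.

Lemma continuous_on_eq (V : set Cn) (F G : Cn -> R) z : open V -> V z ->
  (forall y, V y -> F y = G y) -> {for z, continuous G} -> {for z, continuous F}.
Proof.
move=> oV Vz FG cG; have : F y @[y --> z] --> G z.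
  apply: cvg_trans cG; apply: near_eq_cvg.
  by have : nbhs z V by [exact: open_nbhs_nbhs]; apply: filterS => y Vy; rewrite FG.
by rewrite -(FG z Vz).
Qed.

(** The algebra of the product rule alone: [c s * a t + v * d s t] stands for the derivative of the
    weighted first factor, and the last sum takes back the terms in which the weight was
    differentiated. *)
Lemma leibniz_signed_sum (I : finType) (g c a : I -> R) (d x : I -> I -> R) (v : R) :
  v * (\sum_s \sum_t g s * g t * (d s t * x s t)) =
  \sum_t g t * (\sum_s g s * ((c s * a t + v * d s t) * x s t)) +
  \sum_s (- (g s * c s)) * (\sum_t g t * (a t * x s t)).
Proof.
have -> : \sum_t g t * (\sum_s g s * ((c s * a t + v * d s t) * x s t)) =
    \sum_s \sum_t g t * (g s * ((c s * a t + v * d s t) * x s t)).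
  by rewrite exchange_big; apply: eq_bigr => t _; rewrite mulr_sumr.
rewrite -big_split mulr_sumr /=; apply: eq_bigr => s _.
rewrite !mulr_sumr -big_split /=; apply: eq_bigr => t _; ring.
Qed.

Variables (e e' : 'I_k.+1 -> Cn) (f : 'I_k.+1 -> Cn -> R) (K V : set Cn).
Variables (w dw : Cn -> R).
Hypotheses (oV : open V) (cK : compact K) (KV : K `<=` V).
Hypothesis f0 : forall z, ~ K z -> f ord0 z = 0.
Hypothesis f2 : forall l, Ck 2 V (f l).
Hypothesis cw : continuous w.
Hypothesis wE : forall z u (t : R), w (z + t *: u) = w z + t * dw u.

Let closedK : closed K.
Proof. by apply: compact_closed => //; exact: Cn_hausdorff. Qed.

Let dwP z u : is_derive z u w (dw u).
Proof. by apply: (@derive_quadratic _ _ _ _ _ _ 0) => t; rewrite wE mulr0 addr0. Qed.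

Let g0 (t : 'S_k.+1) (z : Cn) : R := w z * 'D_(e' (t ord0)) (f ord0) z.

Let dg0 t u z : V z -> is_derive z u (g0 t)
  (dw u * 'D_(e' (t ord0)) (f ord0) z + w z * 'D_u ('D_(e' (t ord0)) (f ord0)) z).
Proof.
move=> Vz; have df : is_derive z u ('D_(e' (t ord0)) (f ord0))
    ('D_u ('D_(e' (t ord0)) (f ord0)) z).
  by split => //; exact: (Ck2_derive_derivable (f2 ord0)).
have := is_deriveM (dwP z u) df.
by rewrite addrC [_ *: dw u]mulrC.
Qed.

(** First integration by parts, with [t] frozen: the weight is absorbed into the factor of index
    [ord0], and every factor is a first derivative, hence continuously differentiable on [V]. *)
Let h t (l : 'I_k.+1) : Cn -> R :=
  if l == ord0 then g0 t else 'D_(e' (t l)) (f l).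

Let A t z := \sum_(s : 'S_k.+1) (-1) ^+ s * \prod_l 'D_(e (s l)) (h t l) z.

Let A_null t : null_integral (A t).
Proof.
apply: (@null_lagrangian R n k e (h t) K V) => //.
- move=> z zK; rewrite /h eqxx /g0 (derive_off_support _ closedK f0 zK).
  by rewrite mulr0.
- move=> l z Vz; rewrite /h; case: eqP => _; last exact: (Ck2_derive_continuous (f2 l)).
  by apply: cvgM; [exact: cw|exact: (Ck2_derive_continuous (f2 ord0))].
- move=> l j z Vz; rewrite /h; case: eqP => _.
    by have [] := dg0 t (e j) Vz.
  exact: (Ck2_derive_derivable (f2 l)).
- move=> l j z Vz; rewrite /h; case: eqP => _.
    apply: (continuous_on_eq (G := fun y => dw (e j) * 'D_(e' (t ord0)) (f ord0) y +
      w y * 'D_(e j) ('D_(e' (t ord0)) (f ord0)) y) oV Vz) => [y Vy|].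
      by have [_] := dg0 t (e j) Vy.
    apply: cvgD.
      by apply: cvgMr; exact: (Ck2_derive_continuous (f2 ord0)).
    by apply: cvgM; [exact: cw|exact: (Ck2_derive2_continuous (f2 ord0))].
  exact: (Ck2_derive2_continuous (f2 l)).
Qed.

(** Second integration by parts, with [s] frozen and the directions [e'] in place of [e]. The
    constant [dw (e (s ord0))] stays outside, and [f ord0] itself is now the factor supported in
    [K]. *)
Let g s (l : 'I_k.+1) : Cn -> R :=
  if l == ord0 then f ord0 else 'D_(e (s l)) (f l).

Let B s z := \sum_(t : 'S_k.+1) (-1) ^+ t * \prod_l 'D_(e' (t l)) (g s l) z.

Let B_null s : null_integral (B s).
Proof.
apply: (@null_lagrangian R n k e' (g s) K V) => //.
- move=> l z Vz; rewrite /g; case: eqP => _; last exact: (Ck2_derive_continuous (f2 l)).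
  exact: (Ck2_continuous (f2 ord0)).
- move=> l j z Vz; rewrite /g; case: eqP => _.
    exact: (Ck2_derivable (f2 ord0)).
  exact: (Ck2_derive_derivable (f2 l)).
- move=> l j z Vz; rewrite /g; case: eqP => _.
    exact: (Ck2_derive_continuous (f2 ord0)).
  exact: (Ck2_derive2_continuous (f2 l)).
Qed.

(** The signed sum of the [A t] is the integrand plus terms that carry a derivative of the weight.
    Since [dw] does not depend on the point, these terms are a linear combination of the [B s] with
    constant coefficients. *)
Lemma mixed_hessian_null : null_integral (fun z => w z *
  \sum_(s : 'S_k.+1) \sum_(t : 'S_k.+1) (-1) ^+ s * (-1) ^+ t *
     \prod_l 'D_(e (s l)) ('D_(e' (t l)) (f l)) z).
Proof.
have D0 u z : ~ K z -> 'D_u (f ord0) z = 0 by exact: derive_off_support.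
have DD0 u v z : ~ K z -> 'D_u ('D_v (f ord0)) z = 0.
  by apply: derive_off_support => // y; exact: D0.
have E z : w z * (\sum_(s : 'S_k.+1) \sum_(t : 'S_k.+1) (-1) ^+ s * (-1) ^+ t *
     \prod_l 'D_(e (s l)) ('D_(e' (t l)) (f l)) z) =
   \sum_(t : 'S_k.+1) (-1) ^+ t * A t z +
   \sum_(s : 'S_k.+1) (- ((-1) ^+ s * dw (e (s ord0)))) * B s z.
  have [Kz|zK] := pselect (K z); last first.
    have A0 t : A t z = 0.
      rewrite /A big1// => s _; rewrite big_ord_recl /h eqxx.
      rewrite (derive_off_support _ closedK _ zK) ?mul0r ?mulr0// => y yK.
      by rewrite /g0 D0// mulr0.
    have B0 s : B s z = 0.
      by rewrite /B big1// => t _; rewrite big_ord_recl /g eqxx D0// mul0r mulr0.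
    rewrite [X in _ * X]big1 ?mulr0 => [|s _]; last first.
      by rewrite big1// => t _; rewrite big_ord_recl DD0// mul0r mulr0.
    rewrite [X in _ = X + _]big1 => [|t _]; last by rewrite A0 mulr0.
    by rewrite [X in _ = _ + X]big1 ?addr0// => s _; rewrite B0 mulr0.
  have Vz := KV Kz.
  pose x (s t : 'S_k.+1) := \prod_(l < k) 'D_(e (s (lift ord0 l)))
    ('D_(e' (t (lift ord0 l))) (f (lift ord0 l))) z.
  pose a (t : 'S_k.+1) := 'D_(e' (t ord0)) (f ord0) z.
  pose d (s t : 'S_k.+1) := 'D_(e (s ord0)) ('D_(e' (t ord0)) (f ord0)) z.
  transitivity (w z * (\sum_(s : 'S_k.+1) \sum_(t : 'S_k.+1) (-1) ^+ s * (-1) ^+ t * (d s t * x s t))).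
    congr (_ * _); apply: eq_bigr => s _; apply: eq_bigr => t _.
    by rewrite big_ord_recl.
  rewrite (leibniz_signed_sum (fun s : 'S_k.+1 => (-1) ^+ s) (fun s => dw (e (s ord0))) a); congr (_ + _).
    apply: eq_bigr => t _; congr (_ * _); apply: eq_bigr => s _; congr (_ * _).
    rewrite big_ord_recl {1}/h eqxx; have [_ ->] := dg0 t (e (s ord0)) Vz.
    by congr (_ * _); apply: eq_bigr => l _.
  apply: eq_bigr => s _; congr (_ * _); apply: eq_bigr => t _; congr (_ * _).
  rewrite [RHS]big_ord_recl; refine (f_equal2 _ _ _); first by rewrite /a /g eqxx.
  refine (eq_bigr _ _) => l _.
  (* In [B s] the derivative along [e'] is taken last, in the integrand it is taken first. *)
  exact: (@derive2_sym R n V _ z _ _ oV (f2 (lift ord0 l)) Vz).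
rewrite (_ : (fun z => _) = (fun z => \sum_(t : 'S_k.+1) (-1) ^+ t * A t z +
   \sum_(s : 'S_k.+1) (- ((-1) ^+ s * dw (e (s ord0)))) * B s z)); last exact/funext.
apply: null_integralD; apply: null_integral_sum => s _; apply: null_integralZ.
  exact: A_null.
exact: B_null.
Qed.

End mixed_hessian.

(** * Real-linear functions are m-subharmonic *)

Section linear_functions.
Context {R : realType} {n : nat}.
Local Notation Cn := (Cn R n).
Local Notation borelCn := (borelCn R n).
Local Notation lambda := (@lebesgue_Cn R n).

Lemma continuous_coord1 (j : 'I_n) : continuous (fun z : Cn => z.1 0 j).
Proof.
move=> z; apply: (@continuous_comp _ _ _ fst (fun x : 'rV[R]_n => x 0 j)).
  exact: cvg_fst.
exact: coord_continuous.
Qed.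

Lemma continuous_coord2 (j : 'I_n) : continuous (fun z : Cn => z.2 0 j).
Proof.
move=> z; apply: (@continuous_comp _ _ _ snd (fun x : 'rV[R]_n => x 0 j)).
  exact: cvg_snd.
exact: coord_continuous.
Qed.

Lemma continuous_sum_coord (u : Cn) :
  continuous (fun z : Cn => \sum_(j < n) (z.1 0 j * u.1 0 j + z.2 0 j * u.2 0 j)).
Proof.
move=> z; apply: cvg_big; first exact: add_continuous.
by move=> j _; apply: cvgD; apply: cvgMl; [exact: continuous_coord1|exact: continuous_coord2].
Qed.

Lemma normsq_line (z u : Cn) (t : R) : normsq (z + t *: u) = normsq z +
  t * (2 * \sum_(j < n) (z.1 0 j * u.1 0 j + z.2 0 j * u.2 0 j)) +
  t ^+ 2 * normsq u.
Proof.
rewrite /normsq !mulr_sumr -!big_split /=; apply: eq_bigr => j _.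
rewrite !mxE; ring.
Qed.

Lemma normsqN (z : Cn) : normsq (- z) = normsq z.
Proof. by apply: eq_bigr => j _; rewrite !mxE !sqrrN. Qed.

Lemma continuous_normsq : continuous (@normsq R n).
Proof.
move=> z; apply: cvg_big; first exact: add_continuous.
move=> j _; apply: cvgD; apply: cvgM;
  by [exact: continuous_coord1|exact: continuous_coord2].
Qed.

Lemma Ck2_normsq (V : set Cn) : Ck 2 V (@normsq R n).
Proof.
pose L (u z : Cn) : R := 2 * \sum_(j < n) (z.1 0 j * u.1 0 j + z.2 0 j * u.2 0 j).
have dN u z : is_derive z u (@normsq R n) (L u z).
  by apply: derive_quadratic => t; exact: normsq_line.
have dNE u : 'D_u (@normsq R n) = L u.
  by apply/funext => z; have [_ ->] := dN u z.
have cL u : continuous (L u).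
  by move=> z; apply: cvgMr; exact: continuous_sum_coord.
have dL u v z : is_derive z v (L u) (L u v).
  apply: (@derive_quadratic _ _ _ _ _ _ 0) => t; rewrite mulr0 addr0 /L mulrCA.
  rewrite -mulrDr; congr (_ * _); rewrite mulr_sumr -big_split /=.
  by apply: eq_bigr => j _; rewrite !mxE; ring.
have dLE u v : 'D_v (L u) = cst (L u v).
  by apply/funext => z; have [_ ->] := dL u v z.
split=> [z _|u]; first exact: continuous_normsq.
split=> [z _|]; first by have [] := dN u z.
rewrite dNE; split=> [z _|v]; first exact: cL.
split=> [z _|]; first by have [] := dL u v z.
by rewrite dLE; split => // z _; exact: cst_continuous.
Qed.

Lemma Ck_sub k (U V : set Cn) (f : Cn -> R) : V `<=` U -> Ck k U f -> Ck k V f.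
Proof.
move=> VU; elim: k f => [|k IH] f /= [cf df]; split => //; try by move=> z /VU; exact: cf.
move=> u; have [du Du] := df u; split; last exact: IH.
by move=> z /VU; exact: du.
Qed.

Lemma normsq_ball_bounded (a z : Cn) (r : R) : 0 < r ->
  normsq (z - a) <= r ^+ 2 -> `|z| <= r + `|a|.
Proof.
move=> r0 h; rewrite -(subrK a z) (le_trans (ler_normD _ _))// lerD2r.
have sq (x : R) : x ^+ 2 <= r ^+ 2 -> `|x| <= r.
  by move=> xr; rewrite -(@ler_pXn2r _ 2) ?nnegrE ?(ltW r0)// real_normK ?num_real.
have hj (j : 'I_n) : (z - a).1 0 j ^+ 2 + (z - a).2 0 j ^+ 2 <= r ^+ 2.
  apply: le_trans h; rewrite /normsq (bigD1 j)//= lerDl sumr_ge0// => i _.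
  by rewrite addr_ge0 ?sqr_ge0.
rewrite prod_normE ge_max; apply/andP; split.
- rewrite /Num.norm /= mx_normrE; apply: bigmax_le => [|[i j] _]; first exact: ltW.
  rewrite ord1; apply: sq; apply: le_trans (hj j).
  by rewrite lerDl sqr_ge0.
- rewrite /Num.norm /= mx_normrE; apply: bigmax_le => [|[i j] _]; first exact: ltW.
  rewrite ord1; apply: sq; apply: le_trans (hj j).
  by rewrite lerDr sqr_ge0.
Qed.

Variables (w dw : Cn -> R).
Hypothesis cw : continuous w.
Hypothesis wE : forall z u (t : R), w (z + t *: u) = w z + t * dw u.

(** The reflection in [a] preserves the ball and Lebesgue measure and changes the sign of
    [w z - w a], so the integral of this difference over the ball is its own opposite. *)
Lemma linear_mean_value (a : Cn) (r : R) : 0 < r ->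
  let B := [set z : Cn | normsq (z - a) <= r ^+ 2] in
  ((w a)%:E * lambda B = \int[lambda]_(z in B) (w z)%:E)%E.
Proof.
move=> r0 B.
have mB : measurable (B : set borelCn).
  apply: closed_borel.
  have -> : B = (fun z : Cn => normsq (z - a)) @^-1` [set x | x <= r ^+ 2] by [].
  apply: closed_comp; last exact: closed_le.
  move=> z _; apply: (@continuous_comp _ _ _ (fun z : Cn => z - a)).
    by apply: cvgD; [exact: cvg_id|exact: cvg_cst].
  exact: continuous_normsq.
have Bb z : B z -> `|z| <= r + `|a| by exact: normsq_ball_bounded.
have lB : (lambda B < +oo)%E by exact: (lebesgue_Cn_bounded mB Bb).
pose F (z : Cn) : R := (w z - w a) * \1_B z.
have Fr z : `|F z| <= `|w z - w a| by rewrite /F normrM indicE;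
  case: (_ \in _); rewrite ?normr1 ?normr0 ?mulr1 ?mulr0.
have wd z : w z - w a = dw (z - a).
  by rewrite -[in LHS](subrK a z) [z - a + a]addrC -[z - a]scale1r wE mul1r scale1r addrC addKr.
have dwN z : dw (- z) = - dw z.
  have := wE 0 z (-1); have := wE 0 (- z) 1; rewrite scale1r scaleN1r => ->.
  by move=> /addrI; rewrite mul1r mulN1r.
have cdw : continuous dw.
  have -> : dw = fun z => w (z + a) - w a.
    by apply/funext => z; rewrite wd addrK.
  move=> z; apply: cvgB; last exact: cvg_cst.
  apply: (@continuous_comp _ _ _ (fun z : Cn => z + a)).
    by apply: cvgD; [exact: cvg_id|exact: cvg_cst].
  exact: cw.
have dwZ (t : R) u : dw (t *: u) = t * dw u.
  have := wE 0 (t *: u) 1; rewrite scale1r wE mul1r.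
  by move=> /addrI.
(* [dw] is smaller than [1] in modulus on a ball of radius [d] around [0]. As [z - a] has norm at
   most [C], the factor [d / (C * 2)] brings it into that ball, and homogeneity gives the bound. *)
have [M [M0 FM]] : exists M : R, 0 <= M /\ forall z, B z -> `|w z - w a| <= M.
  have dw0 : dw 0 = 0 by rewrite -(scale0r 0) dwZ mul0r.
  have /cvgr_dist_lt/(_ _ ltr01)/nbhs_ballP[d /= d0 dP] := cdw 0.
  pose C := r + `|a| + `|a|.
  have C0 : 0 < C by rewrite /C -addrA ltr_pwDl// addr_ge0.
  exists (C * 2 / d); split; first by rewrite ltW// divr_gt0// mulr_gt0.
  move=> z /Bb zr; rewrite wd.
  have zC : `|z - a| <= C by rewrite (le_trans (ler_normB _ _))// lerD2r.
  have := dP ((d / (C * 2)) *: (z - a)).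
  rewrite -ball_normE /= dw0 !sub0r !normrN dwZ normrM normrZ.
  rewrite gtr0_norm ?divr_gt0 ?mulr_gt0// => h.
  have CE : C * 2 / d = (d / (C * 2))^-1 by rewrite invf_div.
  rewrite CE -[leRHS]mulr1 ler_pdivlMl ?divr_gt0 ?mulr_gt0// ltW//; apply: h.
  apply: (@le_lt_trans _ _ (d / (C * 2) * C)).
    by rewrite ler_wpM2l// ltW// divr_gt0// mulr_gt0.
  by rewrite invfM mulrA mulrAC divfK ?gt_eqF// ltr_pdivrMr//; move: d0; lra.
have hF : bounded_support F.
  split.
    apply: measurable_funM; last exact: measurable_indic.
    apply: measurable_funB; last exact: measurable_cst.
    exact: continuous_measurable_real.
  exists (Num.max M (r + `|a|)); split => z.
    have [Bz|nBz] := pselect (B z).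
      by rewrite le_max (le_trans (Fr z))// FM.
    by rewrite /F indicE memNset// mulr0 normr0 le_max M0.
  rewrite gt_max => /andP[_ zr]; rewrite /F indicE memNset ?mulr0//.
  by move=> /Bb; rewrite leNgt zr.
have F0 : (\int[lambda]_z F z = 0)%R.
  have : (\int[lambda]_z F z = - \int[lambda]_z F z)%R.
    rewrite -{1}(Rintegral_Cn_shift true (a + a) hF) -mulN1r.
    rewrite -RintegralZl//; last exact: bounded_support_integrable.
    apply: eq_Rintegral => z _; rewrite /F /Cn_shift expr1 scaleN1r mulN1r -mulNr.
    have aE : a + a - z - a = - (z - a) by rewrite opprB addrAC addrK.
    have -> : \1_B (a + a - z) = \1_B z :> R.
      rewrite !indicE; congr (nat_of_bool _)%:R.
      by apply/idP/idP => /set_mem h; apply/mem_set; move: h; rewrite /B /= aE normsqN.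
    by congr (_ * _); rewrite !wd -dwN aE.
  by move/eqP; rewrite -addr_eq0 -mulr2n mulrn_eq0 => /eqP.
have iF := bounded_support_integrable hF.
have iB : lambda.-integrable B (EFin \o F).
  by apply: (integrableS measurableT).
have icst : lambda.-integrable B (EFin \o cst (w a)).
  apply: measurable_bounded_integrable => //.
  exact: bounded_cst.
transitivity (\int[lambda]_(z in B) ((F z)%:E + (w a)%:E))%E; last first.
  apply: eq_integral => z /set_mem Bz; rewrite /F indicE mem_set// mulr1.
  by rewrite -EFinD subrK.
rewrite integralD// integral_cst//.
suff -> : (\int[lambda]_(z in B) (F z)%:E = 0)%E by rewrite add0e.
rewrite integral_mkcond -[RHS](congr1 EFin F0) /Rintegral fineK; last first.
  exact: (integrable_fin_num measurableT iF).
apply: eq_integral => z _; rewrite patchE; case: ifPn => // zB.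
by rewrite /F indicE (negbTE zB) mulr0.
Qed.

Lemma linear_subharmonic : subharmonic setT (EFin \o w).
Proof.
split => [|z _|z _|a r r0 B _]; first exact: openT.
- split; first exact: ltry.
  move=> a; rewrite lte_fin => wa.
  have /cvgr_lt/(_ _ wa) wna : w y @[y --> z] --> w z by exact: cw.
  by rewrite near_withinE; apply: filterS wna => y ya _; rewrite lte_fin.
- by exists z => //; exact: connected_component_refl.
- by rewrite linear_mean_value.
Qed.

End linear_functions.

(** * Expansion of the wedge product in real directions *)

Section wedge_expansion.
Context {R : realType} {n : nat}.
Local Notation Cn := (Cn R n).

Definition real_dir (b : bool) (j : 'I_n) : Cn := if b then diry j else dirx j.

(* [d/dz_j = \sum_b dz_coef b * D_(real_dir b j)], and conjugately for [d/dzbar_j] *)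
Definition dz_coef (b : bool) : R[i] := if b then Complex 0 (- 2^-1) else Complex 2^-1 0.
Definition dzbar_coef (b : bool) : R[i] := if b then Complex 0 2^-1 else Complex 2^-1 0.

Lemma complex_dz_dzbar (D : bool -> bool -> R) :
  Complex ((D false false + D true true) / 4) ((D false true - D true false) / 4) =
  \sum_(b : bool) \sum_(b' : bool) (dz_coef b * dzbar_coef b') * (D b b')%:C%C.
Proof.
rewrite !big_bool /dz_coef /dzbar_coef.
by apply/eqP; rewrite eq_complex /=; apply/andP; split; apply/eqP; field.
Qed.

Lemma hessCE (f : Cn -> R) z j k : hessC f z j k =
  \sum_(b : bool) \sum_(b' : bool) (dz_coef b * dzbar_coef b') *
    ('D_(real_dir b j) ('D_(real_dir b' k) f) z)%:C%C.
Proof.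
rewrite mxE.
exact: (complex_dz_dzbar (fun b b' => 'D_(real_dir b j) ('D_(real_dir b' k) f) z)).
Qed.

Lemma prod_sum2_distr (I : finType) (T : comRingType) (F : I -> bool -> bool -> T) :
  \prod_(i : I) \sum_b \sum_b' F i b b' =
  \sum_(u : {ffun I -> bool}) \sum_(v : {ffun I -> bool})
    \prod_(i : I) F i (u i) (v i).
Proof.
rewrite bigA_distr_bigA /=; apply: eq_bigr => u _.
by rewrite bigA_distr_bigA.
Qed.

Lemma ffun_comp_perm_inj (s : 'S_n) :
  injective (fun u : {ffun 'I_n -> bool} => [ffun i => u (s i)]).
Proof.
move=> u v /ffunP uv; apply/ffunP => i.
by have := uv ((s^-1)%g i); rewrite !ffunE permKV.
Qed.

(** Multilinearity in the choice between the x- and the y-direction. Reindexing [u] by [s] and [v]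
    by [t] attaches the choices to the coordinates instead of the factors. The complex coefficient
    then no longer depends on the permutations, and each pair [u], [v] leaves a real signed double
    sum with one fixed direction per coordinate on either side. *)
Lemma wedge_coefE (A : 'I_n -> 'M[R[i]]_n)
    (D : 'I_n -> bool -> bool -> 'I_n -> 'I_n -> R) :
  (forall k i j, A k i j = \sum_(b : bool) \sum_(b' : bool)
     (dz_coef b * dzbar_coef b') * (D k b b' i j)%:C%C) ->
  wedge_coef A = \sum_(u : {ffun 'I_n -> bool}) \sum_(v : {ffun 'I_n -> bool})
    ((\prod_i dz_coef (u i)) * (\prod_i dzbar_coef (v i))) *
    (\sum_(s : 'S_n) \sum_(t : 'S_n) (-1) ^+ s * (-1) ^+ t *
       \prod_k D k (u (s k)) (v (t k)) (s k) (t k))%:C%C.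
Proof.
move=> AE.
have step (s t : 'S_n) : \prod_(k < n) A k (s k) (t k) =
  \sum_(u : {ffun 'I_n -> bool}) \sum_(v : {ffun 'I_n -> bool})
    ((\prod_i dz_coef (u i)) * (\prod_i dzbar_coef (v i))) *
    (\prod_k D k (u (s k)) (v (t k)) (s k) (t k))%:C%C.
  under eq_bigr do rewrite AE.
  rewrite prod_sum2_distr (reindex_inj (@ffun_comp_perm_inj s)) /=.
  apply: eq_bigr => u _; rewrite (reindex_inj (@ffun_comp_perm_inj t)) /=.
  apply: eq_bigr => v _; rewrite big_split /= big_split /=; congr (_ * _ * _).
  - rewrite [RHS](reindex_inj (@perm_inj _ s)) /=.
    by apply: eq_bigr => i _; rewrite ffunE.
  - rewrite [RHS](reindex_inj (@perm_inj _ t)) /=.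
    by apply: eq_bigr => i _; rewrite ffunE.
  - by rewrite rmorph_prod; apply: eq_bigr => i _; rewrite !ffunE.
rewrite /wedge_coef.
under eq_bigr => s _.
  under eq_bigr => t _.
    rewrite step mulr_sumr; under eq_bigr do rewrite mulr_sumr; over.
  rewrite exchange_big; under eq_bigr do rewrite exchange_big; over.
rewrite exchange_big /=; apply: eq_bigr => u _.
rewrite exchange_big /=; apply: eq_bigr => v _.
rewrite rmorph_sum mulr_sumr; apply: eq_bigr => s _.
rewrite rmorph_sum mulr_sumr; apply: eq_bigr => t _.
by rewrite !rmorphM /= !rmorphXn /= !rmorphN1 mulrCA.
Qed.

Lemma Re_mul_real (z : R[i]) (x : R) : complex.Re (z * x%:C%C) = complex.Re z * x.
Proof. by case: z => a b /=; rewrite mulr0 subr0. Qed.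

Lemma Re_sum (I : Type) (r : seq I) (F : I -> R[i]) :
  complex.Re (\sum_(i <- r) F i) = \sum_(i <- r) complex.Re (F i).
Proof.
elim: r => [|i r IH]; first by rewrite !big_nil.
by rewrite !big_cons -IH; case: (F i) (\sum_(_ <- r) _) => [a b] [c d].
Qed.

End wedge_expansion.

(** * The mixed density integrates to zero against real-linear functions *)

Section linear_msh.
Context {R : realType} {k : nat}.
Local Notation Cn := (Cn R k.+1).
Local Notation lambda := (@lebesgue_Cn R k.+1).

Lemma hessC_off_support (K : set Cn) (phi : Cn -> R) z : closed K ->
  (forall z, ~ K z -> phi z = 0) -> ~ K z -> hessC phi z = 0.
Proof.
move=> cK phi0 zK; apply/matrixP => i j; rewrite hessCE mxE.
rewrite big1// => b _; rewrite big1// => b' _.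
rewrite (derive_off_support _ cK _ zK) ?rmorph0 ?mulr0// => y.
exact: derive_off_support.
Qed.

Lemma wedge_coef0 (A : 'I_k.+1 -> 'M[R[i]]_k.+1) : A ord0 = 0 -> wedge_coef A = 0.
Proof.
move=> A0; rewrite /wedge_coef big1// => s _; rewrite big1// => t _.
by rewrite big_ord_recl A0 mxE mul0r mulr0.
Qed.

(** For each choice of real directions the term is an instance of [mixed_hessian_null], with [phi],
    the [v j] and [normsq] as factors. The dimension is written [k.+1] so that the index [ord0],
    which carries the compactly supported [phi], exists. *)
Lemma linear_ddc_null (m : nat) (V : set Cn) (w dw : Cn -> R)
    (v : nat -> Cn -> R) (phi : Cn -> R) : open V -> continuous w ->
  (forall z u (t : R), w (z + t *: u) = w z + t * dw u) ->
  (forall j, (1 <= j < m)%N -> Ck 2 V (v j)) -> test_fun V phi ->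
  null_integral (fun z => w z * ddc_density m phi v z).
Proof.
move=> oV cw wE vP phiT; have [phiC _ [K [cK KV phi0]]] := phiT.
pose f (l : 'I_k.+1) : Cn -> R := if l == 0%N :> nat then phi
  else if (l < m)%N then v l else @normsq R k.+1.
have f2 l : Ck 2 V (f l).
  rewrite /f; have [_|l0] := eqVneq (l : nat) 0%N; first exact: Ck_sub (phiC 2%N).
  case: ifPn => lm; last exact: Ck2_normsq.
  by apply: vP; rewrite lt0n l0.
have f0 z : ~ K z -> f ord0 z = 0 by exact: phi0.
pose H (u u' : {ffun 'I_k.+1 -> bool}) z :=
  \sum_(s : 'S_k.+1) \sum_(t : 'S_k.+1) (-1) ^+ s * (-1) ^+ t *
    \prod_l 'D_(real_dir (u (s l)) (s l)) ('D_(real_dir (u' (t l)) (t l)) (f l)) z.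
pose c (u u' : {ffun 'I_k.+1 -> bool}) : R := complex.Re
  ((\prod_i (dz_coef (u i) : R[i])) * (\prod_i dzbar_coef (u' i))).
have E z : w z * ddc_density m phi v z = \sum_(u : {ffun 'I_k.+1 -> bool})
    \sum_(u' : {ffun 'I_k.+1 -> bool}) c u u' * (w z * H u u' z).
  transitivity (w z * complex.Re (wedge_coef (fun l => hessC (f l) z))).
    congr (_ * complex.Re (wedge_coef _)); apply/funext => l.
    by rewrite /f; case: ifP => // _; case: ifP.
  rewrite (@wedge_coefE R k.+1 (fun l => hessC (f l) z) (fun l b b' i j =>
    'D_(real_dir b i) ('D_(real_dir b' j) (f l)) z)); last first.
    by move=> l i j; exact: hessCE.
  rewrite Re_sum mulr_sumr; apply: eq_bigr => u _.
  rewrite Re_sum mulr_sumr; apply: eq_bigr => u' _.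
  by rewrite Re_mul_real mulrCA.
rewrite (_ : (fun z => _) = (fun z => \sum_(u : {ffun 'I_k.+1 -> bool})
    \sum_(u' : {ffun 'I_k.+1 -> bool}) c u u' * (w z * H u u' z))); last exact/funext.
apply: null_integral_sum => u _; apply: null_integral_sum => u' _.
apply: null_integralZ.
exact: (@mixed_hessian_null R k.+1 k (fun j => real_dir (u j) j)
  (fun j => real_dir (u' j) j) f K V w dw oV cK KV f0 f2 cw wE).
Qed.

Lemma linear_msh (m : nat) (w dw : Cn -> R) : continuous w ->
  (forall z u (t : R), w (z + t *: u) = w z + t * dw u) -> msh m setT (EFin \o w).
Proof.
move=> cw wE; split; first exact: linear_subharmonic cw wE.
move=> V v oV _ vP phi phiT.
have [|iF F0] := @linear_ddc_null m V w dw v phi oV cw wE _ phiT.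
  by move=> j /vP[].
rewrite (_ : integral _ _ _ = 0%E)//.
(* Outside [V] the Hessian of [phi] is zero and so is the density: the integral over [V] equals the
   one over the whole space. *)
rewrite integral_mkcond -[RHS](congr1 EFin F0) /Rintegral fineK; last first.
  exact: (integrable_fin_num measurableT iF).
have [_ _ [K [cK KV phi0]]] := phiT.
apply: eq_integral => z _; rewrite patchE; case: ifPn => // zV.
rewrite /ddc_density wedge_coef0 ?mulr0//=.
apply: (hessC_off_support (K := K)) => //.
  by apply: compact_closed => //; exact: Cn_hausdorff.
by move=> /KV/mem_set Vz; rewrite Vz in zV.
Qed.

End linear_msh.

(** * Hahn-Banach and Riesz *)

Section hahn_banach.
Context {R : realType} {V : lmodType R}.
Implicit Types (p q : V -> R) (x y : V).

Definition sublinear p := (forall x y, p (x + y) <= p x + p y) /\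
  (forall (t : R) x, 0 <= t -> p (t *: x) <= t * p x).

Lemma sublinear0 p : sublinear p -> p 0 = 0.
Proof.
move=> [pD pZ]; apply/eqP; rewrite eq_le; apply/andP; split.
  by have := pZ 0 0 (lexx _); rewrite scaler0 mul0r.
by have := pD 0 0; rewrite addr0 lerDl.
Qed.

Lemma sublinearZ p (t : R) x : sublinear p -> 0 <= t -> p (t *: x) = t * p x.
Proof.
move=> sp; rewrite le_eqVlt => /orP[/eqP <-|t0].
  by rewrite scale0r mul0r sublinear0.
have [_ pZ] := sp; apply/eqP; rewrite eq_le pZ ?(ltW t0)//=.
rewrite -ler_pdivlMl// -{1}(scale1r x) -(mulVf (lt0r_neq0 t0)) -scalerA.
by rewrite pZ// invr_ge0 ltW.
Qed.

Lemma sublinearN p x : sublinear p -> - p (- x) <= p x.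
Proof.
by move=> sp; rewrite lerNl -subr_ge0 opprK -(sublinear0 sp) -{1}(subrr x) addrC;
  rewrite [- x + x]addrC; case: sp => pD _; rewrite [leRHS]addrC; exact: pD.
Qed.

(** A sublinear minorant of [p] whose value at [- y] is at most [- p y]. A minimal sublinear
    functional must coincide with all its minorants of this kind, which forces it to be odd and
    hence linear. *)
Definition sublinear_along p y x : R :=
  inf [set p (x + t *: y) - t * p y | t in [set t : R | 0 <= t]].

Let along_lb p y x : sublinear p ->
  lbound [set p (x + t *: y) - t * p y | t in [set t : R | 0 <= t]] (- p (- x)).
Proof.
move=> sp _ [t /= t0 <-]; rewrite lerBrDl lerBlDr -(sublinearZ _ sp t0).
have [pD _] := sp; apply: le_trans (pD _ _).
by rewrite addrAC subrr add0r.
Qed.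

Lemma sublinear_along_le p y x (t : R) : sublinear p -> 0 <= t ->
  sublinear_along p y x <= p (x + t *: y) - t * p y.
Proof.
move=> sp t0; apply: ge_inf; last by exists t.
by exists (- p (- x)); exact: along_lb.
Qed.

Lemma sublinear_alongP p y x (a : R) :
  (forall t, 0 <= t -> a <= p (x + t *: y) - t * p y) -> a <= sublinear_along p y x.
Proof.
move=> h; apply: lb_le_inf; first by
  exists (p (x + 0 *: y) - 0 * p y); exists 0 => //; exact: lexx.
by move=> _ [t /= t0 <-]; exact: h.
Qed.

Lemma sublinear_along_sublinear p y : sublinear p -> sublinear (sublinear_along p y).
Proof.
move=> sp; have [pD pZ] := sp; split.
  move=> x x'; rewrite -lerBlDr; apply: sublinear_alongP => t t0.
  rewrite lerBlDr -lerBlDl; apply: sublinear_alongP => s s0; rewrite lerBlDl.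
  apply: (le_trans (sublinear_along_le _ _ sp (addr_ge0 t0 s0))).
  rewrite scalerDl addrACA mulrDl.
  have := pD (x + t *: y) (x' + s *: y); lra.
move=> s x; rewrite le_eqVlt => /orP[/eqP <-|s0].
  rewrite scale0r mul0r (le_trans (sublinear_along_le y 0 sp (lexx 0)))//.
  by rewrite scale0r addr0 mul0r subr0 sublinear0.
rewrite -ler_pdivrMl//; apply: sublinear_alongP => t t0.
rewrite ler_pdivrMl//.
apply: (le_trans (sublinear_along_le _ _ sp (mulr_ge0 (ltW s0) t0))).
by rewrite -scalerA -scalerDr (sublinearZ _ sp (ltW s0)) mulrBr mulrA.
Qed.

Lemma sublinear_alongW p y x : sublinear p -> sublinear_along p y x <= p x.
Proof.
move=> sp; rewrite (le_trans (sublinear_along_le y x sp (lexx 0)))//.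
by rewrite scale0r addr0 mul0r subr0.
Qed.

Lemma sublinear_alongN p y : sublinear p -> sublinear_along p y (- y) <= - p y.
Proof.
move=> sp; rewrite (le_trans (sublinear_along_le y (- y) sp ler01))//.
by rewrite scale1r addNr mul1r sublinear0// sub0r.
Qed.

Lemma minimal_sublinear p : sublinear p -> exists q, [/\ sublinear q,
  forall x, q x <= p x &
  forall r, sublinear r -> (forall x, r x <= q x) -> r = q].
Proof.
move=> sp.
pose T := {q : V -> R | sublinear q /\ forall x, q x <= p x}.
pose Rel (q r : T) := `[< forall x, sval r x <= sval q x >].
have [|||A Atot|q qmin] := @Zorn T Rel.
- by move=> q; apply/asboolP => x.
- move=> q r s /asboolP qr /asboolP rs; apply/asboolP => x.
  exact: le_trans (rs x) (qr x).
- move=> [q qP] [r rP] /asboolP /= qr /asboolP /= rq; apply: eq_exist.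
  by apply/funext => x; apply/eqP; rewrite eq_le qr rq.
- have [[q0 Aq0]|A0] := pselect (A !=set0); last first.
    exists (exist _ p (conj sp (fun x => lexx (p x)))) => s As; exfalso.
    by apply: A0; exists s.
  (* The infimum along the chain is finite because [- p (- x)] is a lower bound for every member; it
     is subadditive because, of two comparable members, the smaller one can be used for both
     summands. *)
  pose m x : R := inf [set sval q x | q in A].
  have m_le (q : T) x : A q -> m x <= sval q x.
    move=> Aq; apply: ge_inf; last by exists q.
    exists (- p (- x)) => _ [r Ar <-]; have [sr rp] := svalP r.
    by apply: le_trans (sublinearN _ sr); rewrite lerN2.
  have mP x (a : R) : (forall q : T, A q -> a <= sval q x) -> a <= m x.
    move=> h; apply: lb_le_inf; first by exists (sval q0 x), q0.
    by move=> _ [r Ar <-]; exact: h.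
  have sm : sublinear m.
    split.
      move=> x y; rewrite -lerBlDr; apply: (mP) => q Aq.
      rewrite lerBlDr -lerBlDl; apply: (mP) => r Ar; rewrite lerBlDl.
      have [[qD _] _] := svalP q; have [[rD _] _] := svalP r.
      have [/asboolP qr|/asboolP rq] := Atot q r Aq Ar.
        by rewrite (le_trans (m_le r _ Ar))// (le_trans (rD _ _))// lerD2r.
      by rewrite (le_trans (m_le q _ Aq))// (le_trans (qD _ _))// lerD2l.
    move=> t x; rewrite le_eqVlt => /orP[/eqP <-|t0].
      rewrite mul0r scale0r (le_trans (m_le q0 _ Aq0))//.
      by have [sq _] := svalP q0; rewrite sublinear0.
    rewrite -ler_pdivrMl//; apply: (mP) => q Aq; rewrite ler_pdivrMl//.
    by have [[_ qZ] _] := svalP q; rewrite (le_trans (m_le q _ Aq))// qZ// ltW.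
  have mp x : m x <= p x.
    by have [_ qp] := svalP q0; exact: le_trans (m_le q0 x Aq0) (qp x).
  by exists (exist _ m (conj sm mp)) => q Aq; apply/asboolP => x; exact: m_le.
have [sq qp] := svalP q; exists (sval q); split => // r sr rq.
have rp x : r x <= p x by exact: le_trans (rq x) (qp x).
suff <- : exist _ r (conj sr rp) = q by [].
by apply: qmin; apply/asboolP.
Qed.

(** Linearity comes from minimality, not from extending a functional off a subspace. Starting below
    [sublinear_along p x0] rather than below [p] yields [L (- x0) <= - p x0], that is, contact at
    [x0]. *)
Theorem hahn_banach_dominated p x0 : sublinear p -> exists L : V -> R,
  [/\ forall x y, L (x + y) = L x + L y, forall (t : R) x, L (t *: x) = t * L x,
      forall x, L x <= p x & L x0 = p x0].
Proof.
move=> sp; have sp0 := sublinear_along_sublinear x0 sp.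
have [L [sL Lp Lmin]] := minimal_sublinear sp0.
have LN x : L (- x) = - L x.
  apply/eqP; rewrite eq_le; apply/andP; split.
    rewrite -{1}(Lmin _ (sublinear_along_sublinear x sL)).
      exact: sublinear_alongN.
    by move=> y; exact: sublinear_alongW.
  by rewrite lerNl; exact: sublinearN.
have [LD LZ] := sL.
exists L; split.
- move=> x y; apply/eqP; rewrite eq_le LD/=.
  by have := LD (x + y) (- y); rewrite addrK LN lerBrDr.
- move=> t x; have [t0|t0] := leP 0 t; first exact: sublinearZ.
  by rewrite -[t]opprK scaleNr LN sublinearZ ?mulNr// oppr_ge0 ltW.
- by move=> x; exact: le_trans (Lp x) (sublinear_alongW _ _ sp).
- apply/eqP; rewrite eq_le (le_trans (Lp x0) (sublinear_alongW _ _ sp))/=.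
  rewrite -lerN2 -LN; apply: le_trans (Lp _) _; exact: sublinear_alongN.
Qed.

End hahn_banach.

(** * Hahn-Banach on the space of functions bounded on a set *)

Section bounded_functions.
Context {R : realType} {T : Type}.
Variable E : set T.

Definition bounded_on (f : T -> R) := exists M : R, forall x, E x -> `|f x| <= M.

Definition bounded_fun_pred : {pred T -> R} := [pred f | `[< bounded_on f >]].

Lemma bounded_fun_submod_closed : submod_closed bounded_fun_pred.
Proof.
split; first by apply/asboolP; exists 0 => x _; rewrite normr0.
move=> c f g /asboolP[M fM] /asboolP[N gN]; apply/asboolP.
exists (`|c| * M + N) => x Ex; rewrite (le_trans (ler_normD _ _))//.
by rewrite lerD ?gN// normrM ler_wpM2l// fM.
Qed.

HB.instance Definition _ :=
  GRing.isSubmodClosed.Build R (T -> R) bounded_fun_pred bounded_fun_submod_closed.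

Record bounded_fun := BoundedFun {
  bounded_fun_val : T -> R ; _ : bounded_fun_val \in bounded_fun_pred }.

HB.instance Definition _ := [isSub for bounded_fun_val].
HB.instance Definition _ := [Choice of bounded_fun by <:].
HB.instance Definition _ := [SubChoice_isSubLmodule of bounded_fun by <:].

Lemma hahn_banach_bounded (p : (T -> R) -> R) (f0 : T -> R) :
  (forall f g, bounded_on f -> bounded_on g -> p (f \+ g) <= p f + p g) ->
  (forall (t : R) f, bounded_on f -> 0 <= t -> p (fun x => t * f x) <= t * p f) ->
  bounded_on f0 -> exists L : (T -> R) -> R,
  [/\ forall f g, bounded_on f -> bounded_on g -> L (f \+ g) = L f + L g,
      forall c f, bounded_on f -> L (fun x => c * f x) = c * L f,
      forall f, bounded_on f -> L f <= p f & L f0 = p f0].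
Proof.
move=> pD pZ bf0.
have bv (u : bounded_fun) : bounded_on (bounded_fun_val u).
  by apply/asboolP; case: u.
have mkP f : bounded_on f -> f \in bounded_fun_pred by move=> bf; exact/asboolP.
have [|l [lD lZ lp l0]] := @hahn_banach_dominated R bounded_fun
    (p \o bounded_fun_val) (BoundedFun (mkP _ bf0)).
  split=> [u v|t u t0]; first exact: (pD _ _ (bv u) (bv v)).
  exact: (pZ t _ (bv u) t0).
(* Off the bounded functions [L] takes the default value [0]; its laws are claimed for bounded
   functions only. *)
pose L f := if pselect (bounded_on f) is left bf then l (BoundedFun (mkP f bf)) else 0.
have LE f (bf : bounded_on f) : L f = l (BoundedFun (mkP f bf)).
  by rewrite /L; case: pselect => // bf'; congr l; exact: val_inj.
have bD f g : bounded_on f -> bounded_on g -> bounded_on (f \+ g).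
  move=> [M fM] [N gN]; exists (M + N) => x Ex.
  by rewrite (le_trans (ler_normD _ _))// lerD ?fM ?gN.
have bZ c f : bounded_on f -> bounded_on (fun x => c * f x).
  by move=> [M fM]; exists (`|c| * M) => x Ex; rewrite normrM ler_wpM2l// fM.
exists L; split.
- move=> f g bf bg; rewrite (LE _ (bD _ _ bf bg)) (LE f bf) (LE g bg) -lD.
  by congr l; exact: val_inj.
- move=> c f bf; rewrite (LE _ (bZ c _ bf)) (LE f bf) -lZ.
  by congr l; exact: val_inj.
- by move=> f bf; rewrite (LE f bf); exact: lp.
- by rewrite (LE f0 bf0); exact: l0.
Qed.

End bounded_functions.

Section compact_covers.

Lemma compact_seq_cover (T : topologicalType) (K : set T) (P : T -> set T -> Prop) :
  compact K -> (forall x, K x -> exists C, [/\ open C, C x & P x C]) ->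
  exists (f : T -> set T) (s : seq T),
    (forall x, x \in s -> K x /\ open (f x) /\ P x (f x)) /\
    K `<=` [set y | exists2 x, x \in s & f x y].
Proof.
move=> cK hK.
have /choice[f fP] x : exists C, K x -> [/\ open C, C x & P x C].
  have [/hK[C CP]|nKx] := pselect (K x); first by exists C.
  by exists set0.
(* Lists directed by inclusion: along this filter, near-covering compactness states that a long
   enough list of centers covers [K]. *)
pose F : set_system (seq T) :=
  [set Q | exists s0 : seq T, forall s : seq T, {subset s0 <= s} -> Q s].
have FF : Filter F.
  split; first by exists [::].
  - move=> P1 P2 [s1 H1] [s2 H2]; exists (s1 ++ s2) => s s12; split.
      by apply: H1 => x xs; apply: s12; rewrite mem_cat xs.
    by apply: H2 => x xs; apply: s12; rewrite mem_cat xs orbT.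
  - by move=> P1 P2 P12 [s1 H1]; exists s1 => s /H1; exact: P12.
pose Q (s : seq T) y := exists2 x, x \in s & K x /\ f x y.
have [x Kx|s0 H] := proj1 (compact_near_coveringP K) cK _ F Q FF.
  have [ofx fx _] := fP x Kx.
  exists (f x, [set s : seq T | x \in s]) => /=.
    split; first exact: open_nbhs_nbhs.
    by exists [:: x] => s; apply; rewrite mem_head.
  by move=> [y s] /= [fxy xs]; exists x.
exists f, [seq x <- s0 | `[< K x >]]; split.
  move=> x; rewrite mem_filter => /andP[/asboolP Kx _].
  by have [] := fP x Kx.
move=> y Ky; have [x xs [Kx fxy]] := H s0 (fun _ => id) y Ky.
by exists x => //; rewrite mem_filter xs andbT; exact/asboolP.
Qed.

End compact_covers.

(** * Clopen sets of the Cantor space and extension of contents *)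

Section cantor_clopen.
Local Notation cantor := cantor_space.

Lemma cantor_clopen_basis (x : cantor) (U : set cantor) : nbhs x U ->
  exists C, [/\ clopen C, C x & C `<=` U].
Proof.
move=> xU; have [C [Cx cC] CU] := zero_dimensional_cvg cantor_space_hausdorff
  cantor_zero_dimensional cantor_space_compact xU.
by exists C.
Qed.

Lemma clopen_seq_cover (s : seq cantor) (f : cantor -> set cantor) :
  (forall x, x \in s -> clopen (f x)) ->
  clopen [set y | exists2 x, x \in s & f x y].
Proof.
elim: s => [_|a s IH sf].
  rewrite (_ : [set _ | _] = set0); first exact: clopen0.
  by apply/seteqP; split => // y [].
rewrite (_ : [set _ | _] = f a `|` [set y | exists2 x, x \in s & f x y]).
  apply: clopenU; first by apply: sf; rewrite mem_head.
  by apply: IH => x xs; apply: sf; rewrite in_cons xs orbT.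
apply/seteqP; split => y /=.
  move=> [x]; rewrite in_cons => /orP[/eqP ->|xs] fxy; first by left.
  by right; exists x.
move=> [fay|[x xs fxy]]; first by exists a; rewrite ?mem_head.
by exists x; rewrite // in_cons xs orbT.
Qed.

Lemma clopen_between (K U : set cantor) : closed K -> open U -> K `<=` U ->
  exists C, [/\ clopen C, K `<=` C & C `<=` U].
Proof.
move=> cK oU KU.
have compK : compact K by apply: (subclosed_compact cK cantor_space_compact).
have [x Kx|f [s [sP Ks]]] :=
    @compact_seq_cover cantor K (fun _ C => clopen C /\ C `<=` U) compK.
  have [C [cC Cx CU]] := cantor_clopen_basis (open_nbhs_nbhs (conj oU (KU x Kx))).
  by exists C; split => //; case: cC.
exists [set y | exists2 x, x \in s & f x y]; split => //.
  by apply: clopen_seq_cover => x /sP[_ [_ []]].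
by move=> y [x /sP[_ [_ [_ fU]]] fxy]; exact: fU.
Qed.

Definition clopen_space : Type := cantor.

HB.instance Definition _ := Pointed.on clopen_space.
HB.instance Definition _ := isAlgebraOfSets.Build default_measure_display
  clopen_space (@clopen0 cantor) (@clopenU cantor)
  (fun A => @clopenC cantor A A).

Definition clopen_sigma : Type := g_sigma_algebraType (@measurable _ clopen_space).
HB.instance Definition _ := Measurable.on clopen_sigma.

Lemma clopen_measurable (C : set cantor) : clopen C -> measurable (C : set clopen_sigma).
Proof. by move=> cC; exact: sub_sigma_algebra. Qed.

(** Countable additivity is automatic: a clopen union of disjoint clopen sets is compact, so all but
    finitely many of them are empty. *)
Lemma clopen_content_extension (R : realType) (L : set cantor -> R) :
  L set0 = 0 -> (forall A, 0 <= L A) ->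
  (forall A B, A `&` B = set0 -> L (A `|` B) = L A + L B) ->
  exists nu : {measure set clopen_sigma -> \bar R},
    forall C, clopen C -> nu C = (L C)%:E.
Proof.
move=> L0 Lge0 LU.
pose mu (A : set clopen_space) := (L A)%:E.
have mu_sum (F : nat -> set cantor) n : trivIset setT F ->
    (\sum_(0 <= i < n) mu (F i) = (L (\bigcup_(i < n) F i))%:E)%E.
  move=> tF; elim: n => [|n IH].
    by rewrite big_nil bigcup_mkord big_ord0 L0.
  rewrite big_nat_recr//= IH !bigcup_mkord big_ord_recr /= LU//.
  rewrite -bigcup_mkord -subset0 => x [[i /= ni Fi] Fn].
  have := tF i n I I (ex_intro _ x (conj Fi Fn)) => ein.
  by rewrite ein ltnn in ni.
have mu_sigma : semi_sigma_additive mu.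
  move=> F mF tF mUF.
  have cU : compact (\bigcup_k F k : set cantor).
    by apply: (subclosed_compact _ cantor_space_compact) => //; case: mUF.
  have [N FN] : exists N, forall n, (N <= n)%N -> F n = set0.
    move: cU; rewrite compact_cover.
    move=> /(_ nat setT F)[i _|x [i _ Fx]|D _ UD]; first by case: (mF i).
      by exists i.
    exists (\max_(i <- finmap.enum_fset D) i).+1 => n Dn; rewrite -subset0 => x Fx.
    have [i /= iD Fi] := UD x (ex_intro2 _ _ n I Fx).
    have ein := tF i n I I (ex_intro _ x (conj Fi Fx)).
    have : (i <= \max_(i <- finmap.enum_fset D) i)%N by exact: leq_bigmax_seq.
    by rewrite leqNgt ein Dn.
  apply: cvg_near_cst; exists N => // n /= Nn; rewrite mu_sum//; congr (L _)%:E.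
  apply/seteqP; split => x [i ni Fi]; first by exists i.
  exists i => //; rewrite /= ltnNge; apply/negP => ni'.
  by rewrite FN ?(leq_trans Nn) in Fi.
have mu0 : mu set0 = 0%E by rewrite /mu L0.
have mu_ge0 A : (0 <= mu A)%E by rewrite lee_fin.
pose mm : {measure set clopen_space -> \bar R} :=
  HB.pack mu (isMeasure.Build _ _ _ mu mu0 mu_ge0 mu_sigma).
exists (measure_extension mm) => C cC.
exact: (@measurable_mu_extE _ R clopen_space mm C cC).
Qed.

End cantor_clopen.

(** * Compact subsets of C^n as continuous images of the Cantor space *)

Section subset_surjection.
Context {R : realType} {n : nat}.
Local Notation Cn := (Cn R n).
Local Notation borelCn := (borelCn R n).

(** The point [x0] is a parameter of the type, so that a set nonempty only by hypothesis becomes a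
    pointed space, to which the surjection from the Cantor space applies. *)
Definition pointed_set_type (E : set Cn) (x0 : E) : Type := E.

Section instances.
Variables (E : set Cn) (x0 : E).
HB.instance Definition _ := Choice.on (@pointed_set_type E x0).
HB.instance Definition _ := isPointed.Build (@pointed_set_type E x0) x0.
HB.instance Definition _ := PseudoMetric.copy (@pointed_set_type E x0) (set_type E).
End instances.

Lemma compact_set_type (E : set Cn) (x0 : E) : compact E ->
  compact [set: @pointed_set_type E x0].
Proof.
move=> cE F PF _.
pose v (x : @pointed_set_type E x0) : Cn := set_val (x : E).
pose G : set_system Cn := v @ F.
have setE x : E (v x) by exact: set_valP.
have GE : G E.
  by apply: (@filterS _ F _ setT) => [x _|]; [exact: setE|exact: filterT].
have [x [Ex Gx]] := cE G _ GE.
exists (exist _ x (mem_set Ex) : E); split => // A U FA [V [[W oW <-] /= WxV] VU].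
have GA : G (v @` A).
  by apply: (@filterS _ F _ A) => [a Aa|//]; exists a.
have xW : nbhs x W by exact: open_nbhs_nbhs.
have [_ [[a Aa <-] Wa]] := Gx _ _ GA xW.
by exists a; split => //; exact: VU.
Qed.

Lemma hausdorff_set_type (E : set Cn) (x0 : E) :
  hausdorff_space (@pointed_set_type E x0).
Proof.
move=> p q pq; apply: val_inj; apply: (@Cn_hausdorff R n) => A B pA qB.
have cv (r : E) (C : set Cn) : nbhs (set_val r) C -> nbhs r (set_val @^-1` C).
  by apply: initial_continuous.
have [x [Ax Bx]] := pq _ _ (cv p A pA) (cv q B qB).
by exists (set_val x).
Qed.

Lemma cantor_surj_compact (E : set Cn) : compact E -> E !=set0 ->
  exists p : cantor_space -> Cn, [/\ continuous p, forall w, E (p w)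
    & forall x, E x -> exists w, p w = x].
Proof.
move=> cE [x Ex]; pose x0 : E := exist _ x (mem_set Ex).
have [f cf] := cantor_surj (compact_set_type (x0 := x0) cE) (@hausdorff_set_type E x0).
exists (fun w => set_val (f w : E)); split.
- move=> w; apply: (@continuous_comp cantor_space (@pointed_set_type E x0) Cn f set_val).
    exact: cf.
  exact: initial_continuous.
- by move=> w; exact: set_valP.
- move=> y Ey; have [w _ fw] := 'surj_f (I : [set: @pointed_set_type E x0]
    (exist _ y (mem_set Ey) : E)).
  by exists w; rewrite fw.
Qed.

(** The sigma-algebra is generated by the clopen sets, so the preimage of an open [V] has to be a
    countable union of such sets. One is inserted between the preimages of [inner_closed V k] and of
    [V], for each [k]. *)
Lemma measurable_cantor_map (p : cantor_space -> Cn) : continuous p ->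
  measurable_fun [set: clopen_sigma] (p : clopen_sigma -> borelCn).
Proof.
move=> cp; apply: open_measurable_fun => V oV.
have oPV : open (p @^-1` V) by apply: open_comp.
have /choice[C CP] k : exists C, [/\ clopen C, p @^-1` inner_closed V k `<=` C &
    C `<=` p @^-1` V].
  apply: clopen_between => //.
    by apply: closed_comp => [w _|]; [exact: cp|exact: closed_inner_closed].
  by move=> w; exact: inner_closed_sub.
rewrite (_ : p @^-1` V = \bigcup_k C k).
  by apply: bigcup_measurable => k _; apply: clopen_measurable; have [] := CP k.
apply/seteqP; split => [w|w [k _ Ckw]]; last by have [_ _] := CP k; exact.
rewrite /= -{1}(bigcup_inner_closed oV) => -[k _ Vw].
by exists k => //; have [_ + _] := CP k; exact.
Qed.

End subset_surjection.

Section unit_mass.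
Context d (T : measurableType d) (R : realType).
Variables (mu : {measure set T -> \bar R}) (mu1 : mu setT = 1%E).

Definition unit_mass_probability of mu setT = 1%E : set T -> \bar R := mu.
HB.instance Definition _ := Measure.on (unit_mass_probability mu1).
HB.instance Definition _ :=
  Measure_isProbability.Build _ _ _ (unit_mass_probability mu1) mu1.

End unit_mass.

(** * Riesz representation on a compact set *)

Section riesz.
Context {R : realType} {n : nat}.
Local Notation Cn := (Cn R n).
Local Notation borelCn := (borelCn R n).

Lemma within_open_preimage (E : set Cn) (f : Cn -> R) (A : set R) :
  {within E, continuous f} -> open A ->
  exists2 U : set Cn, open U & U `&` E = (f @^-1` A) `&` E.
Proof.
move=> cf oA; have : open ((f : subspace E -> R) @^-1` A).
  by move/continuousP : cf; apply.
by move/open_subspaceP.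
Qed.

Lemma within_continuous_measurable (E : set Cn) (f : Cn -> R) :
  measurable (E : set borelCn) -> {within E, continuous f} ->
  measurable_fun (E : set borelCn) (f : borelCn -> R).
Proof.
move=> mE cf; apply: (measurability _ (RGenOpens.measurableE R)) => //.
move=> _ [_ [a [b ->] <-]].
have oab : open `]a, b[%classic by exact: interval_open.
have [U oU UE] := within_open_preimage cf oab.
rewrite setIC -UE; apply: measurableI => //; exact: open_borel.
Qed.

Lemma compact_bounded_on (E : set Cn) (f : Cn -> R) : compact E ->
  {within E, continuous f} -> bounded_on E f.
Proof.
move=> cE cf; have [B [_ /(_ (B + 1))]] := compact_bounded (continuous_compact cf cE).
by rewrite ltrDl ltr01 => /(_ isT) H; exists (B + 1) => x Ex; apply: H; exists x.
Qed.

Definition normalized_positive (E : set Cn) (L : (Cn -> R) -> R) :=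
  [/\ forall f g, bounded_on E f -> bounded_on E g -> L (f \+ g) = L f + L g,
      forall c f, bounded_on E f -> L (fun x => c * f x) = c * L f,
      forall f, bounded_on E f -> (forall x, E x -> 0 <= f x) -> 0 <= L f
    & L (cst 1) = 1].

Variables (E : set Cn) (L : (Cn -> R) -> R).
Hypothesis (LP : normalized_positive E L).
Implicit Types f g : Cn -> R.

Lemma bounded_onD f g : bounded_on E f -> bounded_on E g -> bounded_on E (f \+ g).
Proof.
move=> [M fM] [N gN]; exists (M + N) => x Ex.
by rewrite (le_trans (ler_normD _ _))// lerD ?fM ?gN.
Qed.

Lemma bounded_onZ c f : bounded_on E f -> bounded_on E (fun x => c * f x).
Proof.
by move=> [M fM]; exists (`|c| * M) => x Ex; rewrite normrM ler_wpM2l// fM.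
Qed.

Lemma bounded_on_cst (c : R) : bounded_on E (cst c).
Proof. by exists `|c|. Qed.

Lemma bounded_on_indic (A : set Cn) : bounded_on E (\1_A : Cn -> R).
Proof.
by exists 1 => x _; rewrite indicE; case: (_ \in _); rewrite ?normr1 ?normr0.
Qed.

Lemma positive_le f g : bounded_on E f -> bounded_on E g ->
  (forall x, E x -> f x <= g x) -> L f <= L g.
Proof.
move=> bf bg fg; have [LD LZ L0 _] := LP.
have bh := bounded_onD bg (bounded_onZ (-1) bf).
have := L0 _ bh; rewrite LD//; last exact: bounded_onZ.
rewrite LZ// mulN1r subr_ge0; apply => x Ex /=.
by rewrite mulN1r subr_ge0 fg.
Qed.

Lemma positive_cst c : L (cst c) = c.
Proof.
have [_ LZ _ L1] := LP.
rewrite -[RHS]mulr1 -[X in _ * X]L1 -LZ; last exact: bounded_on_cst.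
by congr L; apply/funext => x; rewrite /= mulr1.
Qed.

Lemma positive_dist f g (e : R) : bounded_on E f -> bounded_on E g ->
  (forall x, E x -> `|f x - g x| <= e) -> `|L f - L g| <= e.
Proof.
move=> bf bg fg; have [LD _ _ _] := LP.
have H u v : bounded_on E u -> bounded_on E v -> (forall x, E x -> u x - v x <= e) ->
    L u - L v <= e.
  move=> bu bv uv; rewrite lerBlDl -[X in _ + X](positive_cst e) -LD//; last first.
    exact: bounded_on_cst.
  apply: positive_le => //; first by apply: bounded_onD => //; exact: bounded_on_cst.
  by move=> x Ex; rewrite /= -lerBlDl uv.
rewrite ler_norml lerNl opprB !H// => x Ex.
  by rewrite (le_trans (ler_norm _))// fg.
by rewrite (le_trans (ler_norm _))// distrC fg.
Qed.

Lemma positive_ext f g : bounded_on E f -> bounded_on E g ->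
  (forall x, E x -> f x = g x) -> L f = L g.
Proof.
move=> bf bg fg; apply/eqP; rewrite eq_le !positive_le//.
  by move=> x Ex; rewrite fg.
by move=> x Ex; rewrite fg.
Qed.

Hypothesis (cE : compact E) (E0 : E !=set0).

(* A clopen set of the Cantor space is given the mass that [L] puts on its
   preimage under a (possibly discontinuous) section of the surjection onto
   [E]: by compactness this finitely additive content is a premeasure. *)
Theorem riesz_compact : exists mu : probability borelCn R, mu E = 1%E /\
  forall f, {within E, continuous f} ->
    (\int[mu]_(x in E) (f x)%:E = (L f)%:E)%E.
Proof.
have [LD LZ L0 L1] := LP.
have [p [cp pE surjp]] := cantor_surj_compact cE E0.
have /choice[sg sgP] x : exists w, E x -> p w = x.
  by have [/surjp[w]|nEx] := pselect (E x); [exists w|exists point].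
pose mass (A : set cantor_space) : R := L \1_(sg @^-1` A).
have [] := @clopen_content_extension R mass.
- rewrite /mass preimage_set0 -(mul0r (L \1_set0)) -LZ; last exact: bounded_on_indic.
  by congr L; apply/funext => x; rewrite indic0 mulr0.
- move=> A; apply: L0; first exact: bounded_on_indic.
  by move=> x _; rewrite indicE ler0n.
- move=> A B AB; rewrite /mass -LD; [|exact: bounded_on_indic|exact: bounded_on_indic].
  congr L; rewrite preimage_setU; apply/funext => x /=.
  have : ~ (A (sg x) /\ B (sg x)) by move=> ABx; have : (A `&` B) (sg x) by []; rewrite AB.
  rewrite !indicE in_setU; case: (boolP (x \in _)) => [/set_mem Ax|_].
    case: (boolP (x \in _)) => [/set_mem Bx|_ _]; last by rewrite addr0.
    by move=> H; exfalso; apply: H.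
  by move=> _; rewrite add0r.
move=> nu nuP.
have mp := measurable_cantor_map cp.
pose mu := measure_function_pushforward__canonical__measure_function_Measure nu mp.
have nuT : nu setT = 1%E.
  rewrite nuP; last exact: clopenT.
  rewrite /mass preimage_setT -L1; congr (L _)%:E; apply/funext => x.
  by rewrite indicT.
have muT : mu setT = 1%E by rewrite /mu /= /pushforward preimage_setT.
exists (unit_mass_probability muT); split.
  rewrite /= /unit_mass_probability /= /pushforward (_ : p @^-1` E = setT)//.
  by apply/seteqP; split => // w _; exact: pE.
move=> f cf.
have mE := compact_borel cE.
have mfE : measurable_fun [set: borelCn] (f \_ E : borelCn -> R).
  by apply/(measurable_restrictT (T1 := borelCn) f mE); exact: within_continuous_measurable.
have [M fM] := compact_bounded_on cE cf.
pose g (w : cantor_space) : R := f (p w).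
have mg : measurable_fun [set: clopen_sigma] (g : clopen_sigma -> R).
  rewrite (_ : g = (f \_ E) \o p).
    exact: (@measurableT_comp _ _ _ clopen_sigma borelCn).
  by apply/funext => w; rewrite /= patchE mem_set.
have nu_int (u : cantor_space -> R) (B : R) :
    measurable_fun [set: clopen_sigma] (u : clopen_sigma -> R) ->
    (forall w, `|u w| <= B) -> nu.-integrable setT (EFin \o (u : clopen_sigma -> R)).
  move=> mu_ uB; apply: measurable_bounded_integrable => //.
    by rewrite [ltLHS](nuT) ltry.
  exists B; split; first exact: num_real.
  by move=> x Bx w _; exact: le_trans (uB w) (ltW Bx).
have gM w : `|g w| <= M by exact: fM.
have ig := nu_int _ _ mg gM.
pose h (s : seq (R * set cantor_space)) (w : cantor_space) : R :=
  \sum_(q <- s) q.1 * \1_(q.2) w.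
pose clopens (s : seq (R * set cantor_space)) := forall q, q \in s -> clopen q.2.
(* On step functions over clopen sets, integration against [nu] is [L] after composition with the
   section, by linearity alone. *)
have hP s : clopens s -> [/\ measurable_fun [set: clopen_sigma] (h s : clopen_sigma -> R),
    exists B : R, forall w, `|h s w| <= B &
    (\int[nu]_w h s w = L (fun x => h s (sg x)))%R].
  elim: s => [_|q s IH qs].
    rewrite (_ : h [::] = cst 0); last by apply/funext => w; rewrite /h big_nil.
    split; first exact: measurable_cst.
      by exists 0 => w; rewrite normr0.
    by rewrite Rintegral_cst// mul0r positive_cst.
  have cq : clopen q.2 by apply: qs; rewrite mem_head.
  have [|mh [B hB] Ih] := IH.
    by move=> q' q's; apply: qs; rewrite in_cons q's orbT.
  have mq : measurable_fun [set: clopen_sigma] (\1_(q.2) : clopen_sigma -> R).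
    by apply: measurable_indic; exact: clopen_measurable.
  have q1 w : `|\1_(q.2) w : R| <= 1.
    by rewrite indicE; case: (_ \in _); rewrite ?normr1 ?normr0.
  have -> : h (q :: s) = fun w => q.1 * \1_(q.2) w + h s w.
    by apply/funext => w; rewrite /h big_cons.
  have mqZ : measurable_fun [set: clopen_sigma]
      ((fun w => q.1 * \1_(q.2) w) : clopen_sigma -> R) by exact: measurable_funM.
  have qZ w : `|q.1 * \1_(q.2) w| <= `|q.1|.
    by rewrite normrM ler_piMr.
  split.
  - exact: measurable_funD.
  - exists (`|q.1| + B) => w; rewrite (le_trans (ler_normD _ _))// lerD//.
  - rewrite (RintegralD measurableT (nu_int _ _ mqZ qZ) (nu_int _ _ mh hB)) Ih.
    rewrite (RintegralZl _ measurableT (nu_int _ _ mq q1)).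
    rewrite -[RHS]/(L ((fun x => q.1 * \1_(q.2) (sg x)) \+ (fun x => h s (sg x)))).
    rewrite LD; last 2 first.
    + by exists `|q.1| => x _; exact: qZ.
    + by exists B => x _; exact: hB.
    rewrite (LZ _ (fun x => \1_(q.2) (sg x))); last by exists 1 => x _; exact: q1.
    congr (_ * _ + _).
    by rewrite /Rintegral integral_indic// ?setIT; [rewrite nuP|exact: clopen_measurable].
have approx (e : R) : 0 < e -> exists s, clopens s /\ forall w, `|g w - h s w| <= e.
  move=> e0.
  have [|F [l [lP Tl]]] := @compact_seq_cover cantor_space setT
      (fun x C => clopen C /\ forall w, C w -> `|g w - g x| <= e) cantor_space_compact.
    move=> x _.
    have ob : open (ball (g x) e) by exact: ball_open.
    have [U oU UE] := within_open_preimage cf ob.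
    have Ux : U (p x).
      by have : (U `&` E) (p x) by [rewrite UE; split; [exact: ballxx|exact: pE]]; case.
    have [|C [cC Cx CU]] := @cantor_clopen_basis x (p @^-1` U).
      by apply: cp; exact: open_nbhs_nbhs.
    exists C; split => //; first by case: cC.
    split => // w /CU Uw; have : (U `&` E) (p w) by split => //; exact: pE.
    by rewrite UE => -[]; rewrite /= -ball_normE /= distrC => /ltW.
  have {lP} lP x : x \in l -> clopen (F x) /\ forall w, F x w -> `|g w - g x| <= e.
    by move=> /lP[_ []].
  (* The cover is made disjoint one member at a time: each clopen set enters without the union [Ul]
     of those already treated. The invariant that the sum vanishes off the union keeps the values
     from adding up. *)
  suff [s [cs sP]] : exists s, clopens s /\ forall w,
      ((exists2 x, x \in l & F x w) -> `|g w - h s w| <= e) /\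
      (~ (exists2 x, x \in l & F x w) -> h s w = 0).
    by exists s; split => // w; apply: (proj1 (sP w)); exact: Tl.
  elim: l lP {Tl} => [_|a l IH lP].
    exists [::]; split => // w; split; first by case.
    by move=> _; rewrite /h big_nil.
  have [|s [cs sP]] := IH.
    by move=> x xl; apply: lP; rewrite in_cons xl orbT.
  have [cFa oscFa] := lP a (mem_head _ _).
  pose Ul := [set y | exists2 x, x \in l & F x y].
  have cUl : clopen Ul.
    by apply: clopen_seq_cover => x xl; have [] := lP x; rewrite ?in_cons ?xl ?orbT.
  exists ((g a, F a `&` ~` Ul) :: s); split.
    move=> q; rewrite in_cons => /orP[/eqP -> /=|]; last exact: cs.
    by apply: clopenI => //; exact: (clopenC Ul).
  move=> w; have -> : h ((g a, F a `&` ~` Ul) :: s) w =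
      g a * \1_(F a `&` ~` Ul) w + h s w by rewrite /h big_cons.
  have [sP1 sP0] := sP w.
  have [Uw|nUw] := pselect (Ul w).
    rewrite indicE memNset ?mulr0 ?add0r; last by case.
    split; first by move=> _; exact: sP1.
    by move=> h0; exfalso; apply: h0; case: Uw => x xl Fx; exists x => //;
      rewrite in_cons xl orbT.
  rewrite (sP0 nUw) addr0; split.
    move=> [x]; rewrite in_cons => /orP[/eqP -> Faw|xl Fxw]; last by exfalso; apply: nUw; exists x.
    by rewrite indicE mem_set// mulr1; exact: oscFa.
  move=> h0; rewrite indicE memNset ?mulr0// => -[Faw _]; apply: h0.
  by exists a => //; exact: mem_head.
have gE : (\int[nu]_w g w = L f)%R.
  have bgs : bounded_on E (fun x => g (sg x)) by exists M => x _; exact: gM.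
  have bf : bounded_on E f by exists M.
  (* On [E] the surjection undoes its section, so the two functions agree there, and [L] sees only
     values on [E]. *)
  have -> : L f = L (fun x => g (sg x)).
    by apply: positive_ext => // x Ex; rewrite /g sgP.
  apply/eqP; rewrite -subr_eq0 -normr_le0; apply/ler_addgt0Pr => e e0; rewrite add0r.
  have e2 : 0 < e / 2 by rewrite divr_gt0.
  have [s [cs gs]] := approx _ e2.
  have [mh [B hB] Ih] := hP s cs.
  have ih := nu_int _ _ mh hB.
  rewrite (le_trans (ler_distD (\int[nu]_w h s w)%R _ _))// (splitr e) lerD//.
    rewrite -(RintegralB measurableT ig ih) (le_trans (le_normr_Rintegral measurableT _))//.
      by rewrite (_ : _ \o _ = (EFin \o g) \- (EFin \o h s))%E//; exact: integrableB.
    rewrite [leRHS](_ : _ = e / 2 * fine (nu setT)); last by rewrite nuT mulr1.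
    rewrite -Rintegral_cst//; apply: le_Rintegral => //.
      apply: (nu_int (fun w => `|g w - h s w|) (e / 2)) => [|w].
        by apply: measurableT_comp => //; exact: measurable_funB.
      by rewrite normr_id.
    by apply: (nu_int (cst (e / 2)) (e / 2)) => [|w]; rewrite ?ger0_norm// ltW.
  rewrite Ih; apply: positive_dist => //; first by exists B => x _; exact: hB.
  by move=> x _; rewrite distrC.
rewrite -[LHS]/(\int[mu]_(x in E) (f x)%:E)%E.
rewrite integral_mkcond -gE /Rintegral fineK; last exact: (integrable_fin_num measurableT ig).
transitivity (\int[mu]_x ((f \_ E) x)%:E)%E.
  by apply: eq_integral => x _; rewrite !patchE; case: ifP.
have pfE : (EFin \o (f \_ E : borelCn -> R)) \o (p : clopen_sigma -> borelCn) =
    EFin \o (g : clopen_sigma -> R).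
  by apply/funext => w; rewrite /= patchE mem_set.
rewrite (@integral_pushforward _ _ clopen_sigma borelCn R p mp nu setT
  (EFin \o (f \_ E : borelCn -> R)))//.
- by rewrite preimage_setT pfE.
- exact/measurable_EFinP.
- by rewrite preimage_setT pfE.
Qed.

End riesz.

(** * Borel probabilities on compact sets *)

Section borel_regularity.
Context {R : realType} {n : nat}.
Local Notation Cn := (Cn R n).
Local Notation borelCn := (borelCn R n).
Variable mu : probability borelCn R.
Local Open Scope ereal_scope.

Definition approximable (A : set borelCn) := forall e : R, (0 < e)%R ->
  exists F V : set Cn, [/\ closed F, open V, F `<=` A, A `<=` V & mu (V `\` F) < e%:E].

Let mD (F V : set Cn) : closed F -> open V -> measurable (V `\` F : set borelCn).
Proof. by move=> cF oV; apply: measurableD; [exact: open_borel|exact: closed_borel]. Qed.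

Lemma nondecreasing_union_approx (F : nat -> set borelCn) (e : R) : (0 < e)%R ->
  (forall i, measurable (F i)) -> (forall i j, (i <= j)%N -> F i `<=` F j) ->
  exists k, mu (\bigcup_i F i `\` F k) < e%:E.
Proof.
move=> e0 mF ndF; have mU : measurable (\bigcup_i F i) by exact: bigcup_measurable.
have cF : mu (F k) @[k --> \oo] --> mu (\bigcup_i F i).
  apply: nondecreasing_cvg_mu => // i j ij; apply/subsetPset; exact: ndF.
have Ufin : mu (\bigcup_i F i) \is a fin_num by exact: fin_num_measure.
have cF' : (fine (mu (F k)))%R @[k --> \oo] --> fine (mu (\bigcup_i F i)).
  by apply: fine_cvg; rewrite fineK.
have : (fine (mu (\bigcup_i F i)) - e < fine (mu (\bigcup_i F i)))%R by rewrite gtrBl.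
move=> /(cvgr_gt _ cF')[k _ /(_ k (leqnn k)) /= h]; exists k.
rewrite measureD//; last by rewrite -ge0_fin_numE.
rewrite setIidr; last by move=> x Fx; exists k.
have Fk : mu (F k) \is a fin_num by exact: fin_num_measure.
apply: (@le_lt_trans _ _ (fine (mu (\bigcup_i F i)) - fine (mu (F k)))%:E).
  by rewrite EFinB !fineK.
by rewrite lte_fin; move: h; rewrite ltrBlDr ltrBlDl addrC.
Qed.

Lemma open_approximable (V : set Cn) : open V -> approximable V.
Proof.
move=> oV e e0.
have [k kP] := @nondecreasing_union_approx (inner_closed V) e e0
  (fun i => closed_borel (@closed_inner_closed R n V i))
  (@inner_closed_nondecreasing R n V).
exists (inner_closed V k), V; split => //.
- exact: closed_inner_closed.
- exact: inner_closed_sub.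
- by move: kP; rewrite bigcup_inner_closed.
Qed.

(** The approximable sets form a sigma-algebra that contains the open sets; complements exchange the
    closed and the open approximant. *)
Lemma measurable_approximable (A : set borelCn) : measurable A -> approximable A.
Proof.
apply: smallest_sub; last by move=> V oV; exact: open_approximable.
split.
- move=> e e0; exists set0, set0; rewrite setD0 measure0 lte_fin.
  by split => //; exact: closed0.
- move=> B aB e e0; have [F [V [cF oV FB BV h]]] := aB e e0.
  exists (~` V), (~` F); split.
  + exact: open_closedC.
  + exact: closed_openC.
  + by rewrite setTD; exact: subsetC.
  + by rewrite setTD; exact: subsetC.
  + by rewrite setDE setCK setIC -setDE.
- move=> B aB e e0.
  (* One half of [e] is spread geometrically over the sequence; the other half pays for keeping
     finitely many of the [F i], as their full union need not be closed. *)
  have e2 : (0 < e / 2)%R by rewrite divr_gt0.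
  have /choice[F /choice[V FV]] i : exists F V : set Cn, [/\ closed F, open V, F `<=` B i,
      B i `<=` V & mu (V `\` F) < (e / 2 / 2 ^+ i.+1)%:E].
    by apply: aB; rewrite divr_gt0// exprn_gt0.
  pose G k := \bigcup_(i < k) F i.
  have cG k : closed (G k).
    by apply: closed_bigcup => [|i _]; [exact: finite_II|have [] := FV i].
  have mF i : measurable (F i : set borelCn) by apply: closed_borel; have [] := FV i.
  have mV i : measurable (V i : set borelCn) by apply: open_borel; have [] := FV i.
  have [k Gk] := @nondecreasing_union_approx (fun k => G k : set borelCn) _ e2
    (fun k => closed_borel (cG k)) (fun i j ij x => fun '(ex_intro2 l li Fl) =>
       ex_intro2 _ _ l (leq_trans li ij) Fl).
  have UG : \bigcup_i G i = \bigcup_i F i.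
    apply/seteqP; split => x [i _].
      by move=> [j _ Fj]; exists j.
    by move=> Fi; exists i.+1 => //; exists i => //=.
  exists (G k), (\bigcup_i V i); split => //.
  + by apply: bigcup_open => i _; have [] := FV i.
  + by move=> x [i _ Fi]; exists i => //; have [_ _ + _ _] := FV i; exact.
  + by move=> x [i _ Bi]; exists i => //; have [_ _ _ + _] := FV i; exact.
  + have mU : measurable (\bigcup_i F i : set borelCn) by exact: bigcup_measurable.
    have mVU : measurable (\bigcup_i V i : set borelCn) by exact: bigcup_measurable.
    apply: (@le_lt_trans _ _ (mu (\bigcup_i (V i `\` F i)) + mu (\bigcup_i G i `\` G k))).
      have m1 : measurable (\bigcup_i (V i `\` F i) : set borelCn).
        by apply: bigcup_measurable => i _; exact: measurableD.
      have m2 : measurable (\bigcup_i G i `\` G k : set borelCn).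
        by rewrite UG; apply: measurableD => //; exact: closed_borel.
      apply: (@le_trans _ _ (mu ((\bigcup_i (V i `\` F i)) `|` (\bigcup_i G i `\` G k)))).
        apply: le_measure; rewrite ?inE.
        - by apply: measurableD => //; exact: closed_borel.
        - exact: measurableU.
        - move=> x [[i _ Vi] nG]; have [Ux|nUx] := pselect ((\bigcup_i G i) x).
            by right.
          by left; exists i => //; split => // Fi; apply: nUx; rewrite UG; exists i.
      exact: measureU2.
    rewrite (splitr e) EFinD; apply: lee_ltD => //.
      apply: fin_num_measure; apply: bigcup_measurable => i _; exact: measurableD.
    apply: (@le_trans _ _ (\sum_(i <oo) mu (V i `\` F i))).
      apply: measure_sigma_subadditive => // [i|]; first exact: measurableD.
      by apply: bigcup_measurable => i _; exact: measurableD.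
    apply: (le_trans _ (epsilon_trick0 xpredT (ltW e2))).
    apply: lee_nneseries => // i _; rewrite natrX; apply: ltW.
    by have [] := FV i.
Qed.

Variables (X : set Cn) (cX : compact X) (muX : mu X = 1).

Let mX : measurable (X : set borelCn). Proof. exact: compact_borel. Qed.

Lemma mass_outside (A : set borelCn) : measurable A -> mu (A `\` X) = 0.
Proof.
move=> mA; have muXC : mu (~` X) = 0.
  by have := probability_setC mu mX; rewrite muX subee.
apply: (@subset_measure0 _ _ _ mu _ (~` X)) => //.
- exact: measurableD.
- exact: measurableC.
Qed.

(** Approximation by closed and open sets holds already; intersecting the closed set with [X], which
    carries all the mass, makes it compact. *)
Lemma compact_probability_regular : regular_borel mu.
Proof.
move=> A mA; split.
- apply/eqP; rewrite eq_le; apply/andP; split.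
    apply: le_ereal_inf_tmp => _ [V [oV AV] <-].
    by apply: le_measure; rewrite ?inE//; exact: open_borel.
  apply/lee_addgt0Pr => e e0.
  have [F [V [cF oV FA AV h]]] := measurable_approximable mA e0.
  apply: (@le_trans _ _ (mu V)); first by apply: ereal_inf_lbound; exists V.
  have mF := closed_borel cF; have mV := open_borel oV.
  rewrite (measureDI mu mV mF) addeC leeD//; last exact: ltW.
  apply: le_measure; rewrite ?inE//; first exact: measurableI.
  by move=> x [_ Fx]; exact: FA.
- apply/eqP; rewrite eq_le; apply/andP; split; last first.
    apply: ge_ereal_sup => _ [K [cK KA] <-].
    by apply: le_measure; rewrite ?inE//; exact: compact_borel.
  apply/lee_addgt0Pr => e e0.
  have [F [V [cF oV FA AV h]]] := measurable_approximable mA e0.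
  have mF := closed_borel cF; have mV := open_borel oV.
  apply: (@le_trans _ _ (mu (F `&` X) + e%:E)); last first.
    rewrite leeD2r//; apply: ereal_sup_ubound; exists (F `&` X) => //; split.
      rewrite setIC; exact: compact_closedI.
    by move=> x [Fx _]; exact: FA.
  rewrite (measureDI mu mA mF) addeC leeD//.
    apply: (@le_trans _ _ (mu F)).
      apply: le_measure; rewrite ?inE//; first exact: measurableI.
    apply: (@le_trans _ _ (mu (F `\` X) + mu (F `&` X))).
      by rewrite (measureDI mu mF mX).
    by rewrite mass_outside// add0e.
  apply: le_trans (ltW h); apply: le_measure; rewrite ?inE//.
  - exact: measurableD.
  - exact: measurableD.
  - by move=> x [Ax nFx]; split => //; exact: AV.
Qed.

(** By inner regularity it is enough to look at compact sets off [B]. Each of their points has an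
    open null neighborhood, and finitely many of these cover. *)
Lemma mass_off_support (B : set Cn) : closed B -> measure_supp mu `<=` B ->
  mu B = 1.
Proof.
move=> cB sB; have oB : open (~` B) by exact: closed_openC.
have mB := closed_borel cB.
suff nB : mu (~` B) = 0.
  by have := probability_setC mu (measurableC mB); rewrite setCK nB sube0.
have [_ ->] := compact_probability_regular (open_borel oB).
apply/eqP; rewrite eq_le; apply/andP; split; last first.
  by apply: ereal_sup_ubound; exists set0; [split => //; exact: compact0|rewrite measure0].
apply: ge_ereal_sup => _ [K [cK KB] <-].
have [x Kx|f [s [sP Ks]]] := @compact_seq_cover Cn K
    (fun _ C => open C /\ mu (C : set borelCn) = 0) cK.
  have : ~ measure_supp mu x by move=> /sB; exact: KB.
  move=> /existsNP[V /not_implyP[oV /not_implyP[Vx V0]]]; exists V; split => //.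
  split => //; apply/eqP; rewrite eq_le measure_ge0 andbT leNgt; exact/negP.
have {}sP x : x \in s -> open (f x) /\ mu (f x : set borelCn) = 0.
  by move=> /sP[_ [_ []]].
have [mU U0] : measurable ([set y | exists2 x, x \in s & f x y] : set borelCn) /\
    mu ([set y | exists2 x, x \in s & f x y] : set borelCn) = 0.
  elim: s sP {Ks} => [_|a s IH sP].
    rewrite (_ : [set _ | _] = set0) ?measure0//.
    by apply/seteqP; split => // y [].
  have [|mU U0] := IH; first by move=> x xs; apply: sP; rewrite in_cons xs orbT.
  have [oa a0] := sP a (mem_head _ _).
  rewrite (_ : [set _ | _] = f a `|` [set y | exists2 x, x \in s & f x y]).
    have ma := open_borel oa.
    by split; [exact: measurableU|rewrite measureU0].
  apply/seteqP; split => y /=.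
    move=> [x]; rewrite in_cons => /orP[/eqP ->|xs] fxy; first by left.
    by right; exists x.
  move=> [fay|[x xs fxy]]; first by exists a; rewrite ?mem_head.
  by exists x; rewrite // in_cons xs orbT.
by rewrite -U0; apply: le_measure; rewrite ?inE//; exact: compact_borel.
Qed.

End borel_regularity.

(** * Probabilities on a compact set are determined by integrals of continuous functions *)

Section integrals_on_compacts.
Context {R : realType} {n : nat}.
Local Notation Cn := (Cn R n).
Local Notation borelCn := (borelCn R n).
Implicit Types (mu nu : probability borelCn R) (X B : set Cn) (f : Cn -> R).

Lemma within_continuous_integrable mu X f : compact X -> {within X, continuous f} ->
  mu.-integrable (X : set borelCn) (EFin \o f).
Proof.
move=> cX cf; have mX := compact_borel cX.
have [M fM] := compact_bounded_on cX cf.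
apply: measurable_bounded_integrable => //.
- by rewrite (le_lt_trans (probability_le1 mu mX))// ltry.
- exact: within_continuous_measurable.
- exists M; split; first exact: num_real.
  by move=> x Mx w Xw; exact: le_trans (fM w Xw) (ltW Mx).
Qed.

Lemma integral_full_mass mu X B (f : Cn -> \bar R) : measurable (X : set borelCn) ->
  compact B -> B `<=` X -> mu B = 1%E -> mu.-integrable (X : set borelCn) f ->
  (\int[mu]_(x in X) f x = \int[mu]_(x in B) f x)%E.
Proof.
move=> mX cB BX muB If; have mB := compact_borel cB.
rewrite (negligible_integral (N := (X `\` B : set borelCn)))//.
- by rewrite setDD setIidr.
- exact: measurableD.
- exact: mass_outside.
Qed.

Lemma within_continuousS X B f : B `<=` X -> {within X, continuous f} ->
  {within B, continuous f}.
Proof. by move=> BX; apply: continuous_subspaceW. Qed.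

Lemma compact_bump (K V : set Cn) : compact K -> open V -> K `<=` V ->
  exists f : Cn -> R, [/\ continuous f, forall x, 0 <= f x <= 1,
    forall x, K x -> f x = 1 & forall x, ~ V x -> f x = 0].
Proof.
move=> cK oV KV.
(* Only the radius of the tube is wanted, hence the empty family of functions. *)
have [|r [M [r0 tube]]] := @compact_tube R n void (fun _ _ => 0) K V cK oV KV.
  by case.
have [|f [cf fr f0 f1]] := proj1 (@uniform_separatorP Cn R (~` V) K).
  apply: uniform_separatorW; exists [set xy | ball xy.1 r xy.2].
    exact: (entourage_ball Cn (PosNum r0)).
  rewrite -subset0 => -[x y] [/= [Vx Ky] xy]; apply: Vx.
  by have [] := tube y x Ky; first by move: xy; rewrite /= -ball_normE /=.
exists f; split => //.
- by move=> x; have := fr (f x) (ex_intro2 _ _ x I erefl); rewrite /= in_itv.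
- by move=> x Kx; apply: f1; exists x.
- by move=> x Vx; apply: f0; exists x.
Qed.

(** For a compact [K] inside [V], a bump function between the two indicators compares the masses
    through the common integral; inner regularity then takes the supremum over [K]. *)
Lemma le_open_of_integrals mu nu B : compact B -> mu B = 1%E ->
  regular_borel mu ->
  (forall f, continuous f ->
    \int[mu]_(x in B) (f x)%:E = \int[nu]_(x in B) (f x)%:E)%E ->
  forall V : set Cn, open V -> (mu V <= nu V)%E.
Proof.
move=> cB muB rmu mn V oV; have mV := open_borel oV; have mB := compact_borel cB.
have [_ ->] := rmu V mV; apply: ge_ereal_sup => _ [K [cK KV] <-].
have mK := compact_borel cK.
have [f [cf f01 f1 f0]] := compact_bump cK oV KV.
have mf : measurable_fun (B : set borelCn) (f : borelCn -> R).
  by apply: measurable_funTS; exact: continuous_measurable_real.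
apply: (@le_trans _ _ (\int[mu]_(x in B) (f x)%:E)%E).
  apply: (@le_trans _ _ (mu (K `&` B))).
    apply: (@le_trans _ _ (mu (K `\` B) + mu (K `&` B))%E).
      by rewrite (measureDI mu mK mB).
    by rewrite (mass_outside cB muB mK) add0e.
  rewrite -[leLHS](@integral_indic _ borelCn R mu B mB K)//.
  apply: ge0_le_integral => //.
  - by apply/measurable_EFinP; exact: measurable_indic.
  - exact/measurable_EFinP.
  - move=> x _; rewrite lee_fin indicE; case: (boolP (x \in K)) => [/set_mem/f1 ->//|_].
    by have /andP[] := f01 x.
rewrite mn//; apply: (@le_trans _ _ (\int[nu]_(x in B) (\1_V x)%:E)%E).
  apply: ge0_le_integral => //.
  - by move=> x _; rewrite lee_fin; have /andP[] := f01 x.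
  - exact/measurable_EFinP.
  - by apply/measurable_EFinP; exact: measurable_indic.
  - move=> x _; rewrite lee_fin indicE; case: (boolP (x \in V)) => [_|/negP Vx].
      by have /andP[] := f01 x.
    by rewrite f0// => Vx'; apply: Vx; exact: mem_set.
rewrite integral_indic//; apply: le_measure; rewrite ?inE//.
exact: measurableI.
Qed.

Lemma eq_on_borel_integrals mu nu B : compact B -> mu B = 1%E -> nu B = 1%E ->
  (forall f, continuous f ->
    \int[mu]_(x in B) (f x)%:E = \int[nu]_(x in B) (f x)%:E)%E ->
  eq_on_borel mu nu.
Proof.
move=> cB muB nuB mn A mA.
have rmu := compact_probability_regular cB muB.
have rnu := compact_probability_regular cB nuB.
have E V : open (V : set Cn) -> mu V = nu V.
  move=> oV; apply/eqP; rewrite eq_le (le_open_of_integrals cB muB rmu mn oV)/=.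
  by apply: (le_open_of_integrals cB nuB rnu _ oV) => f cf; rewrite mn.
have [-> _] := rmu A mA; have [-> _] := rnu A mA; congr ereal_inf.
by apply/seteqP; split => _ [V [oV AV] <-]; exists V => //; rewrite E.
Qed.

End integrals_on_compacts.

(** * Jensen measures and the Choquet boundary *)

Lemma linear_SHo {R : realType} (n m : nat) (X : set (Cn R n)) (w dw : Cn R n -> R) :
  (0 < n)%N -> continuous w ->
  (forall z u (t : R), w (z + t *: u) = w z + t * dw u) -> SHo m X w.
Proof.
case: n X w dw => // k X w dw _ cw wE; exists setT, w; split => //.
- exact: openT.
- exact: linear_msh cw wE.
- by move=> z _; exact: cw.
Qed.

Section jensen_cone.
Context {R : realType} {n : nat} (m : nat).
Local Notation Cn := (Cn R n).
Local Notation borelCn := (borelCn R n).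
Variable X : set Cn.
Hypotheses (cX : compact X) (n0 : (0 < n)%N).
Implicit Types (mu : probability borelCn R) (v f g : Cn -> R) (z : Cn).

Let mX : measurable (X : set borelCn). Proof. exact: compact_borel. Qed.
Let clX : closed X. Proof. by apply: compact_closed => //; exact: Cn_hausdorff. Qed.

Definition continuous_SH : set (Cn -> R) :=
  [set v : Cn -> R | SH m X (EFin \o v) /\ {within X, continuous v}].

Lemma within_usc_on v : {within X, continuous v} -> usc_on X (EFin \o v).
Proof.
move=> cv z Xz; split; first exact: ltry.
move=> a; rewrite lte_fin => va.
have oa : open `]-oo, a[%classic by exact: interval_open.
have [U oU UE] := within_open_preimage cv oa.
have Uz : U z by have : (U `&` X) z by [rewrite UE; split => //; rewrite /= in_itv]; case.
rewrite near_withinE; have : nbhs z U by exact: open_nbhs_nbhs.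
apply: filterS => y Uy Xy; rewrite lte_fin.
by have : (U `&` X) y by []; rewrite UE => -[]; rewrite /= in_itv.
Qed.

Lemma integral_Rintegral mu f : {within X, continuous f} ->
  (\int[mu]_(x in X) (f x)%:E = (\int[mu]_(x in X) f x)%R%:E)%E.
Proof.
move=> cf; rewrite /Rintegral fineK//.
exact: (integrable_fin_num mX (within_continuous_integrable mu cX cf)).
Qed.

Lemma continuous_SHP v : continuous_SH v <-> {within X, continuous v} /\
  forall z mu, X z -> jensen_measures m X z mu -> (v z <= \int[mu]_(x in X) v x)%R.
Proof.
split=> [[[_ h] cv]|[cv h]]; split => //.
- by move=> z mu Xz Jmu; rewrite -lee_fin -integral_Rintegral//; exact: h.
- split; first exact: within_usc_on.
  by move=> z Xz mu Jmu; rewrite [leRHS]integral_Rintegral// lee_fin h.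
Qed.

Lemma continuous_SHD v w : continuous_SH v -> continuous_SH w ->
  continuous_SH (v \+ w).
Proof.
move=> /continuous_SHP[cv hv] /continuous_SHP[cw hw]; apply/continuous_SHP; split.
  by move=> x; apply: cvgD; [exact: cv|exact: cw].
move=> z mu Xz Jmu; rewrite RintegralD// ?lerD ?hv ?hw//.
  exact: within_continuous_integrable.
exact: within_continuous_integrable.
Qed.

Lemma continuous_SHZ (t : R) v : 0 <= t -> continuous_SH v ->
  continuous_SH (fun x => t * v x).
Proof.
move=> t0 /continuous_SHP[cv hv]; apply/continuous_SHP; split.
  by move=> x; apply: cvgMr; exact: cv.
move=> z mu Xz Jmu; rewrite RintegralZl// ?ler_wpM2l ?hv//.
exact: within_continuous_integrable.
Qed.

Lemma continuous_SH_cst (t : R) : continuous_SH (cst t).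
Proof.
apply/continuous_SHP; split; first by move=> x; exact: cst_continuous.
move=> z mu Xz [muX _ _]; rewrite Rintegral_cst//.
by rewrite [X in _ <= _ * fine X](_ : _ = 1%E) ?mulr1//; exact: muX.
Qed.

Lemma SHo_within u : SHo m X u -> {within X, continuous u}.
Proof.
move=> [U [w [oU XU _ cw uw]]].
apply/subspace_continuousP => x Xx.
have wx : w y @[y --> within X (nbhs x)] --> w x.
  by apply: cvg_within_filter; apply: cw; exact: XU.
have : u y @[y --> within X (nbhs x)] --> w x.
  apply: cvg_trans wx; apply: near_eq_cvg; rewrite near_withinE.
  by apply: nearW => y Xy; rewrite uw.
by rewrite -(uw x Xx).
Qed.

Lemma SHo_continuous_SH u : SHo m X u -> continuous_SH u.
Proof.
move=> Su; have cu := SHo_within Su; apply/continuous_SHP; split => //.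
move=> z mu Xz [_ _ h]; rewrite -lee_fin -integral_Rintegral//.
exact: h.
Qed.

Definition coordinate (i : 'I_n + 'I_n) z : R :=
  match i with inl j => z.1 0 j | inr j => z.2 0 j end.

Lemma coordinate_SHo i : SHo m X (coordinate i).
Proof.
apply: (@linear_SHo R n m X (coordinate i) (coordinate i) n0).
  by case: i => j; [exact: continuous_coord1|exact: continuous_coord2].
by case: i => j z u t; rewrite /= !mxE.
Qed.

(** The counterpart of a closed face in the proof of Bauer's maximum principle. *)
Definition absorbing (A : set Cn) := [/\ compact A, A !=set0, A `<=` X &
  forall z mu, A z -> jensen_measures m X z mu -> mu A = 1%E].

Lemma absorbing_argmax (A : set Cn) v : absorbing A -> continuous_SH v ->
  exists A', [/\ absorbing A', A' `<=` A &
    forall x y, A' x -> A y -> v y <= v x].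
Proof.
move=> [cA A0 AX Aabs] Sv; have /continuous_SHP[cv hv] := Sv.
have cvA := within_continuousS AX cv.
have [c /set_mem Ac cmax] := compact_EVT_max A0 cA cvA.
have [U oU UE] : exists2 U : set Cn, open U & U `&` A = (v @^-1` [set x | x < v c]) `&` A.
  by apply: within_open_preimage => //; exact: open_lt.
pose A' := A `&` ~` U.
have A'E x : A' x <-> A x /\ v c <= v x.
  split=> [[Ax nUx]|[Ax cx]]; split => //.
    rewrite leNgt; apply/negP => vx; apply: nUx.
    by have : (v @^-1` [set x | x < v c] `&` A) x by []; rewrite -UE => -[].
  by move=> Ux; have : (U `&` A) x by []; rewrite UE => -[]; rewrite /= ltNge cx.
exists A'; split; last 2 first.
- by move=> x [].
- by move=> x y /A'E[Ax cx] Ay; apply: le_trans cx; apply: cmax; exact: mem_set.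
have cA' : compact A' by apply: compact_closedI => //; exact: open_closedC.
split => //.
- by exists c; apply/A'E.
- by move=> x [/AX].
move=> z mu /A'E[Az cz] Jmu; have muA := Aabs z mu Az Jmu.
have mA := compact_borel cA; have mA' := compact_borel cA'.
have Iv := within_continuous_integrable mu cA cvA.
have fc : mu.-integrable (A : set borelCn) (EFin \o cst (v c)).
  by apply: within_continuous_integrable => // x; exact: cst_continuous.
have vz : v c <= \int[mu]_(x in A) v x.
  apply: (le_trans cz); apply: (le_trans (hv z mu (AX z Az) Jmu)).
  rewrite /Rintegral (integral_full_mass mX cA AX muA)//.
  exact: within_continuous_integrable.
have J0 : (\int[mu]_(x in A) (v c - v x) = 0)%R.
  apply/eqP; rewrite eq_le Rintegral_ge0 ?andbT; last first.
    by move=> x Ax; rewrite subr_ge0; apply: cmax; exact: mem_set.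
  rewrite RintegralB// Rintegral_cst//.
  rewrite [X in _ * fine X - _](_ : _ = 1%E) ?mulr1 ?subr_le0//; exact: muA.
have I0 : (\int[mu]_(x in A) `|(v c - v x)%:E| = 0)%E.
  rewrite -[RHS](congr1 EFin J0) /Rintegral fineK; last first.
    apply: (integrable_fin_num mA).
    by rewrite (_ : (fun x => _) = (EFin \o cst (v c)) \- (EFin \o v))%E//; exact: integrableB.
  apply: eq_integral => x /set_mem Ax; rewrite gee0_abs// lee_fin subr_ge0.
  by apply: cmax; exact: mem_set.
have mcv : measurable_fun (A : set borelCn) (fun x : borelCn => (v c - v x)%:E).
  apply/measurable_EFinP/measurable_funB; first exact: measurable_cst.
  exact: within_continuous_measurable.
have [N [mN N0 AN]] := proj1 (ae_eq_integral_abs mu mA mcv) I0.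
have AA' : mu (A `\` A') = 0%E.
  apply: (@subset_measure0 _ _ _ mu _ N) => //; first exact: measurableD.
  move=> x [Ax nA'x]; apply: AN => /= h; apply: nA'x; apply/A'E; split => //.
  by have := h Ax; rewrite /cst => -[] /eqP; rewrite subr_eq0 => /eqP ->.
have : (mu A = mu (A `\` A') + mu (A `&` A'))%E by exact: (measureDI mu mA mA').
rewrite AA' add0e muA setIidr; last by move=> x [].
by move=> <-.
Qed.

Lemma absorbing_seq (s : seq ('I_n + 'I_n)) (A : set Cn) : absorbing A ->
  exists A', [/\ absorbing A', A' `<=` A &
    forall i x y, i \in s -> A' x -> A' y -> coordinate i x = coordinate i y].
Proof.
move=> absA; elim: s => [|i s [A1 [abs1 A1A cst1]]]; first by exists A; split.
have [A2 [abs2 A21 max2]] := absorbing_argmax abs1 (SHo_continuous_SH (coordinate_SHo i)).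
exists A2; split => // [x /A21/A1A //|j x y].
rewrite in_cons => /orP[/eqP ->|js] A2x A2y; last by apply: cst1 => //; exact: A21.
by apply/eqP; rewrite eq_le !max2//; exact: A21.
Qed.

(** Serves the converse half of the equivalence in [choquet_boundary]. Measures are compared on
    Borel sets only, so it concerns every probability that agrees there with the Dirac mass. *)
Lemma dirac_jensen z mu : X z -> eq_on_borel mu \d_(z : borelCn) ->
  jensen_measures m X z mu.
Proof.
move=> Xz muE; have muX : mu X = 1%E by rewrite muE// diracE mem_set.
split => //; first exact: (compact_probability_regular cX).
move=> u Su; have cu := SHo_within Su.
rewrite (eq_measure_integral (\d_(z : borelCn))); last by move=> B mB _; exact: muE.
rewrite integral_dirac//.
  by rewrite diracE mem_set// mul1e.
by apply/measurable_EFinP; exact: within_continuous_measurable.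
Qed.

Lemma absorbing_point z : absorbing [set z] -> choquet_boundary m X z.
Proof.
move=> [c1 _ zX abs]; have Xz : X z by exact: zX.
split => // mu; split; last exact: dirac_jensen.
move=> Jmu B mB; have mu1 := abs z mu erefl Jmu.
have mz : measurable ([set z] : set borelCn) by exact: compact_borel.
have [Bz|nBz] := pselect (B z).
  rewrite diracE mem_set//; apply/eqP; rewrite eq_le probability_le1//=.
  rewrite -mu1; apply: le_measure; rewrite ?inE//.
  by move=> _ ->.
rewrite diracE memNset//; apply: (@subset_measure0 _ _ _ mu _ (B `\` [set z])) => //.
- exact: measurableD.
- by move=> x Bx; split => // xz; apply: nBz; rewrite -xz.
- exact: (mass_outside c1 mu1).
Qed.

Lemma choquet_maximum v (c : R) : continuous_SH v ->
  (forall x, choquet_boundary m X x -> v x <= c) -> forall x, X x -> v x <= c.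
Proof.
move=> Sv vc x Xx.
have absX : absorbing X by split => //; [exists x|move=> z mu _ [] ].
have [A [absA AX Amax]] := absorbing_argmax absX Sv.
have [A' [absA' A'A cst]] := absorbing_seq (enum {: 'I_n + 'I_n}) absA.
have [_ [z A'z] _ _] := absA'.
have A'1 : A' = [set z].
  apply/seteqP; split => [y A'y|_ ->//].
  have E i : coordinate i y = coordinate i z by apply: cst; rewrite ?mem_enum.
  case: y z E {A'z A'y} => [y1 y2] [z1 z2] E; congr pair; apply/rowP => j.
    exact: (E (inl j)).
  exact: (E (inr j)).
rewrite A'1 in absA'; apply: (le_trans (Amax z x (A'A z A'z) Xx)).
by apply: vc; exact: absorbing_point.
Qed.

End jensen_cone.

(** * Duality for the envelope *)

Section envelope_duality.
Context {R : realType} {n : nat} (m : nat).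
Local Notation Cn := (Cn R n).
Local Notation borelCn := (borelCn R n).
Variable X : set Cn.
Hypotheses (cX : compact X) (n0 : (0 < n)%N).
Implicit Types (mu : probability borelCn R) (v f g : Cn -> R) (z : Cn).
Local Notation B := (silov_boundary m X).

Let mX : measurable (X : set borelCn). Proof. exact: compact_borel. Qed.

Lemma silov_sub : B `<=` X.
Proof.
have clX : closed X by apply: compact_closed => //; exact: Cn_hausdorff.
rewrite {2}((closure_id X).1 clX); apply: closure_subset => x [].
by [].
Qed.

Lemma silov_compact : compact B.
Proof. by apply: (subclosed_compact _ cX silov_sub); exact: closed_closure. Qed.

Lemma silov_maximum v (c : R) : continuous_SH m X v ->
  (forall x, B x -> v x <= c) -> forall x, X x -> v x <= c.
Proof.
move=> Sv vc; apply: (@choquet_maximum R n m X cX n0 v c Sv) => x Ox; apply: vc.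
exact: subset_closure.
Qed.

(** On an empty boundary the maximum principle would bound the constant [0] by [-1]. *)
Lemma silov_nonempty z : X z -> B !=set0.
Proof.
move=> Xz; apply: contrapT => B0.
have := @silov_maximum (cst 0) (-1) (continuous_SH_cst m cX 0) _ z Xz.
rewrite /= lerNr oppr0 ler10 => /(_ _)/notF; apply => x Bx; exfalso.
by apply: B0; exists x.
Qed.

Lemma jensen_boundary_mass z mu : jensen_boundary m X z mu -> mu B = 1%E.
Proof.
move=> [[muX _ _] supp]; apply: (mass_off_support cX muX) => //.
exact: closed_closure.
Qed.

Lemma jensen_boundary_integral z mu f : jensen_boundary m X z mu ->
  {within X, continuous f} ->
  (\int[mu]_(x in X) (f x)%:E = \int[mu]_(x in B) (f x)%:E)%E.
Proof.
move=> Jmu cf; apply: integral_full_mass => //.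
- exact: silov_compact.
- exact: silov_sub.
- exact: jensen_boundary_mass Jmu.
- exact: within_continuous_integrable.
Qed.

Lemma PB_le_integral z mu f : X z -> {within B, continuous f} ->
  jensen_boundary m X z mu -> (PB m X f z <= \int[mu]_(x in B) (f x)%:E)%E.
Proof.
move=> Xz cf Jmu; apply: ge_ereal_sup => _ [v [Sv cv vf] <-].
have [_ h] := Sv; have [Jmu' _] := Jmu.
apply: (le_trans (h z Xz mu Jmu')); rewrite (jensen_boundary_integral Jmu cv).
have cB := silov_compact; have mB := compact_borel cB.
apply: le_integral => //.
- apply: within_continuous_integrable => //; exact: within_continuousS silov_sub cv.
- exact: within_continuous_integrable.
- by move=> x /set_mem Bx; rewrite lee_fin vf.
Qed.

Section representation.
Variables (z : Cn) (Xz : X z).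

Let upper g := [set v | continuous_SH m X v /\ forall x, B x -> g x <= - v x].

(** The envelope from above by negatives of continuous members of [SH m X]: it is
    [- PB m X (\- g) z], extended to every [g] bounded on the boundary. It is sublinear because
    these members form a convex cone, and finite by the maximum principle. *)
Let p g : R := inf [set - v z | v in upper g].

Let bounded_cst (M : R) g : (forall x, B x -> `|g x| <= M) -> upper g (cst (- M)).
Proof.
move=> gM; split; first exact: continuous_SH_cst.
by move=> x Bx; rewrite /= opprK (le_trans (ler_norm _))// gM.
Qed.

Let upper_lb (M : R) g v : (forall x, B x -> `|g x| <= M) -> upper g v -> - M <= - v z.
Proof.
move=> gM [Sv gv]; rewrite lerN2; apply: (silov_maximum Sv) => // x Bx.
have := gv x Bx; have := gM x Bx; rewrite ler_norml => /andP[] ? _ ?; lra.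
Qed.

Let p_le g v : bounded_on B g -> upper g v -> p g <= - v z.
Proof.
move=> [M gM] gv; apply: ge_inf; last by exists v.
by exists (- M) => _ [w gw <-]; exact: upper_lb gw.
Qed.

Let p_ge g (a : R) : bounded_on B g -> (forall v, upper g v -> a <= - v z) -> a <= p g.
Proof.
move=> [M gM] h; apply: lb_le_inf.
  by exists (- (cst (- M) z)); exists (cst (- M)) => //; exact: bounded_cst.
by move=> _ [v gv <-]; exact: h.
Qed.

Let bD f g : bounded_on B f -> bounded_on B g -> bounded_on B (f \+ g).
Proof. exact: bounded_onD. Qed.

Let pD f g : bounded_on B f -> bounded_on B g -> p (f \+ g) <= p f + p g.
Proof.
move=> bf bg; rewrite -lerBlDr; apply: p_ge => // v [Sv fv].
rewrite lerBlDr -lerBlDl; apply: p_ge => // w [Sw gw]; rewrite lerBlDl.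
have up : upper (f \+ g) (v \+ w).
  split; first exact: continuous_SHD.
  by move=> x Bx; rewrite /= opprD lerD ?fv ?gw.
by apply: (le_trans (p_le (bD bf bg) up)); rewrite /= opprD.
Qed.

Let pZ (t : R) f : bounded_on B f -> 0 <= t -> p (fun x => t * f x) <= t * p f.
Proof.
move=> bf; have bt := bounded_onZ t bf; rewrite le_eqVlt => /orP[/eqP t0|t0].
  rewrite -t0 mul0r -{2}oppr0 -[X in _ <= - X]/(cst 0 z); apply: p_le.
    by rewrite t0.
  split; first exact: continuous_SH_cst.
  by move=> x _; rewrite mul0r /= oppr0.
rewrite -ler_pdivrMl//; apply: p_ge => // v [Sv fv]; rewrite ler_pdivrMl//.
have up : upper (fun x => t * f x) (fun x => t * v x).
  split; first by apply: continuous_SHZ => //; exact: ltW.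
  by move=> x Bx; rewrite -mulrN ler_pM2l// fv.
by apply: (le_trans (p_le bt up)); rewrite mulrN.
Qed.

(** Hahn-Banach is used with contact at [- f], where [p] equals [- PB m X f z]. Every property of
    [L] comes from testing its domination by [p] with one competitor: [0] for positivity, the
    constants [-1] and [1] for the normalization, and [u] itself for the Jensen inequality. *)
Lemma PB_representation f : {within B, continuous f} ->
  exists2 mu, jensen_boundary m X z mu & PB m X f z = (\int[mu]_(x in B) (f x)%:E)%E.
Proof.
move=> cf; have cB := silov_compact; have mB := compact_borel cB.
have bf := compact_bounded_on cB cf.
have bNf := bounded_onZ (-1) bf.
have [L [LD LZ Lp Lf]] := hahn_banach_bounded pD pZ bNf.
have LN g : bounded_on B g -> L (fun x => -1 * g x) = - L g.
  by move=> bg; rewrite LZ// mulN1r.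
have LP : normalized_positive B L.
  split => //.
  - move=> g bg g0; rewrite -oppr_le0 -LN//; apply: le_trans (Lp _ (bounded_onZ _ bg)) _.
    rewrite -[leRHS]oppr0; apply: (@p_le _ (cst 0)); first exact: bounded_onZ.
    split; first exact: continuous_SH_cst.
    by move=> x Bx; rewrite /= oppr0 mulN1r oppr_le0 g0.
  - have b1 : bounded_on B (cst 1 : Cn -> R) by exact: bounded_on_cst.
    apply/eqP; rewrite eq_le; apply/andP; split.
      apply: le_trans (Lp _ b1) _; rewrite -[leRHS]opprK.
      apply: (@p_le _ (cst (-1))) => //; split; first exact: continuous_SH_cst.
      by move=> x _; rewrite /= opprK.
    rewrite -lerN2 -LN//; apply: le_trans (Lp _ (bounded_onZ _ b1)) _.
    apply: (@p_le _ (cst 1)); first exact: bounded_onZ.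
    split; first exact: continuous_SH_cst.
    by move=> x _; rewrite /= mulN1r.
have [mu [muB muL]] := riesz_compact LP cB (silov_nonempty Xz).
have BX := silov_sub.
have muX : mu X = 1%E.
  apply/eqP; rewrite eq_le probability_le1//= -muB.
  by apply: le_measure; rewrite ?inE.
have clB : closed B by exact: closed_closure.
have Jmu : jensen_measures m X z mu.
  split => //; first exact: (compact_probability_regular cX).
  move=> u Su; have cu := SHo_within Su.
  rewrite (integral_full_mass mX cB BX muB); last exact: within_continuous_integrable.
  have cuB := within_continuousS BX cu.
  rewrite muL// lee_fin; have bu := compact_bounded_on cB cuB.
  rewrite -lerN2 -LN//; apply: le_trans (Lp _ (bounded_onZ _ bu)) _.
  apply: p_le; first exact: bounded_onZ.
  split; first exact: SHo_continuous_SH.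
  by move=> x Bx; rewrite mulN1r.
exists mu.
  split => // x; apply: contraPP => nBx /(_ (~` B) (closed_openC clB) nBx).
  suff -> : mu (~` B) = 0%E by rewrite ltxx.
  have : (mu (~` B) = 1 - mu B)%E by exact: (probability_setC mu mB).
  by rewrite muB subee.
rewrite muL//; have -> : L f = - p (fun x => -1 * f x) by rewrite -Lf LN ?opprK.
apply/eqP; rewrite eq_le; apply/andP; split.
  apply: ge_ereal_sup => _ [v [Sv cv vf] <-]; rewrite lee_fin lerNr.
  apply: p_le => //; split => // x Bx.
  by rewrite mulN1r lerN2 vf.
(* A competitor that is optimal up to [e] in the infimum [p] is admissible, unchanged, in the
   supremum that defines [PB]. *)
apply/lee_addgt0Pr => e e0; rewrite -leeBlDr// -EFinB -opprD.
have : p (fun x => -1 * f x) < p (fun x => -1 * f x) + e by rewrite ltrDl.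
have hi : [set - v z | v in upper (fun x => -1 * f x)] !=set0.
  have [M fM] := bNf.
  by exists (- (cst (- M) z)); exists (cst (- M)) => //; exact: bounded_cst.
move=> /(inf_lt hi)[_ [v [[Sv cv] fv] <-] h].
apply: (@le_trans _ _ (v z)%:E); first by rewrite lee_fin lerNl ltW.
apply: ereal_sup_ubound; exists v => //; split => // x Bx.
by have := fv x Bx; rewrite mulN1r lerN2.
Qed.

End representation.
End envelope_duality.

(** * Envelopes as harmonic extensions, and the equivalence *)

Section poisson_sets.
Context {R : realType} {n : nat} (m : nat).
Local Notation Cn := (Cn R n).
Local Notation borelCn := (borelCn R n).
Variable X : set Cn.
Hypotheses (cX : compact X) (n0 : (0 < n)%N).
Implicit Types (mu nu : probability borelCn R) (u v f g : Cn -> R) (z : Cn).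
Local Notation B := (silov_boundary m X).

Lemma eq_on_borel_integral mu nu (A : set Cn) (f : Cn -> \bar R) :
  eq_on_borel mu nu -> (\int[mu]_(x in A) f x = \int[nu]_(x in A) f x)%E.
Proof. by move=> E; apply: eq_measure_integral => C mC _; exact: E. Qed.

Lemma within_continuous_integralN mu (A : set Cn) f : compact A ->
  {within A, continuous f} ->
  (\int[mu]_(x in A) ((\- f) x)%:E = - \int[mu]_(x in A) (f x)%:E)%E.
Proof.
move=> cA cf; rewrite -integralN//; apply: integrable_add_def; first exact: compact_borel.
exact: within_continuous_integrable.
Qed.

Lemma within_continuousN (A : set Cn) f : {within A, continuous f} ->
  {within A, continuous (\- f)}.
Proof. by move=> cf x; apply: cvgN; exact: cf. Qed.

Lemma usc_within_continuous u : usc_on X (EFin \o u) ->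
  usc_on X (EFin \o (\- u)) -> {within X, continuous u}.
Proof.
move=> usc lsc; apply/subspace_continuousP => x Xx.
apply/cvgrPdist_lt => e e0.
have [_ /(_ (u x + e))] := usc x Xx; rewrite lte_fin ltrDl => /(_ e0) h1.
have [_ /(_ (- u x + e))] := lsc x Xx; rewrite lte_fin ltrDl => /(_ e0) h2.
near=> y; suff : `|u x - u y| < e by [].
have : ((EFin \o u) y < (u x + e)%:E)%E by near: y.
have : ((EFin \o (\- u)%R) y < (- u x + e)%:E)%E by near: y.
rewrite /= !lte_fin => ? ?; rewrite ltr_norml; apply/andP; split; lra.
Unshelve. all: by end_near. Qed.

Lemma jensen_boundary_ext z mu nu : jensen_boundary m X z mu ->
  jensen_boundary m X z nu ->
  (forall f, {within B, continuous f} ->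
    \int[mu]_(x in B) (f x)%:E = \int[nu]_(x in B) (f x)%:E)%E ->
  eq_on_borel mu nu.
Proof.
move=> Jmu Jnu mn; apply: (@eq_on_borel_integrals _ _ mu nu B).
- exact: silov_compact.
- exact: jensen_boundary_mass Jmu.
- exact: jensen_boundary_mass Jnu.
- by move=> f cf; apply: mn; exact: continuous_subspaceT.
Qed.

(** A supremum of continuous functions is lower semicontinuous: a competitor that is large at [z]
    stays large nearby and lies below [u]. *)
Lemma PB_envelope_lsc f u : (forall z, X z -> PB m X f z = (u z)%:E) ->
  usc_on X (EFin \o (\- u)).
Proof.
move=> uE z Xz; split; first exact: ltry.
move=> a; rewrite lte_fin => uza.
have : ((- a)%:E < PB m X f z)%E by rewrite uE// lte_fin ltrNl.
move=> /ereal_sup_gt[_ [v [Sv cv vf] <-]]; rewrite lte_fin => az.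
have [_ /(_ a)] := within_usc_on (within_continuousN cv) Xz.
rewrite lte_fin ltrNl => /(_ az); rewrite !near_withinE; apply: filterS => y vy Xy.
apply: le_lt_trans (vy Xy); rewrite lee_fin lerN2 -lee_fin -uE//.
by apply: ereal_sup_ubound; exists v.
Qed.

(** The Jensen inequality survives the supremum, since every competitor lies below [u] under the
    integral; continuity of [u] makes that integral meaningful. *)
Lemma PB_envelope_SH f u : (forall z, X z -> PB m X f z = (u z)%:E) ->
  {within X, continuous u} -> SH m X (EFin \o u).
Proof.
move=> uE cu; split; first exact: within_usc_on.
move=> z Xz mu Jmu; rewrite /= -uE//; apply: ge_ereal_sup => _ [v [Sv cv vf] <-].
have [_ h] := Sv; apply: (le_trans (h z Xz mu Jmu)).
apply: le_integral.
- exact: compact_borel.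
- exact: within_continuous_integrable.
- exact: within_continuous_integrable.
- move=> x /set_mem Xx; rewrite /= -uE//; apply: ereal_sup_ubound.
  by exists v.
Qed.

(** The measure that represents the envelope at a Choquet point can only be the Dirac mass. This is
    where the boundary values are attained; continuity carries them to the closure. *)
Lemma PB_choquet f z : {within B, continuous f} -> choquet_boundary m X z ->
  PB m X f z = (f z)%:E.
Proof.
move=> cf Oz; have [Xz Jz] := Oz; have Bz : B z by exact: subset_closure.
have [mu Jmu ->] := PB_representation cX n0 Xz cf.
have mB : measurable (B : set borelCn) by apply: compact_borel; exact: silov_compact.
rewrite (eq_on_borel_integral _ _ ((Jz mu).1 Jmu.1)) integral_dirac//.
  by rewrite diracE mem_set// mul1e.
by apply/measurable_EFinP; exact: within_continuous_measurable.
Qed.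

Lemma within_continuous_closure_eq (A : set Cn) f g :
  {within closure A, continuous f} -> {within closure A, continuous g} ->
  (forall z, A z -> f z = g z) -> forall z, closure A z -> f z = g z.
Proof.
move=> cf cg fg z Az; apply/eqP; rewrite -subr_eq0; apply/negPn/negP => fgz.
have cfg : {within closure A, continuous (f \- g)}.
  by move=> x; apply: cvgB; [exact: cf|exact: cg].
have [U oU UE] := within_open_preimage cfg (@open_neq _ 0).
have Uz : U z by have : (U `&` closure A) z by [rewrite UE; split]; case.
have [y [Ay Uy]] := Az U (open_nbhs_nbhs (conj oU Uz)).
have : (U `&` closure A) y by split => //; exact: subset_closure.
by rewrite UE => -[] /=; rewrite fg// subrr eqxx.
Qed.

Lemma symmetric_envelope_Hm f : {within B, continuous f} ->
  (forall z, X z -> PB m X (\- f) z = (- PB m X f z)%E) ->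
  exists2 u, Hm m X u & forall z, B z -> u z = f z.
Proof.
(* The integral representation makes the envelope finite on [X], so [fine] loses nothing there. *)
move=> cf sym; pose u z := fine (PB m X f z).
have uE z : X z -> PB m X f z = (u z)%:E.
  move=> Xz; rewrite /u fineK//; have [mu Jmu ->] := PB_representation cX n0 Xz cf.
  have cB := @silov_compact R n m X cX.
  exact: (integrable_fin_num (compact_borel cB) (within_continuous_integrable mu cB cf)).
have uNE z : X z -> PB m X (\- f) z = ((\- u) z)%:E by move=> Xz; rewrite sym// uE.
have cu : {within X, continuous u}.
  apply: usc_within_continuous; last exact: PB_envelope_lsc uE.
  have := PB_envelope_lsc uNE; congr (usc_on X _).
  by apply/funext => x /=; rewrite opprK.
exists u.
  split; first exact: PB_envelope_SH uE cu.
  by apply: PB_envelope_SH uNE _; exact: within_continuousN.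
apply: within_continuous_closure_eq => //.
  apply: within_continuousS cu; exact: silov_sub.
by move=> z Oz; rewrite /u PB_choquet.
Qed.

Lemma Hm_continuous u : Hm m X u -> {within X, continuous u}.
Proof. by move=> [[uu _] [lu _]]; exact: usc_within_continuous. Qed.

Lemma Hm_representation u f z mu : Hm m X u -> X z ->
  (forall x, B x -> u x = f x) -> jensen_boundary m X z mu ->
  ((u z)%:E = \int[mu]_(x in B) (f x)%:E)%E.
Proof.
move=> Hu Xz uf Jmu; have cu := Hm_continuous Hu.
have -> : (\int[mu]_(x in B) (f x)%:E = \int[mu]_(x in X) (u x)%:E)%E.
  rewrite (jensen_boundary_integral cX Jmu cu).
  by apply: eq_integral => x /set_mem Bx; rewrite uf.
have [[_ hu] [_ hNu]] := Hu; apply/eqP; rewrite eq_le hu//=; last by have [] := Jmu.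
by rewrite -leeN2 -within_continuous_integralN// hNu//; have [] := Jmu.
Qed.

End poisson_sets.

Theorem theorem5p10 (R : realType) (n m : nat) (X : set (Cn R n))
    (hX : compact X) (hm : (1 <= m <= n)%N) :
  let B := silov_boundary m X in
  let poisson :=
    forall f : Cn R n -> R, {within B, continuous f} ->
      exists2 u, Hm m X u & forall z, B z -> u z = f z in
  let unique_measure :=
    forall z, X z ->
      exists2 P, jensen_boundary m X z P &
        forall mu, jensen_boundary m X z mu -> eq_on_borel mu P in
  let symmetric_envelope :=
    forall f : Cn R n -> R, {within B, continuous f} ->
      forall z, X z -> PB m X (\- f) z = (- PB m X f z)%E in
  (poisson <-> unique_measure) /\ (unique_measure <-> symmetric_envelope).
Proof.
move=> B poisson unique_measure symmetric_envelope.
have n0 : (0 < n)%N by case/andP: hm; exact: leq_trans.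
have cB : compact B by exact: silov_compact.
have repr z f : X z -> {within B, continuous f} -> exists2 mu,
    jensen_boundary m X z mu & PB m X f z = (\int[mu]_(x in B) (f x)%:E)%E.
  by move=> Xz; exact: PB_representation.
(* The zero function is represented only for the sake of its measure: this shows that boundary
   Jensen measures exist at every point of [X]. *)
have cst0 : {within B, continuous (cst 0 : Cn R n -> R)}.
  by move=> x; exact: cst_continuous.
have poisson_unique : poisson -> unique_measure.
  move=> Pois z Xz; have [P JP _] := repr z _ Xz cst0.
  exists P => // mu Jmu; apply: (jensen_boundary_ext hX Jmu JP) => f cf.
  have [u Hu uf] := Pois f cf.
  by rewrite -(Hm_representation hX Hu Xz uf Jmu) -(Hm_representation hX Hu Xz uf JP).
have unique_symmetric : unique_measure -> symmetric_envelope.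
  move=> uniq f cf z Xz; have [P JP Puniq] := uniq z Xz.
  have [mu Jmu ->] := repr z f Xz cf.
  have [nu Jnu ->] := repr z _ Xz (within_continuousN cf).
  rewrite (eq_on_borel_integral _ _ (Puniq mu Jmu)).
  by rewrite (eq_on_borel_integral _ _ (Puniq nu Jnu)) within_continuous_integralN.
have symmetric_unique : symmetric_envelope -> unique_measure.
  move=> sym z Xz; have [P JP _] := repr z _ Xz cst0.
  (* The bound of [PB] by an integral is applied to [f] and to [\- f]; the symmetry of the envelope
     turns the second into the reverse inequality. *)
  have E f mu : {within B, continuous f} -> jensen_boundary m X z mu ->
      (\int[mu]_(x in B) (f x)%:E)%E = PB m X f z.
    move=> cf Jmu; apply/eqP; rewrite eq_le (PB_le_integral hX Xz cf Jmu) andbT.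
    rewrite -leeN2 -sym// -within_continuous_integralN//.
    exact: PB_le_integral (within_continuousN cf) Jmu.
  exists P => // mu Jmu; apply: (jensen_boundary_ext hX Jmu JP) => f cf.
  by rewrite !E.
split; last by split.
split=> // uniq f cf.
apply: symmetric_envelope_Hm => // z Xz; exact: unique_symmetric.
Qed.
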